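(* Let $F:\mathbb{C}\to\mathbb{C}$ be an entire function, $F\not\equiv 0$, and let $a_+\neq a_-$ be two equilibria of $\dot{x}=F(x)$ such that there is at least one heteroclinic orbit connecting them, i.e. an orbit $\Gamma$ with $w_+(\Gamma)=\{a_+\}$ and $w_-(\Gamma)=\{a_-\}$. Let $\mathcal{H}$ be the heteroclinic region of $F$ between $a_+$ and $a_-$. Then all orbits on $\partial\mathcal{H}\setminus\{a_+,a_-\}$ are unbounded, and $\mathcal{H}$ is unbounded.
   Context: Consider the autonomous planar system $\dot{x}=F(x)$, $x\in\mathbb{C}$, $t\in\mathbb{R}$, with flow $\Phi(t,x)$ on the maximal interval of existence; $\Gamma(x)$ is the (full) orbit through $x$. $w_+(\Gamma)$ (resp. $w_-(\Gamma)$) is the positive (resp. negative) limit set of an orbit $\Gamma$, i.e. the set of all limits in $\mathbb{C}$ along sequences of times tending to the right (resp. left) endpoint of the maximal interval of existence. Equilibria are the zeros of $F$. The heteroclinic region between $a_+$ and $a_-$ is $\mathcal{H}:=\mathcal{H}_+\cap\mathcal{H}_-$ with $\mathcal{H}_{+}:=\{x\in\mathbb{C}:w_{+}(\Gamma(x))=\{a_{+}\}\}$ and $\mathcal{H}_{-}:=\{x\in\mathbb{C}:w_{-}(\Gamma(x))=\{a_{-}\}\}$. $\partial\mathcal{H}$ is the topological boundary in $\mathbb{C}$. An orbit is unbounded if it is an unbounded subset of $\mathbb{C}$. *)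

(* Defs.v *)
From Stdlib Require Import Reals.
From Coquelicot Require Import Coquelicot.

Open Scope R_scope.

Definition entire (F : C -> C) : Prop :=
  forall z : C, ex_derive (K := C_AbsRing) (V := C_NormedModule) F z.

Definition equilibrium (F : C -> C) (a : C) : Prop := F a = RtoC 0.

(** The values of [phi] outside the open interval (al, be) are irrelevant. *)
Definition solution (F : C -> C) (x0 : C) (al be : Rbar) (phi : R -> C) : Prop :=
  Rbar_lt al 0 /\ Rbar_lt 0 be /\ phi 0 = x0 /\
  forall t : R, Rbar_lt al t -> Rbar_lt t be ->
    is_derive (K := R_AbsRing) (V := C_R_NormedModule) phi t (F (phi t)).

(** A solution without proper extension: (al, be) is the maximal interval of
    existence at x0, and phi t = Phi(t, x0) on it. *)
Definition maximal_solution (F : C -> C) (x0 : C) (al be : Rbar) (phi : R -> C)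
  : Prop :=
  solution F x0 al be phi /\
  forall (al' be' : Rbar) (psi : R -> C),
    solution F x0 al' be' psi ->
    Rbar_le al' al -> Rbar_le be be' ->
    (forall t : R, Rbar_lt al t -> Rbar_lt t be -> psi t = phi t) ->
    al' = al /\ be' = be.

Definition orbit (F : C -> C) (x : C) : C -> Prop := fun y =>
  exists (al be : Rbar) (phi : R -> C),
    maximal_solution F x al be phi /\
    exists t : R, Rbar_lt al t /\ Rbar_lt t be /\ phi t = y.

Definition set_eq (A B : C -> Prop) : Prop := forall z : C, A z <-> B z.

Definition singleton (a : C) : C -> Prop := fun z => z = a.

Definition is_orbit (F : C -> C) (G : C -> Prop) : Prop :=
  exists x : C, set_eq G (orbit F x).

(** Limit sets of an orbit G. Since the system is autonomous, the choice of the
    base point x on G only shifts time and does not affect the set. *)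
Definition w_plus (F : C -> C) (G : C -> Prop) : C -> Prop := fun y =>
  exists (x : C) (al be : Rbar) (phi : R -> C) (t : nat -> R),
    G x /\ maximal_solution F x al be phi /\
    (forall n : nat, Rbar_lt al (t n) /\ Rbar_lt (t n) be) /\
    is_lim_seq t be /\
    filterlim (fun n : nat => phi (t n)) eventually
      (locally (T := C_UniformSpace) y).

Definition w_minus (F : C -> C) (G : C -> Prop) : C -> Prop := fun y =>
  exists (x : C) (al be : Rbar) (phi : R -> C) (t : nat -> R),
    G x /\ maximal_solution F x al be phi /\
    (forall n : nat, Rbar_lt al (t n) /\ Rbar_lt (t n) be) /\
    is_lim_seq t al /\
    filterlim (fun n : nat => phi (t n)) eventually
      (locally (T := C_UniformSpace) y).

Definition connects (F : C -> C) (G : C -> Prop) (ap am : C) : Prop :=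
  set_eq (w_plus F G) (singleton ap) /\ set_eq (w_minus F G) (singleton am).

Definition H_plus (F : C -> C) (ap : C) : C -> Prop := fun x =>
  set_eq (w_plus F (orbit F x)) (singleton ap).

Definition H_minus (F : C -> C) (am : C) : C -> Prop := fun x =>
  set_eq (w_minus F (orbit F x)) (singleton am).

Definition heteroclinic_region (F : C -> C) (ap am : C) : C -> Prop := fun x =>
  H_plus F ap x /\ H_minus F am x.

Definition interior (D : C -> Prop) : C -> Prop := fun x =>
  locally (T := C_UniformSpace) x D.

Definition closure (D : C -> Prop) : C -> Prop := fun x =>
  forall P : C -> Prop, locally (T := C_UniformSpace) x P ->
    exists y : C, P y /\ D y.

Definition boundary (D : C -> Prop) : C -> Prop := fun x =>
  closure D x /\ ~ interior D x.

Definition unbounded (D : C -> Prop) : Prop :=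
  ~ exists M : R, forall z : C, D z -> Cmod z <= M.

(* Main.v *)
Require Import Defs.
From Stdlib Require Import Reals Lra Lia Psatz ClassicalEpsilon FunctionalExtensionality Ranalysis5.
From Coquelicot Require Import Coquelicot.

(** Let [phi] be a solution that stays in a disc and starts at [x] with [F x <> 0]. Following the
    fields [c u * F], [c u] complex and small, from every point [phi t] moves [phi] to a solution
    starting at any prescribed point [y] near [x], because flows of complex multiples of [F] commute.
    Equilibria are fixed by this motion, so by Gronwall the distance to an equilibrium changes at most
    by a constant factor, uniformly in [t]; hence [y] lies in the heteroclinic region iff [x] does.
    Therefore the region is open, and a boundary point with a bounded orbit is an equilibrium.
    Near any equilibrium every orbit stays near it in forward or in backward time: for a simple zero
    by a Lyapunov function built from a primitive of the regular part of [1 / F], for a zero of order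
    [n + 1] by the coordinate [(z - b)^-n]. So no equilibrium other than the two ends is a boundary
    point. If the region were bounded, three rays issued from one of its points would meet the
    boundary in three distinct points, whose orbits are bounded by continuous dependence.

    Since differentiability is only assumed pointwise, the Taylor estimates for [F] come from Cauchy's
    formula, itself obtained from Goursat's bisection applied to a homotopy of circles. *)

Open Scope R_scope.

(** * Curves and complex differentiability *)

(** Neither end of a heteroclinic orbit is assumed to be attracting or repelling, so openness of the
    region cannot be read off from basins. Holomorphy offers a substitute: the fields [F] and [i F]
    commute, and where [F] does not vanish they span the plane, so that a straight segment from x to
    y becomes an integral curve of [c u * F] for a suitable [c]. The same [u]-dependent field then
    acts on all points of the orbit at once. Its size is governed by [c] alone, so only boundedness
    of the orbit enters and not its limits. This is why membership is carried in both directions,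
    and why one argument serves both a point of the region and a boundary point outside it. At an
    equilibrium the fields [c u * F] vanish and the method stops. There, trapping in a single time
    direction is enough, because a heteroclinic orbit with other ends has to leave a small
    neighbourhood in both directions. Three is the right number of rays: the boundary argument
    leaves only the two ends as candidates for boundary points with bounded orbits. *)

Definition ccont (f : R -> C) (t : R) : Prop :=
  forall e, 0 < e -> exists d, 0 < d /\
    forall s, Rabs (s - t) < d -> Cmod (f s - f t) < e.

Definition cder (f : R -> C) (t : R) (l : C) : Prop :=
  forall e, 0 < e -> exists d, 0 < d /\
    forall s, Rabs (s - t) < d ->
      Cmod (f s - f t - RtoC (s - t) * l) <= e * Rabs (s - t).

Definition hol (f : C -> C) (z l : C) : Prop :=
  forall e, 0 < e -> exists d, 0 < d /\
    forall w, Cmod (w - z) < d ->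
      Cmod (f w - f z - l * (w - z)) <= e * Cmod (w - z).

Definition hcont (f : C -> C) (z : C) : Prop :=
  forall e, 0 < e -> exists d, 0 < d /\
    forall w, Cmod (w - z) < d -> Cmod (f w - f z) < e.

Lemma norm_Cmod (z : C) : @norm R_AbsRing C_R_NormedModule z = Cmod z.
Proof.
  unfold norm; simpl. unfold prod_norm, Cmod. f_equal.
  unfold norm; simpl. unfold abs; simpl.
  rewrite !Rmult_1_r.
  rewrite <- !Rabs_mult. rewrite !(Rabs_pos_eq (_ * _)); nra.
Qed.

Lemma Cmod_sym (a b : C) : Cmod (a - b) = Cmod (b - a).
Proof. rewrite <- Cmod_opp. f_equal. ring. Qed.

Lemma Cmod_tri (a b c : C) : Cmod (a - c) <= Cmod (a - b) + Cmod (b - c).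
Proof. replace (a - c)%C with ((a - b) + (b - c))%C by ring. apply Cmod_triangle. Qed.

Lemma Cmod_minus_le (a b : C) : Cmod (a - b) <= Cmod a + Cmod b.
Proof. unfold Cminus. rewrite <- (Cmod_opp b). apply Cmod_triangle. Qed.

Lemma Cmod_rev (a b : C) : Cmod a - Cmod b <= Cmod (a - b).
Proof. pose proof (Cmod_triangle (a - b) b) as H.
  replace (a - b + b)%C with a in H by ring. lra. Qed.

Lemma Cmod_abs_fst (z : C) : Rabs (fst z) <= Cmod z.
Proof. eapply Rle_trans; [apply Rmax_l | apply Rmax_Cmod]. Qed.

Lemma Cmod_abs_snd (z : C) : Rabs (snd z) <= Cmod z.
Proof. eapply Rle_trans; [apply Rmax_r | apply Rmax_Cmod]. Qed.

Lemma Cmod_le_sum (z : C) : Cmod z <= Rabs (fst z) + Rabs (snd z).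
Proof.
  destruct z as [x y]; simpl.
  replace (x, y) with ((RtoC x) + (0, y))%C
    by (unfold RtoC, Cplus; simpl; f_equal; ring).
  eapply Rle_trans; [apply Cmod_triangle|].
  rewrite Cmod_R. apply Rplus_le_compat_l.
  unfold Cmod; simpl. right.
  replace (0 * (0 * 1) + y * (y * 1)) with (y * y) by ring.
  apply sqrt_Rsqr_abs.
Qed.

Lemma Cmod_sq (z : C) : Cmod z * Cmod z = fst z * fst z + snd z * snd z.
Proof.
  unfold Cmod. rewrite sqrt_sqrt; simpl; nra.
Qed.

(** Balls of the product structure on [C] are squares; a square of half-side d contains the disc of
    radius d and lies in the disc of radius 2 d. *)
Lemma locally_Cmod (z : C) (P : C -> Prop) :
  locally (T := C_UniformSpace) z P <->
  exists d, 0 < d /\ forall w, Cmod (w - z) < d -> P w.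
Proof.
  split.
  - intros [d Hd]. exists d. split; [apply cond_pos|]. intros w Hw. apply Hd.
    split.
    + eapply Rle_lt_trans; [|exact Hw]. exact (Cmod_abs_fst (w - z)).
    + eapply Rle_lt_trans; [|exact Hw]. exact (Cmod_abs_snd (w - z)).
  - intros [d [Hd H]]. assert (Hd2 : 0 < d / 2) by lra.
    exists (mkposreal _ Hd2). intros w [H1 H2]. apply H.
    eapply Rle_lt_trans; [apply Cmod_le_sum|].
    unfold ball in H1, H2; simpl in H1, H2. unfold AbsRing_ball in H1, H2; simpl in *.
    unfold abs, minus, plus, opp in H1, H2; simpl in *. lra.
Qed.

Lemma locally_R (t : R) (P : R -> Prop) :
  locally t P <-> exists d, 0 < d /\ forall s, Rabs (s - t) < d -> P s.
Proof.
  split.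
  - intros [d Hd]. exists d. split; [apply cond_pos|]. intros w Hw. apply Hd. exact Hw.
  - intros [d [Hd H]]. exists (mkposreal _ Hd). intros s Hs. apply H. exact Hs.
Qed.

Lemma ccont_iff (f : R -> C) t :
  ccont f t <-> continuous (U := C_UniformSpace) f t.
Proof.
  split.
  - intros H P HP. apply locally_Cmod in HP. destruct HP as [e [He HP]].
    destruct (H e He) as [d [Hd Hs]]. apply locally_R. exists d. split; auto.
  - intros H e He.
    assert (HP : locally (T := C_UniformSpace) (f t) (fun w => Cmod (w - f t) < e)).
    { apply locally_Cmod. exists e. split; auto. }
    specialize (H _ HP). apply locally_R in H. exact H.
Qed.

Lemma cder_iff (f : R -> C) t l :
  cder f t l <-> is_derive (K := R_AbsRing) (V := C_R_NormedModule) f t l.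
Proof.
  split.
  - intros H. split; [apply is_linear_scal_l|].
    intros x Hx. apply (is_filter_lim_locally_unique (V := R_NormedModule) t x) in Hx. subst x.
    intros e. apply locally_R. destruct (H e (cond_pos e)) as [d [Hd Hs]].
    exists d. split; auto. intros s Hs'. specialize (Hs s Hs').
    rewrite norm_Cmod.
    rewrite <- scal_R_Cmult in Hs. exact Hs.
  - intros [_ H] e He. specialize (H t (fun P h => h) (mkposreal e He)).
    apply locally_R in H. destruct H as [d [Hd Hs]]. exists d. split; auto.
    intros s Hs'. specialize (Hs s Hs'). rewrite norm_Cmod in Hs.
    rewrite <- scal_R_Cmult. exact Hs.
Qed.

Lemma hol_of_derive (f : C -> C) z l :
  is_derive (K := C_AbsRing) (V := C_NormedModule) f z l -> hol f z l.
Proof.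
  intros [_ H] e He. specialize (H z (fun P h => h) (mkposreal e He)).
  (* Over [C_AbsRing] both the balls and the norm are given by [Cmod], so discs appear directly and
     no squares intervene. *)
  change (locally (T := AbsRing_UniformSpace C_AbsRing) z
    (fun x => Cmod (minus (minus (f x) (f z)) (scal (minus x z) l)) <= e * Cmod (minus x z))) in H.
  destruct H as [d Hd]. exists d. split; [apply cond_pos|].
  intros w Hw. specialize (Hd w Hw).
  replace (l * (w - z))%C with ((w - z) * l)%C by ring. exact Hd.
Qed.

Lemma entire_hol (F : C -> C) : entire F -> exists F', forall z, hol F z (F' z).
Proof.
  intros H. exists (fun z => epsilon (inhabits (RtoC 0)) (fun l => hol F z l)).
  intros z. apply epsilon_spec. destruct (H z) as [l Hl]. exists l.
  apply hol_of_derive, Hl.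
Qed.

Lemma hol_hcont f z l : hol f z l -> hcont f z.
Proof.
  intros H e He. destruct (H 1 Rlt_0_1) as [d [Hd Hs]].
  set (K := 1 + Cmod l + 1).
  assert (HK : 0 < K) by (unfold K; pose proof (Cmod_ge_0 l); lra).
  exists (Rmin d (e / K)). split.
  - apply Rmin_pos; auto. apply Rdiv_lt_0_compat; auto.
  - intros w Hw. pose proof (Rmin_l d (e / K)). pose proof (Rmin_r d (e / K)).
    specialize (Hs w ltac:(lra)).
    replace (f w - f z)%C with ((f w - f z - l * (w - z)) + l * (w - z))%C by ring.
    eapply Rle_lt_trans; [apply Cmod_triangle|]. rewrite Cmod_mult.
    assert (Cmod (w - z) * K < e).
    { apply Rlt_le_trans with (e / K * K). apply Rmult_lt_compat_r; lra. right; field; lra. }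
    unfold K in *. pose proof (Cmod_ge_0 (w - z)). nra.
Qed.

Lemma cder_ccont f t l : cder f t l -> ccont f t.
Proof.
  intros H e He. destruct (H 1 Rlt_0_1) as [d [Hd Hs]].
  set (K := 1 + Cmod l + 1).
  assert (HK : 0 < K) by (unfold K; pose proof (Cmod_ge_0 l); lra).
  exists (Rmin d (e / K)). split.
  - apply Rmin_pos; auto. apply Rdiv_lt_0_compat; auto.
  - intros w Hw. pose proof (Rmin_l d (e / K)). pose proof (Rmin_r d (e / K)).
    specialize (Hs w ltac:(lra)).
    replace (f w - f t)%C with ((f w - f t - RtoC (w - t) * l) + RtoC (w - t) * l)%C by ring.
    eapply Rle_lt_trans; [apply Cmod_triangle|]. rewrite Cmod_mult, Cmod_R.
    assert (Rabs (w - t) * K < e).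
    { apply Rlt_le_trans with (e / K * K). apply Rmult_lt_compat_r; lra. right; field; lra. }
    unfold K in *. pose proof (Rabs_pos (w - t)). nra.
Qed.

Lemma hcont_comp f g t : ccont g t -> hcont f (g t) -> ccont (fun s => f (g s)) t.
Proof.
  intros Hg Hf e He. destruct (Hf e He) as [d [Hd Hs]].
  destruct (Hg d Hd) as [d' [Hd' Hs']]. exists d'. split; auto.
Qed.

Lemma ccont_plus f g t : ccont f t -> ccont g t -> ccont (fun s => f s + g s)%C t.
Proof.
  rewrite !ccont_iff. intros. apply (continuous_plus (V := C_R_NormedModule) f g); auto.
Qed.

Lemma ccont_const c t : ccont (fun _ => c) t.
Proof. intros e He. exists 1. split; [lra|]. intros. replace (c - c)%C with (RtoC 0) by ring. rewrite Cmod_0. auto. Qed.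

Lemma ccont_mult f g t : ccont f t -> ccont g t -> ccont (fun s => f s * g s)%C t.
Proof.
  intros Hf Hg e He.
  set (K := Cmod (f t) + Cmod (g t) + 2).
  pose proof (Cmod_ge_0 (f t)). pose proof (Cmod_ge_0 (g t)).
  assert (HK : 0 < K) by (unfold K; lra).
  assert (He' : 0 < Rmin 1 (e / K)) by (apply Rmin_pos; [lra|apply Rdiv_lt_0_compat; auto]).
  destruct (Hf _ He') as [d1 [Hd1 A1]]. destruct (Hg _ He') as [d2 [Hd2 A2]].
  exists (Rmin d1 d2). split; [apply Rmin_pos; auto|]. intros s Hs.
  pose proof (Rmin_l d1 d2). pose proof (Rmin_r d1 d2).
  specialize (A1 s ltac:(lra)). specialize (A2 s ltac:(lra)).
  pose proof (Rmin_l 1 (e / K)). pose proof (Rmin_r 1 (e / K)).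
  replace (f s * g s - f t * g t)%C with ((f s - f t) * (g s - g t) + (f s - f t) * g t + f t * (g s - g t))%C by ring.
  set (m := Rmin 1 (e / K)) in *.
  eapply Rle_lt_trans; [apply Cmod_triangle|].
  eapply Rle_lt_trans; [apply Rplus_le_compat_r, Cmod_triangle|]. rewrite !Cmod_mult.
  assert (m * K <= e) by (apply Rle_trans with (e / K * K); [apply Rmult_le_compat_r; lra| right; field; lra]).
  pose proof (Cmod_ge_0 (f s - f t)). pose proof (Cmod_ge_0 (g s - g t)).
  unfold K in *. nra.
Qed.

Lemma hol_plus f g z a b : hol f z a -> hol g z b -> hol (fun w => f w + g w)%C z (a + b).
Proof.
  intros Hf Hg e He. destruct (Hf (e / 2) ltac:(lra)) as [d1 [Hd1 A1]].
  destruct (Hg (e / 2) ltac:(lra)) as [d2 [Hd2 A2]].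
  exists (Rmin d1 d2). split; [apply Rmin_pos; auto|]. intros s Hs.
  pose proof (Rmin_l d1 d2). pose proof (Rmin_r d1 d2).
  specialize (A1 s ltac:(lra)). specialize (A2 s ltac:(lra)).
  replace (f s + g s - (f z + g z) - (a + b) * (s - z))%C with ((f s - f z - a * (s - z)) + (g s - g z - b * (s - z)))%C by ring.
  eapply Rle_trans; [apply Cmod_triangle|]. lra.
Qed.

Lemma cder_plus f g t a b : cder f t a -> cder g t b -> cder (fun w => f w + g w)%C t (a + b).
Proof.
  rewrite !cder_iff. intros. apply (is_derive_plus (V := C_R_NormedModule) f g); auto.
Qed.

Lemma cder_const c t : cder (fun _ => c) t 0.
Proof. apply cder_iff. apply (is_derive_const (V := C_R_NormedModule)). Qed.

Lemma hol_const c z : hol (fun _ => c) z 0.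
Proof. intros e He. exists 1. split; [lra|]. intros.
  replace (c - c - 0 * (w - z))%C with (RtoC 0) by ring. rewrite Cmod_0. apply Rmult_le_pos; [lra|apply Cmod_ge_0]. Qed.

Lemma hol_id z : hol (fun w => w) z 1.
Proof. intros e He. exists 1. split; [lra|]. intros.
  replace (w - z - 1 * (w - z))%C with (RtoC 0) by ring. rewrite Cmod_0. apply Rmult_le_pos; [lra|apply Cmod_ge_0]. Qed.

Lemma hol_mult f g z a b : hol f z a -> hol g z b ->
  hol (fun w => f w * g w)%C z (a * g z + f z * b).
Proof.
  intros Hf Hg e He. pose proof (hol_hcont _ _ _ Hg) as Cg.
  set (K := Cmod (f z) + Cmod (g z) + Cmod a + 2).
  pose proof (Cmod_ge_0 (f z)). pose proof (Cmod_ge_0 (g z)). pose proof (Cmod_ge_0 a).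
  assert (HK : 0 < K) by (unfold K; lra).
  assert (He' : 0 < Rmin 1 (e / K)) by (apply Rmin_pos; [lra|apply Rdiv_lt_0_compat; auto]).
  destruct (Hf _ He') as [d1 [Hd1 A1]]. destruct (Hg _ He') as [d2 [Hd2 A2]].
  destruct (Cg _ He') as [d3 [Hd3 A3]].
  exists (Rmin d1 (Rmin d2 d3)). split; [repeat apply Rmin_pos; auto|]. intros w Hw.
  pose proof (Rmin_l d1 (Rmin d2 d3)). pose proof (Rmin_r d1 (Rmin d2 d3)).
  pose proof (Rmin_l d2 d3). pose proof (Rmin_r d2 d3).
  specialize (A1 w ltac:(lra)). specialize (A2 w ltac:(lra)). specialize (A3 w ltac:(lra)).
  pose proof (Rmin_l 1 (e / K)). pose proof (Rmin_r 1 (e / K)).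
  set (m := Rmin 1 (e / K)) in *.
  replace (f w * g w - f z * g z - (a * g z + f z * b) * (w - z))%C with
    ((f w - f z - a * (w - z)) * (g z + (g w - g z)) + a * (w - z) * (g w - g z) + f z * (g w - g z - b * (w - z)))%C by ring.
  eapply Rle_trans; [apply Cmod_triangle|].
  eapply Rle_trans; [apply Rplus_le_compat_r, Cmod_triangle|]. rewrite !Cmod_mult.
  assert (m * K <= e) by (apply Rle_trans with (e / K * K); [apply Rmult_le_compat_r; lra| right; field; lra]).
  pose proof (Cmod_triangle (g z) (g w - g z)).
  pose proof (Cmod_ge_0 (g w - g z)). pose proof (Cmod_ge_0 (w - z)).
  pose proof (Cmod_ge_0 (g w - g z - b * (w - z))).
  pose proof (Cmod_ge_0 (f w - f z - a * (w - z))).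
  set (x := Cmod (w - z)) in *.
  apply Rle_trans with (m * x * (Cmod (g z) + 1) + Cmod a * x * m + Cmod (f z) * (m * x)).
  - apply Rplus_le_compat; [apply Rplus_le_compat|].
    + apply Rmult_le_compat; try apply Cmod_ge_0; lra.
    + apply Rmult_le_compat_l; [apply Rmult_le_pos; lra|lra].
    + apply Rmult_le_compat_l; lra.
  - apply Rle_trans with (m * K * x); [unfold K; nra|].
    apply Rmult_le_compat_r; lra.
Qed.

Lemma hol_inv g z b : hol g z b -> g z <> 0 -> hol (fun w => / g w)%C z (- b / (g z * g z)).
Proof.
  intros Hg Hz e He. pose proof (hol_hcont _ _ _ Hg) as Cg.
  set (p := Cmod (g z)). assert (Hp : 0 < p) by (apply Cmod_gt_0; auto).
  assert (Hp2 : 0 < p / 2) by lra.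
  (* The two summands are the coefficients of the two error terms below, once [/ Cmod (g w)] is
     bounded by [2 / p]. *)
  set (K := 2 * Cmod b / (p * p * p) + 2 / (p * p)).
  assert (Hppp : 0 < p * p * p) by (repeat apply Rmult_lt_0_compat; auto).
  assert (HK : 0 < K). { unfold K. pose proof (Cmod_ge_0 b).
    assert (0 < 2 / (p * p)) by (apply Rdiv_lt_0_compat; nra).
    assert (0 <= 2 * Cmod b / (p * p * p)) by (apply Rmult_le_pos; [lra|left; apply Rinv_0_lt_compat; auto]). lra. }
  assert (He' : 0 < e / K) by (apply Rdiv_lt_0_compat; auto).
  destruct (Hg _ He') as [d2 [Hd2 A2]].
  destruct (Cg _ (Rmin_pos _ _ He' Hp2)) as [d3 [Hd3 A3]].
  exists (Rmin d2 d3). split; [repeat apply Rmin_pos; auto|]. intros w Hw.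
  pose proof (Rmin_l d2 d3). pose proof (Rmin_r d2 d3).
  specialize (A2 w ltac:(lra)). specialize (A3 w ltac:(lra)).
  pose proof (Rmin_l (e / K) (p / 2)). pose proof (Rmin_r (e / K) (p / 2)).
  assert (Hgw : p / 2 <= Cmod (g w)).
  { pose proof (Cmod_rev (g z) (g w)) as Q. rewrite Cmod_sym in Q. fold p in Q. lra. }
  assert (Hgw0 : g w <> 0) by (apply Cmod_gt_0; lra).
  replace (/ g w - / g z - - b / (g z * g z) * (w - z))%C with
    ((b * (w - z) * (g w - g z) * / (g z * g z * g w)) - (g w - g z - b * (w - z)) * / (g z * g w))%C
    by (field; auto).
  eapply Rle_trans; [apply Cmod_minus_le|]. rewrite !Cmod_mult.
  rewrite !Cmod_inv by (repeat apply Cmult_neq_0; auto). rewrite !Cmod_mult. fold p.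
  set (q := Cmod (g w)) in *. set (x := Cmod (w - z)) in *.
  assert (0 <= x) by apply Cmod_ge_0. pose proof (Cmod_ge_0 b).
  assert (Hq : / q <= 2 / p). { replace (2 / p) with (/ (p / 2)) by (field; lra). apply Rinv_le_contravar; lra. }
  assert (0 < / q) by (apply Rinv_0_lt_compat; lra).
  assert (0 < / p) by (apply Rinv_0_lt_compat; lra).
  assert (H10 : / (p * p * q) <= 2 / (p * p * p)).
  { rewrite !Rinv_mult. replace (2 / (p * p * p)) with (/ p * / p * (2 / p)) by (field; lra).
    apply Rmult_le_compat_l; nra. }
  assert (H11 : / (p * q) <= 2 / (p * p)).
  { rewrite !Rinv_mult. replace (2 / (p * p)) with (/ p * (2 / p)) by (field; lra).
    apply Rmult_le_compat_l; nra. }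
  apply Rle_trans with (Cmod b * x * (e / K) * (2 / (p * p * p)) + (e / K * x) * (2 / (p * p))).
  - apply Rplus_le_compat.
    + apply Rmult_le_compat; auto.
      * repeat apply Rmult_le_pos; auto; apply Cmod_ge_0.
      * left. apply Rinv_0_lt_compat. apply Rmult_lt_0_compat; nra.
      * apply Rmult_le_compat_l; [nra|]. lra.
    + apply Rmult_le_compat; auto.
      * apply Cmod_ge_0.
      * left. apply Rinv_0_lt_compat. nra.
  - right. transitivity (e / K * K * x); [unfold K; field; lra|field; lra].
Qed.

Lemma hol_div f g z a b : hol f z a -> hol g z b -> g z <> 0 ->
  hol (fun w => f w / g w)%C z ((a * g z - f z * b) / (g z * g z)).
Proof.
  intros Hf Hg Hz.
  replace ((a * g z - f z * b) / (g z * g z))%C with (a * / g z + f z * (- b / (g z * g z)))%C by (field; auto).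
  apply (hol_mult f (fun w => / g w)%C); auto. apply hol_inv; auto.
Qed.

Lemma hol_unique f z a b : hol f z a -> hol f z b -> a = b.
Proof.
  intros Ha Hb. destruct (Ceq_dec a b) as [|Hn]; auto. exfalso.
  assert (Hp : 0 < Cmod (a - b)) by (apply Cmod_gt_0, Cminus_eq_contra; auto).
  (* With this [e] the two Taylor errors at the test point add up to half of [Cmod (a - b) * d],
     which is too little. *)
  set (e := Cmod (a - b) / 4). assert (He : 0 < e) by (unfold e; lra).
  destruct (Ha e He) as [d1 [Hd1 A1]]. destruct (Hb e He) as [d2 [Hd2 A2]].
  set (d := Rmin d1 d2 / 2). assert (0 < Rmin d1 d2) by (apply Rmin_pos; auto).
  assert (Hd : 0 < d) by (unfold d; lra).
  pose proof (Rmin_l d1 d2). pose proof (Rmin_r d1 d2).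
  assert (E : Cmod (z + RtoC d - z) = d).
  { replace (z + RtoC d - z)%C with (RtoC d) by ring. rewrite Cmod_R. apply Rabs_pos_eq. lra. }
  specialize (A1 (z + RtoC d)%C). specialize (A2 (z + RtoC d)%C). rewrite E in A1, A2.
  assert (K1 := A1 ltac:(unfold d; lra)). assert (K2 := A2 ltac:(unfold d; lra)).
  pose proof (Cmod_tri (a * (z + RtoC d - z)) (f (z + RtoC d)%C - f z) (b * (z + RtoC d - z))) as T.
  rewrite (Cmod_sym (a * (z + RtoC d - z)) (f (z + RtoC d)%C - f z)) in T.
  replace (a * (z + RtoC d - z) - b * (z + RtoC d - z))%C with ((a - b) * (z + RtoC d - z))%C in T by ring.
  rewrite Cmod_mult, E in T. unfold e in *. nra.
Qed.

Lemma cder_comp f g t l v : cder g t v -> hol f (g t) l -> cder (fun s => f (g s)) t (l * v).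
Proof.
  intros Hg Hf e He. pose proof (cder_ccont _ _ _ Hg) as Cg.
  set (K := Cmod v + 1 + Cmod l). pose proof (Cmod_ge_0 v). pose proof (Cmod_ge_0 l).
  assert (HK : 0 < K) by (unfold K; lra).
  assert (He' : 0 < Rmin 1 (e / K)) by (apply Rmin_pos; [lra|apply Rdiv_lt_0_compat; auto]).
  destruct (Hf _ He') as [d1 [Hd1 A1]]. destruct (Hg _ He') as [d2 [Hd2 A2]].
  destruct (Cg _ Hd1) as [d3 [Hd3 A3]].
  exists (Rmin d2 d3). split; [apply Rmin_pos; auto|]. intros s Hs.
  pose proof (Rmin_l d2 d3). pose proof (Rmin_r d2 d3).
  specialize (A3 s ltac:(lra)). specialize (A1 _ A3). specialize (A2 s ltac:(lra)).
  pose proof (Rmin_l 1 (e / K)). pose proof (Rmin_r 1 (e / K)).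
  set (m := Rmin 1 (e / K)) in *.
  assert (m * K <= e) by (apply Rle_trans with (e / K * K); [apply Rmult_le_compat_r; lra| right; field; lra]).
  replace (f (g s) - f (g t) - RtoC (s - t) * (l * v))%C with
    ((f (g s) - f (g t) - l * (g s - g t)) + l * (g s - g t - RtoC (s - t) * v))%C by ring.
  eapply Rle_trans; [apply Cmod_triangle|]. rewrite Cmod_mult.
  set (x := Rabs (s - t)) in *. assert (0 <= x) by apply Rabs_pos.
  assert (Hgs : Cmod (g s - g t) <= (Cmod v + 1) * x).
  { replace (g s - g t)%C with ((g s - g t - RtoC (s - t) * v) + RtoC (s - t) * v)%C by ring.
    eapply Rle_trans; [apply Cmod_triangle|]. rewrite Cmod_mult, Cmod_R. fold x. nra. }
  apply Rle_trans with (m * ((Cmod v + 1) * x) + Cmod l * (m * x)).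
  - apply Rplus_le_compat; [|apply Rmult_le_compat_l; lra].
    eapply Rle_trans; [exact A1|]. apply Rmult_le_compat_l; lra.
  - unfold K in *. nra.
Qed.

Lemma hol_eq f z a b : hol f z a -> a = b -> hol f z b.
Proof. intros H <-; exact H. Qed.

Lemma cder_eq f t a b : cder f t a -> a = b -> cder f t b.
Proof. intros H <-; exact H. Qed.

Lemma hol_scal f z a k : hol f z a -> hol (fun w => k * f w)%C z (k * a).
Proof.
  intros H. eapply hol_eq; [apply (hol_mult (fun _ => k) f); [apply hol_const|exact H]|].
  simpl; ring.
Qed.

Lemma cder_scal f t a k : cder f t a -> cder (fun s => k * f s)%C t (k * a).
Proof.
  intros H. apply (cder_comp (fun w => k * w)%C f t k a H).
  eapply hol_eq; [apply (hol_scal (fun w => w)), hol_id|]. ring.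
Qed.

Lemma cder_minus f g t a b : cder f t a -> cder g t b -> cder (fun s => f s - g s)%C t (a - b).
Proof.
  rewrite !cder_iff. intros. apply (is_derive_minus (V := C_R_NormedModule) f g); auto.
Qed.

Lemma cder_ext f g t a : (forall s, f s = g s) -> cder f t a -> cder g t a.
Proof.
  intros E H e He. destruct (H e He) as [d [Hd A]]. exists d. split; auto.
  intros s Hs. rewrite <- !E. auto.
Qed.

(* Polarization reduces the product rule to the chain rule for squaring. *)
Lemma cder_mult f g t a b : cder f t a -> cder g t b ->
  cder (fun s => f s * g s)%C t (a * g t + f t * b).
Proof.
  intros Hf Hg.
  assert (S : forall h c, cder h t c -> cder (fun s => h s * h s)%C t (RtoC 2 * h t * c)).
  { intros h c Hh. refine (cder_comp (fun w => w * w)%C h t (RtoC 2 * h t) c Hh _).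
    eapply hol_eq; [apply (hol_mult (fun w => w) (fun w => w)); apply hol_id|]. ring. }
  pose proof (S _ _ (cder_plus _ _ _ _ _ Hf Hg)) as A1.
  pose proof (cder_scal _ _ _ (RtoC (/2)) (cder_minus _ _ _ _ _ A1 (cder_plus _ _ _ _ _ (S _ _ Hf) (S _ _ Hg)))) as A3.
  simpl in A3. rewrite RtoC_inv in A3 by lra.
  eapply cder_eq; [eapply cder_ext; [|exact A3]|]; simpl; intros; field.
Qed.

Lemma cder_fst f t l : cder f t l -> is_derive (fun s => fst (f s)) t (fst l).
Proof.
  intros H. apply is_derive_Reals. intros e He.
  destruct (H (e / 2) ltac:(lra)) as [d [Hd A]]. exists (mkposreal d Hd).
  intros h Hh Hhd. simpl in Hhd. specialize (A (t + h)).
  replace (t + h - t) with h in A by ring. specialize (A Hhd).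
  assert (0 < Rabs h) by (apply Rabs_pos_lt; auto).
  replace ((fst (f (t + h)) - fst (f t)) / h - fst l) with
    ((fst (f (t + h)) - fst (f t) - h * fst l) / h) by (field; auto).
  unfold Rdiv. rewrite Rabs_mult, Rabs_inv.
  pose proof (Cmod_abs_fst (f (t + h)%R - f t - RtoC h * l)) as B.
  replace (fst (f (t + h)%R - f t - RtoC h * l)%C) with (fst (f (t + h)) - fst (f t) - h * fst l) in B by (simpl; ring).
  apply Rle_lt_trans with (e / 2 * Rabs h * / Rabs h).
  - apply Rmult_le_compat_r; [left; apply Rinv_0_lt_compat; auto|lra].
  - field_simplify; lra.
Qed.

Lemma cder_snd f t l : cder f t l -> is_derive (fun s => snd (f s)) t (snd l).
Proof.
  (* The imaginary part of z is the real part of - i z. *)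
  intros H. pose proof (cder_fst _ _ _ (cder_scal _ _ _ (- Ci)%C H)) as A.
  simpl in A. eapply is_derive_ext; [|replace (snd l) with (- (0) * fst l - - (1) * snd l) by ring; exact A].
  intros; simpl. ring.
Qed.

Lemma cder_pair (u v : R -> R) t a b :
  is_derive u t a -> is_derive v t b -> cder (fun s => (u s, v s)) t (a, b).
Proof.
  intros Hu Hv e He. apply is_derive_Reals in Hu. apply is_derive_Reals in Hv.
  destruct (Hu (e / 2) ltac:(lra)) as [d1 A1]. destruct (Hv (e / 2) ltac:(lra)) as [d2 A2].
  pose proof (cond_pos d1). pose proof (cond_pos d2).
  exists (Rmin d1 d2). split; [apply Rmin_pos; auto|]. intros s Hs.
  pose proof (Rmin_l d1 d2). pose proof (Rmin_r d1 d2).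
  eapply Rle_trans; [apply Cmod_le_sum|]. simpl.
  destruct (Req_dec s t) as [->|Hn].
  - replace (u t + - u t + - ((t - t) * a - 0 * b)) with 0 by ring.
    replace (v t + - v t + - ((t - t) * b + 0 * a)) with 0 by ring.
    rewrite Rabs_R0. pose proof (Rabs_pos (t - t)). nra.
  - assert (Hh : s - t <> 0) by lra.
    specialize (A1 _ Hh ltac:(lra)). specialize (A2 _ Hh ltac:(lra)).
    replace (t + (s - t)) with s in A1, A2 by ring.
    assert (0 < Rabs (s - t)) by (apply Rabs_pos_lt; auto).
    replace (u s + - u t + - ((s - t) * a - 0 * b)) with (((u s - u t) / (s - t) - a) * (s - t)) by (field; auto).
    replace (v s + - v t + - ((s - t) * b + 0 * a)) with (((v s - v t) / (s - t) - b) * (s - t)) by (field; auto).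
    rewrite !Rabs_mult. nra.
Qed.

(** Distances are differentiated through their squares, since [Cmod] is not differentiable at 0. *)
Lemma cder_sq f t l : cder f t l ->
  is_derive (fun s => Cmod (f s) * Cmod (f s)) t (2 * (fst (f t) * fst l + snd (f t) * snd l)).
Proof.
  intros H. pose proof (cder_fst _ _ _ H) as A. pose proof (cder_snd _ _ _ H) as B.
  apply (is_derive_ext (fun s => fst (f s) * fst (f s) + snd (f s) * snd (f s))).
  { intros; rewrite Cmod_sq; auto. }
  replace (2 * (fst (f t) * fst l + snd (f t) * snd l)) with
    ((fst l * fst (f t) + fst (f t) * fst l) + (snd l * snd (f t) + snd (f t) * snd l)) by ring.
  apply (is_derive_plus (V := R_NormedModule)); apply (is_derive_mult (K := R_AbsRing)); auto; intros; apply Rmult_comm.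
Qed.

(** Cauchy-Schwarz from Lagrange's identity: the difference of the squares is the square of the
    cross product. *)
Lemma Cdot_le a b : fst a * fst b + snd a * snd b <= Cmod a * Cmod b.
Proof.
  apply Rsqr_incr_0_var; [|apply Rmult_le_pos; apply Cmod_ge_0].
  unfold Rsqr. replace (Cmod a * Cmod b * (Cmod a * Cmod b)) with ((Cmod a * Cmod a) * (Cmod b * Cmod b)) by ring.
  rewrite !Cmod_sq. pose proof (Rle_0_sqr (fst a * snd b - snd a * fst b)). unfold Rsqr in *. nra.
Qed.

(** * Monotonicity and Gronwall's inequality *)

Lemma decr_of_derive (g g' : R -> R) a b : a <= b ->
  (forall t, a <= t <= b -> is_derive g t (g' t)) ->
  (forall t, a <= t <= b -> g' t <= 0) -> g b <= g a.
Proof.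
  intros Hab Hd Hn. destruct (Rle_lt_or_eq_dec _ _ Hab) as [Hlt| ->]; [|lra].
  destruct (MVT_gen g a b g') as [c [Hc E]].
  - rewrite Rmin_left, Rmax_right by lra. intros; apply Hd; lra.
  - rewrite Rmin_left, Rmax_right by lra. intros t Ht.
    apply continuity_pt_filterlim, (ex_derive_continuous (K := R_AbsRing) (V := R_NormedModule) g t). exists (g' t). apply (Hd t Ht).
  - rewrite Rmin_left, Rmax_right in Hc by lra. specialize (Hn c ltac:(lra)). nra.
Qed.

(* From [(|E|^2)' <= 2 A |E|^2 + 2 B |E| <= (2 A + 1) |E|^2 + B^2]. *)
Lemma gronwall (E E' : R -> C) A B T : 0 <= A -> 0 <= B -> 0 <= T ->
  (forall t, 0 <= t <= T -> cder E t (E' t)) ->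
  (forall t, 0 <= t <= T -> Cmod (E' t) <= A * Cmod (E t) + B) ->
  Cmod (E T) <= (Cmod (E 0) + B) * exp ((2 * A + 1) * T).
Proof.
  intros HA HB HT Hd Hb.
  set (k := 2 * A + 1). assert (Hk : 1 <= k) by (unfold k; lra).
  (* The exponential weight turns the differential inequality for [|E|^2 + B^2] into monotonicity of
     [g]. *)
  set (g := fun t => (Cmod (E t) * Cmod (E t) + B * B) * exp (- k * t)).
  assert (G : g T <= g 0).
  { apply (decr_of_derive g (fun t => (2 * (fst (E t) * fst (E' t) + snd (E t) * snd (E' t))) * exp (- k * t)
      + (Cmod (E t) * Cmod (E t) + B * B) * (- k * exp (- k * t)))); auto.
    - intros t Ht. apply (is_derive_mult (K := R_AbsRing) (fun t => Cmod (E t) * Cmod (E t) + B * B) (fun t => exp (- k * t))); [| |intros; apply Rmult_comm].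
      + replace (2 * (fst (E t) * fst (E' t) + snd (E t) * snd (E' t))) with (2 * (fst (E t) * fst (E' t) + snd (E t) * snd (E' t)) + 0) by ring.
        apply (is_derive_plus (V := R_NormedModule) (fun s => Cmod (E s) * Cmod (E s)) (fun _ => B * B)).
        apply cder_sq; auto. apply (is_derive_const (V := R_NormedModule)).
      + auto_derive; auto. ring.
    - intros t Ht. pose proof (exp_pos (- k * t)).
      assert (2 * (fst (E t) * fst (E' t) + snd (E t) * snd (E' t)) <= k * (Cmod (E t) * Cmod (E t) + B * B)); [|nra].
      pose proof (Cdot_le (E t) (E' t)) as D. specialize (Hb t Ht). pose proof (Cmod_ge_0 (E t)).
      set (m := Cmod (E t)) in *. apply Rle_trans with (2 * (m * (A * m + B))); [nra|].
      unfold k. pose proof (Rle_0_sqr (m - B)). unfold Rsqr in *.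
      assert (0 <= A * (B * B)) by (apply Rmult_le_pos; nra). nra. }
  unfold g in G. rewrite Rmult_0_r, exp_0, Rmult_1_r in G.
  assert (P := exp_pos (k * T)).
  assert (X : exp (- k * T) * exp (k * T) = 1) by (rewrite <- exp_plus; replace (- k * T + k * T) with 0 by ring; apply exp_0).
  assert (Q : 1 <= exp (k * T)).
  { pose proof (exp_ineq1_le (k * T)). assert (0 <= k * T) by (apply Rmult_le_pos; lra). lra. }
  pose proof (Cmod_ge_0 (E T)). pose proof (Cmod_ge_0 (E 0)).
  set (m := Cmod (E T)) in *. set (n := Cmod (E 0)) in *. set (x := exp (k * T)) in *.
  assert (H1 : m * m + B * B <= (n * n + B * B) * x).
  { replace (m * m + B * B) with ((m * m + B * B) * exp (- k * T) * x) by (rewrite Rmult_assoc; rewrite X; ring).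
    apply Rmult_le_compat_r; lra. }
  (* Since [x] is at least 1, it may be enlarged to [x * x], which makes the right-hand side a
     perfect square. *)
  apply Rsqr_incr_0_var; [|apply Rmult_le_pos; lra]. unfold Rsqr.
  apply Rle_trans with ((n * n + B * B) * x); [nra|].
  apply Rle_trans with ((n * n + B * B) * (x * x)).
  - apply Rmult_le_compat_l; nra.
  - replace ((n + B) * x * ((n + B) * x)) with ((n + B) * (n + B) * (x * x)) by ring.
    apply Rmult_le_compat_r; nra.
Qed.

(** * Integrals of complex-valued functions of a real variable *)

Definition CI (f : R -> C) (a b : R) : C := RInt (V := C_R_CompleteNormedModule) f a b.

Definition ccont_on (f : R -> C) (a b : R) : Prop :=
  forall t, Rmin a b <= t <= Rmax a b -> ccont f t.

Lemma ccont_on_le f a b : a <= b -> (forall t, a <= t <= b -> ccont f t) -> ccont_on f a b.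
Proof. intros H A t. rewrite Rmin_left, Rmax_right by lra. auto. Qed.

Lemma CI_ex f a b : ccont_on f a b -> is_RInt (V := C_R_NormedModule) f a b (CI f a b).
Proof.
  intros H. apply (RInt_correct (V := C_R_CompleteNormedModule)).
  apply (ex_RInt_continuous (V := C_R_CompleteNormedModule)).
  intros z Hz. apply ccont_iff. auto.
Qed.

Lemma CI_bound f a b M : ccont_on f a b ->
  (forall t, Rmin a b <= t <= Rmax a b -> Cmod (f t) <= M) ->
  Cmod (CI f a b) <= Rabs (b - a) * M.
Proof.
  intros H HM. pose proof (CI_ex _ _ _ H) as I.
  destruct (Rle_dec a b) as [L|L].
  - rewrite Rmin_left, Rmax_right in HM by lra. rewrite Rabs_pos_eq by lra.
    rewrite <- norm_Cmod. apply (norm_RInt_le_const (V := C_R_NormedModule) f a b); auto.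
    intros. rewrite norm_Cmod. auto.
  - rewrite Rmin_right, Rmax_left in HM by lra. rewrite Rabs_left by lra.
    rewrite <- Cmod_opp. replace (- (b - a)) with (a - b) by ring.
    rewrite <- norm_Cmod. apply (norm_RInt_le_const (V := C_R_NormedModule) f b a); [lra| |].
    intros. rewrite norm_Cmod. auto. apply (is_RInt_swap (V := C_R_NormedModule)). auto.
Qed.

Lemma CI_unique f a b l : is_RInt (V := C_R_NormedModule) f a b l -> CI f a b = l.
Proof. apply (is_RInt_unique (V := C_R_CompleteNormedModule)). Qed.

Lemma CI_ftc g g' a b : (forall t, Rmin a b <= t <= Rmax a b -> cder g t (g' t)) ->
  ccont_on g' a b -> CI g' a b = (g b - g a)%C.
Proof.
  intros H H'. apply CI_unique. apply (is_RInt_derive (V := C_R_CompleteNormedModule) g g').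
  - intros; apply cder_iff; auto.
  - intros; apply ccont_iff; auto.
Qed.

Lemma CI_chasles f a b c : ccont_on f a b -> ccont_on f b c ->
  (CI f a b + CI f b c)%C = CI f a c.
Proof.
  intros. apply (RInt_Chasles (V := C_R_CompleteNormedModule)); eexists; apply CI_ex; auto.
Qed.

(** The integral lives in a real normed module, so a complex factor is pulled out through real and
    imaginary parts. *)
Lemma CI_scal k f a b : ccont_on f a b ->
  CI (fun t => k * f t)%C a b = (k * CI f a b)%C.
Proof.
  intros H. pose proof (CI_ex _ _ _ H) as I. apply CI_unique.
  pose proof (is_RInt_fct_extend_fst (U := R_NormedModule) (V := R_NormedModule) _ _ _ _ I) as I1.
  pose proof (is_RInt_fct_extend_snd (U := R_NormedModule) (V := R_NormedModule) _ _ _ _ I) as I2.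
  apply (is_RInt_fct_extend_pair (U := R_NormedModule) (V := R_NormedModule)); simpl.
  - apply (is_RInt_minus (V := R_NormedModule) (fun t => fst k * fst (f t)) (fun t => snd k * snd (f t)));
    apply (is_RInt_scal (V := R_NormedModule)); auto.
  - apply (is_RInt_plus (V := R_NormedModule) (fun t => fst k * snd (f t)) (fun t => snd k * fst (f t)));
    apply (is_RInt_scal (V := R_NormedModule)); auto.
Qed.

Lemma CI_minus f g a b : ccont_on f a b -> ccont_on g a b ->
  CI (fun t => f t - g t)%C a b = (CI f a b - CI g a b)%C.
Proof.
  intros. apply (RInt_minus (V := C_R_CompleteNormedModule)); eexists; apply CI_ex; auto.
Qed.

Lemma CI_ext f g a b : (forall t, Rmin a b <= t <= Rmax a b -> f t = g t) -> CI f a b = CI g a b.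
Proof.
  intros H. apply (RInt_ext (V := C_R_CompleteNormedModule)). intros; apply H; lra.
Qed.

Lemma CI_const c a b : CI (fun _ => c) a b = (RtoC (b - a) * c)%C.
Proof. unfold CI. rewrite RInt_const. apply scal_R_Cmult. Qed.

Lemma CI_cder f a t : (forall s, ccont f s) -> cder (fun s => CI f a s) t (f t).
Proof.
  intros H. apply cder_iff. apply (is_derive_RInt (V := C_R_NormedModule) f (fun s => CI f a s) a).
  - exists (mkposreal 1 Rlt_0_1). intros y _. apply CI_ex. intros s _; auto.
  - apply ccont_iff; auto.
Qed.

(** * Goursat's lemma on parameter rectangles *)

(** The supremum of the left ends lies below every right end. *)
Lemma nested_intervals (a b : nat -> R) :
  (forall n, a n <= a (S n)) -> (forall n, b (S n) <= b n) -> (forall n, a n <= b n) ->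
  exists x, forall n, a n <= x <= b n.
Proof.
  intros Ha Hb Hab.
  assert (Ma : forall n k, a n <= a (n + k)%nat).
  { intros n k; induction k; [rewrite Nat.add_0_r; lra|]. rewrite Nat.add_succ_r. specialize (Ha (n + k)%nat). lra. }
  assert (Mb : forall n k, b (n + k)%nat <= b n).
  { intros n k; induction k; [rewrite Nat.add_0_r; lra|]. rewrite Nat.add_succ_r. specialize (Hb (n + k)%nat). lra. }
  assert (M : forall n m, a n <= b m).
  { intros n m. specialize (Ma n m). specialize (Mb m n). rewrite Nat.add_comm in Mb. specialize (Hab (n + m)%nat). lra. }
  destruct (completeness (fun x => exists n, x = a n)) as [x [H1 H2]].
  - exists (b O). intros y [n ->]. apply M.
  - exists (a O), O; auto.
  - exists x. intros n. split; [apply H1; eauto|]. apply H2. intros y [m ->]. apply M.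
Qed.

(** The path integral of f dz along the arc [g], with velocity [g']. *)
Definition edge (f : C -> C) (g g' : R -> C) (a b : R) : C := CI (fun t => f (g t) * g' t)%C a b.

(** A primitive of the first-order Taylor polynomial f0 + f1 (z - z0). *)
Definition affine_prim (f0 f1 z0 z : C) : C := (f0 * z + f1 * / RtoC 2 * ((z - z0) * (z - z0)))%C.

Lemma RtoC_neq0 x : x <> 0 -> RtoC x <> RtoC 0.
Proof. intros H E. apply RtoC_inj in E. auto. Qed.

(** The affine part of [f] integrates exactly to a difference of its primitive; only the remainder,
    at most [e], times the speed, at most [K], is left. *)
Lemma edge_approx f g g' a b z0 f0 f1 e K :
  a <= b -> 0 <= e ->
  (forall t, a <= t <= b -> cder g t (g' t)) ->
  (forall t, a <= t <= b -> ccont g' t) ->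
  (forall t, a <= t <= b -> ccont (fun s => f (g s)) t) ->
  (forall t, a <= t <= b -> Cmod (g' t) <= K) ->
  (forall t, a <= t <= b -> Cmod (f (g t) - f0 - f1 * (g t - z0)) <= e) ->
  Cmod (edge f g g' a b - (affine_prim f0 f1 z0 (g b) - affine_prim f0 f1 z0 (g a))) <= (b - a) * (e * K).
Proof.
  intros Hab He Hg Hg' Hf HK Hfe.
  assert (Cg : forall t, a <= t <= b -> ccont g t) by (intros; eapply cder_ccont; eauto).
  assert (CA : forall t, a <= t <= b -> ccont (fun s => (f0 + f1 * (g s + - z0)) * g' s)%C t).
  { intros t Ht. apply ccont_mult; auto. apply ccont_plus; [apply ccont_const|].
    apply ccont_mult; [apply ccont_const|]. apply ccont_plus; auto. apply ccont_const. }
  rewrite <- (CI_ftc (fun s => affine_prim f0 f1 z0 (g s)) (fun s => (f0 + f1 * (g s + - z0)) * g' s)%C a b).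
  - unfold edge. rewrite <- CI_minus; try (apply ccont_on_le; auto).
    + rewrite <- (Rabs_pos_eq (b - a)) by lra. apply CI_bound.
      * apply ccont_on_le; auto. intros t Ht.
        apply (ccont_plus (fun s => f (g s) * g' s)%C (fun s => - ((f0 + f1 * (g s + - z0)) * g' s))%C).
        apply (ccont_mult (fun s => f (g s))); auto.
        replace (fun s => - ((f0 + f1 * (g s + - z0)) * g' s))%C with (fun s => - (1) * ((f0 + f1 * (g s + - z0)) * g' s))%C
          by (apply FunctionalExtensionality.functional_extensionality; intros; ring).
        apply ccont_mult; auto. apply ccont_const.
      * rewrite Rmin_left, Rmax_right by lra. intros t Ht.
        replace (f (g t) * g' t - (f0 + f1 * (g t + - z0)) * g' t)%C with ((f (g t) - f0 - f1 * (g t - z0)) * g' t)%C by ring.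
        rewrite Cmod_mult. apply Rmult_le_compat; try apply Cmod_ge_0; auto.
    + intros t Ht. apply (ccont_mult (fun s => f (g s))); auto.
  - rewrite Rmin_left, Rmax_right by lra. intros t Ht.
    apply (cder_comp (affine_prim f0 f1 z0) g t (f0 + f1 * (g t + - z0))%C); auto.
    unfold affine_prim. eapply hol_eq.
    + apply hol_plus. apply hol_scal, hol_id. apply hol_scal.
      apply (hol_mult (fun z => z - z0)%C (fun z => z - z0)%C); apply (hol_plus (fun z => z)); try apply hol_id; apply hol_const.
    + simpl. field.
  - apply ccont_on_le; auto.
Qed.

Record rect := Rect { ra : R; rb : R; rc : R; rd : R }.

(** The integral of f dz over the image under [s] of the positively oriented boundary of [q]; [sl]
    and [st] are the partial derivatives of [s]. Since [s] may be degenerate, the same statement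
    serves annular homotopies and triangles. *)
Definition rectint (f : C -> C) (s sl st : R -> R -> C) (q : rect) : C :=
  let (a, b, c, d) := q in
  (edge f (fun l => s l c) (fun l => sl l c) a b + edge f (s b) (st b) c d
   - edge f (fun l => s l d) (fun l => sl l d) a b - edge f (s a) (st a) c d)%C.

Definition subrect (q p : rect) : Prop :=
  ra p <= ra q /\ ra q <= rb q /\ rb q <= rb p /\ rc p <= rc q /\ rc q <= rd q /\ rd q <= rd p.

Definition quarters (q : rect) : list rect :=
  let (a, b, c, d) := q in let m := (a + b) / 2 in let n := (c + d) / 2 in
  (Rect a m c n :: Rect m b c n :: Rect a m n d :: Rect m b n d :: nil)%list.

(** Each partial derivative is continuous in its own variable, the direction of the edges along
    which it is integrated. *)
Definition C1_map (s sl st : R -> R -> C) : Prop :=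
  (forall l t, cder (fun l => s l t) l (sl l t)) /\ (forall l t, cder (s l) t (st l t)) /\
  (forall l t, ccont (fun l => sl l t) l) /\ (forall l t, ccont (st l) t).

Lemma edge_chasles f g g' a b c : a <= b -> b <= c -> (forall t, ccont g t) -> (forall t, ccont g' t) ->
  (forall t, a <= t <= c -> exists l, hol f (g t) l) ->
  (edge f g g' a b + edge f g g' b c)%C = edge f g g' a c.
Proof.
  intros Hab Hbc Hg Hg' Hf.
  assert (H : forall t, a <= t <= c -> ccont (fun t => f (g t) * g' t)%C t).
  { intros t Ht. apply (ccont_mult (fun t => f (g t))); auto. apply hcont_comp; auto.
    destruct (Hf t Ht) as [l Hl]. eapply hol_hcont; eauto. }
  apply CI_chasles; apply ccont_on_le; auto; intros; apply H; lra.
Qed.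

Definition hol_on_image (f : C -> C) (s : R -> R -> C) (q : rect) : Prop :=
  forall l t, ra q <= l <= rb q -> rc q <= t <= rd q -> exists v, hol f (s l t) v.

Lemma rectint_quarters f s sl st q : ra q <= rb q -> rc q <= rd q -> C1_map s sl st -> hol_on_image f s q ->
  rectint f s sl st q = List.fold_right Cplus 0 (List.map (rectint f s sl st) (quarters q)).
Proof.
  destruct q as [a b c d]; simpl. intros Hab Hcd [Dl [Dt [Cl Ct]]] Hf. unfold hol_on_image in Hf; simpl in Hf.
  set (m := (a + b) / 2). set (n := (c + d) / 2).
  assert (a <= m <= b) by (unfold m; lra). assert (c <= n <= d) by (unfold n; lra).
  assert (X : forall t, c <= t <= d -> (edge f (fun l => s l t) (fun l => sl l t) a m + edge f (fun l => s l t) (fun l => sl l t) m b)%C = edge f (fun l => s l t) (fun l => sl l t) a b).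
  { intros t Ht. apply edge_chasles; try lra; auto; intros. eapply cder_ccont, Dl. }
  assert (Y : forall l, a <= l <= b -> (edge f (s l) (st l) c n + edge f (s l) (st l) n d)%C = edge f (s l) (st l) c d).
  { intros l Hl. apply edge_chasles; try lra; auto; intros. eapply cder_ccont, Dt. }
  rewrite <- (X c), <- (X d), <- (Y a), <- (Y b) by lra. ring.
Qed.

Lemma quarters_sub q p : ra q <= rb q -> rc q <= rd q -> List.In p (quarters q) ->
  subrect p q /\ rb p - ra p = (rb q - ra q) / 2 /\ rd p - rc p = (rd q - rc q) / 2.
Proof.
  destruct q as [a b c d]; simpl. intros H1 H2 H.
  repeat (destruct H as [<-|H]; [unfold subrect; simpl; lra|]). contradiction.
Qed.

(** Inner edges cancel, so the integral is the sum over the four quarters, and one of them carries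
    at least a quarter of the modulus. *)
Lemma big_quarter f s sl st q : ra q <= rb q -> rc q <= rd q -> C1_map s sl st -> hol_on_image f s q ->
  exists p, subrect p q /\ rb p - ra p = (rb q - ra q) / 2 /\ rd p - rc p = (rd q - rc q) / 2 /\
    Cmod (rectint f s sl st q) <= 4 * Cmod (rectint f s sl st p).
Proof.
  intros H1 H2 HC Hf. apply Classical_Prop.NNPP. intros N.
  assert (A : forall p, List.In p (quarters q) -> 4 * Cmod (rectint f s sl st p) < Cmod (rectint f s sl st q)).
  { intros p Hp. destruct (Rlt_le_dec (4 * Cmod (rectint f s sl st p)) (Cmod (rectint f s sl st q))); auto.
    exfalso. apply N. exists p. destruct (quarters_sub q p H1 H2 Hp) as [? [? ?]]. auto. }
  pose proof (rectint_quarters f s sl st q H1 H2 HC Hf) as E.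
  destruct q as [a b c d].
  unfold quarters in *. cbv zeta in *. set (m := (a + b) / 2) in *. set (n := (c + d) / 2) in *.
  pose proof (A _ (or_introl eq_refl)) as A1.
  pose proof (A _ (or_intror (or_introl eq_refl))) as A2.
  pose proof (A _ (or_intror (or_intror (or_introl eq_refl)))) as A3.
  pose proof (A _ (or_intror (or_intror (or_intror (or_introl eq_refl))))) as A4.
  cbn [List.map List.fold_right] in E.
  set (q := rectint f s sl st {| ra := a; rb := b; rc := c; rd := d |}) in *.
  set (q1 := rectint f s sl st {| ra := a; rb := m; rc := c; rd := n |}) in *.
  set (q2 := rectint f s sl st {| ra := m; rb := b; rc := c; rd := n |}) in *.
  set (q3 := rectint f s sl st {| ra := a; rb := m; rc := n; rd := d |}) in *.
  set (q4 := rectint f s sl st {| ra := m; rb := b; rc := n; rd := d |}) in *.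
  pose proof (Cmod_triangle q1 (q2 + (q3 + (q4 + 0)))) as T1.
  pose proof (Cmod_triangle q2 (q3 + (q4 + 0))) as T2.
  pose proof (Cmod_triangle q3 (q4 + 0)) as T3.
  pose proof (Cmod_triangle q4 0) as T4. rewrite Cmod_0 in T4.
  rewrite <- E in T1. lra.
Qed.

(** Integrate the partial derivatives along an L-shaped path inside the rectangle. *)
Lemma C1_map_lip s sl st q K : C1_map s sl st ->
  (forall l t, ra q <= l <= rb q -> rc q <= t <= rd q -> Cmod (sl l t) <= K /\ Cmod (st l t) <= K) ->
  forall l t l' t', ra q <= l <= rb q -> rc q <= t <= rd q -> ra q <= l' <= rb q -> rc q <= t' <= rd q ->
  Cmod (s l t - s l' t') <= K * (Rabs (l - l') + Rabs (t - t')).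
Proof.
  intros [Dl [Dt [Cl Ct]]] HK l t l' t' Hl Ht Hl' Ht'.
  assert (I : forall a b x y z, a <= x <= b -> a <= y <= b -> Rmin x y <= z <= Rmax x y -> a <= z <= b).
  { intros a b x y z H1 H2 [H3 H4]. split.
    - eapply Rle_trans; [|exact H3]. apply Rmin_glb; lra.
    - eapply Rle_trans; [exact H4|]. apply Rmax_lub; lra. }
  eapply Rle_trans; [apply (Cmod_tri _ (s l' t))|].
  rewrite Rmult_plus_distr_l. apply Rplus_le_compat.
  - rewrite <- (CI_ftc (fun l => s l t) (fun l => sl l t) l' l); [|intros; apply Dl|intros ? _; apply Cl].
    rewrite Rmult_comm. apply CI_bound; [intros ? _; apply Cl|]. intros x Hx.
    apply HK; auto. apply (I _ _ _ _ _ Hl' Hl Hx).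
  - rewrite <- (CI_ftc (s l') (st l') t' t); [|intros; apply Dt|intros ? _; apply Ct].
    rewrite Rmult_comm. apply CI_bound; [intros ? _; apply Ct|]. intros x Hx.
    apply HK; auto. apply (I _ _ _ _ _ Ht' Ht Hx).
Qed.

(** The differences of the affine primitive telescope around the closed boundary, so that only the
    remainders on the four edges survive. *)
Lemma rectint_small f s sl st q z0 f0 f1 e K : ra q <= rb q -> rc q <= rd q -> C1_map s sl st ->
  hol_on_image f s q -> 0 <= e ->
  (forall l t, ra q <= l <= rb q -> rc q <= t <= rd q -> Cmod (sl l t) <= K /\ Cmod (st l t) <= K) ->
  (forall l t, ra q <= l <= rb q -> rc q <= t <= rd q -> Cmod (f (s l t) - f0 - f1 * (s l t - z0)) <= e) ->
  Cmod (rectint f s sl st q) <= 2 * ((rb q - ra q) + (rd q - rc q)) * (e * K).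
Proof.
  destruct q as [a b c d]; simpl. intros Hab Hcd [Dl [Dt [Cl Ct]]] Hf He HK Hfe.
  unfold hol_on_image in Hf; simpl in Hf.
  assert (X : forall t, c <= t <= d -> Cmod (edge f (fun l => s l t) (fun l => sl l t) a b - (affine_prim f0 f1 z0 (s b t) - affine_prim f0 f1 z0 (s a t))) <= (b - a) * (e * K)).
  { intros t Ht. apply (edge_approx f (fun l => s l t) (fun l => sl l t)); auto.
    - intros l Hl. apply hcont_comp; [eapply cder_ccont, Dl|]. destruct (Hf l t Hl Ht) as [v Hv]. eapply hol_hcont; eauto.
    - intros l Hl. apply HK; auto. }
  assert (Y : forall l, a <= l <= b -> Cmod (edge f (s l) (st l) c d - (affine_prim f0 f1 z0 (s l d) - affine_prim f0 f1 z0 (s l c))) <= (d - c) * (e * K)).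
  { intros l Hl. apply (edge_approx f (s l) (st l)); auto.
    - intros t Ht. apply hcont_comp; [eapply cder_ccont, Dt|]. destruct (Hf l t Hl Ht) as [v Hv]. eapply hol_hcont; eauto.
    - intros t Ht. apply HK; auto. }
  pose proof (X c ltac:(lra)) as X1. pose proof (X d ltac:(lra)) as X2.
  pose proof (Y a ltac:(lra)) as Y1. pose proof (Y b ltac:(lra)) as Y2.
  set (e1 := edge f (fun l => s l c) (fun l => sl l c) a b) in *.
  set (e2 := edge f (s b) (st b) c d) in *.
  set (e3 := edge f (fun l => s l d) (fun l => sl l d) a b) in *.
  set (e4 := edge f (s a) (st a) c d) in *.
  set (G := affine_prim f0 f1 z0) in *.
  replace (e1 + e2 - e3 - e4)%C with ((e1 - (G (s b c) - G (s a c))) + (e2 - (G (s b d) - G (s b c)))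
    - (e3 - (G (s b d) - G (s a d))) - (e4 - (G (s a d) - G (s a c))))%C by ring.
  eapply Rle_trans; [apply Cmod_minus_le|].
  eapply Rle_trans; [apply Rplus_le_compat_r, Cmod_minus_le|].
  eapply Rle_trans; [apply Rplus_le_compat_r, Rplus_le_compat_r, Cmod_triangle|]. lra.
Qed.

Lemma subrect_trans p q r : subrect p q -> subrect q r -> subrect p r.
Proof. unfold subrect; intuition lra. Qed.

Lemma bisection f s sl st q : ra q <= rb q -> rc q <= rd q -> C1_map s sl st -> hol_on_image f s q ->
  exists u : nat -> rect, u O = q /\ forall n,
    subrect (u (S n)) (u n) /\ subrect (u n) q /\
    (rb (u n) - ra (u n)) + (rd (u n) - rc (u n)) = ((rb q - ra q) + (rd q - rc q)) * (/ 2) ^ n /\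
    Cmod (rectint f s sl st q) <= 4 ^ n * Cmod (rectint f s sl st (u n)).
Proof.
  intros Hab Hcd HC Hf.
  set (P := fun p' p => subrect p' p /\ rb p' - ra p' = (rb p - ra p) / 2 /\ rd p' - rc p' = (rd p - rc p) / 2 /\
    Cmod (rectint f s sl st p) <= 4 * Cmod (rectint f s sl st p')).
  (* The choice is made for every rectangle with [q] as default; its specification is known only for
     subrectangles of [q], hence the invariant [Hs]. *)
  set (next := fun p => epsilon (inhabits q) (fun p' => P p' p)).
  set (u := fix u n := match n with O => q | S n => next (u n) end).
  assert (Hn : forall n, subrect (u n) q -> P (u (S n)) (u n)).
  { intros n Hs. simpl. unfold next. apply epsilon_spec. unfold P.
    apply big_quarter; auto; try (unfold subrect in Hs; lra).
    intros l t Hl Ht. apply Hf; unfold subrect in Hs; lra. }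
  assert (Hs : forall n, subrect (u n) q).
  { induction n; [unfold subrect; simpl; lra|]. eapply subrect_trans; [apply Hn; auto|auto]. }
  exists u. split; auto. intros n. split; [apply Hn; auto|]. split; auto.
  induction n as [|n [IH1 IH2]]; [simpl; lra|].
  destruct (Hn n (Hs n)) as [_ [W1 [W2 B]]]. split.
  - rewrite W1, W2. simpl pow. lra.
  - eapply Rle_trans; [exact IH2|]. simpl pow.
    assert (0 < 4 ^ n) by (apply pow_lt; lra). nra.
Qed.

(** On the n-th rectangle of the bisection both the perimeter and the diameter of the image are of
    order 2^-n. Differentiability at the limit point makes the integral there o(4^-n), which beats
    the factor [4 ^ n] lost in choosing quarters. *)
Lemma goursat f s sl st q K : ra q <= rb q -> rc q <= rd q -> C1_map s sl st -> hol_on_image f s q ->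
  (forall l t, ra q <= l <= rb q -> rc q <= t <= rd q -> Cmod (sl l t) <= K /\ Cmod (st l t) <= K) ->
  rectint f s sl st q = RtoC 0.
Proof.
  intros Hab Hcd HC Hf HK.
  destruct (bisection f s sl st q Hab Hcd HC Hf) as [u [_ Hu]].
  destruct (nested_intervals (fun n => ra (u n)) (fun n => rb (u n))) as [l0 Hl0].
  1-3: intros n; destruct (Hu n) as [H1 [H2 _]]; unfold subrect in *; lra.
  destruct (nested_intervals (fun n => rc (u n)) (fun n => rd (u n))) as [t0 Ht0].
  1-3: intros n; destruct (Hu n) as [H1 [H2 _]]; unfold subrect in *; lra.
  set (w := (rb q - ra q) + (rd q - rc q)) in *.
  assert (Hw : 0 <= w) by (unfold w; lra).
  assert (In0 : ra q <= l0 <= rb q /\ rc q <= t0 <= rd q).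
  { destruct (Hu O) as [_ [H _]]. specialize (Hl0 O). specialize (Ht0 O). unfold subrect in H. lra. }
  destruct In0 as [L0 T0]. destruct (Hf l0 t0 L0 T0) as [v Hv].
  assert (K0 : 0 <= K). { destruct (HK l0 t0 L0 T0) as [k _]. pose proof (Cmod_ge_0 (sl l0 t0)). lra. }
  pose proof (C1_map_lip s sl st q K HC HK) as Lip.
  apply Cmod_eq_0. apply Rle_antisym; [|apply Cmod_ge_0].
  apply le_epsilon. intros eta Heta. rewrite Rplus_0_l.
  (* The final bound is [eta / D] times [2 * w * w * K * K]; the summand 1 keeps [D] positive when
     [w] or [K] is 0. *)
  set (D := 2 * w * w * K * K + 1).
  assert (HD : 0 < D). { unfold D. assert (0 <= w * w * (K * K)) by (apply Rmult_le_pos; apply Rmult_le_pos; auto). lra. }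
  assert (He : 0 < eta / D) by (apply Rdiv_lt_0_compat; auto).
  assert (HKw : 0 <= K * w) by (apply Rmult_le_pos; auto).
  destruct (Hv _ He) as [d [Hd A]].
  destruct (pow_lt_1_zero (/ 2) ltac:(rewrite Rabs_pos_eq; lra) (d / (K * w + 1))) as [N HN].
  { apply Rdiv_lt_0_compat; lra. }
  specialize (HN N (Nat.le_refl _)). destruct (Hu N) as [_ [S1 [W B]]].
  set (h := (/ 2) ^ N) in *. assert (Hh : 0 < h) by (apply pow_lt; lra).
  rewrite Rabs_pos_eq in HN by lra.
  assert (Hsmall : K * (w * h) < d).
  { assert (h * (K * w + 1) < d). { apply Rlt_le_trans with (d / (K * w + 1) * (K * w + 1)).
      apply Rmult_lt_compat_r; lra. right; field; lra. } nra. }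
  specialize (Hl0 N). specialize (Ht0 N).
  unfold subrect in S1.
  assert (Dist : forall l t, ra (u N) <= l <= rb (u N) -> rc (u N) <= t <= rd (u N) -> Cmod (s l t - s l0 t0) <= K * (w * h)).
  { intros l t Hl Ht. eapply Rle_trans; [apply Lip; lra|]. apply Rmult_le_compat_l; auto.
    assert (Rabs (l - l0) <= rb (u N) - ra (u N)) by (apply Rabs_le; lra).
    assert (Rabs (t - t0) <= rd (u N) - rc (u N)) by (apply Rabs_le; lra). lra. }
  assert (Sm : Cmod (rectint f s sl st (u N)) <= 2 * (w * h) * (eta / D * (K * (w * h)) * K)).
  { rewrite <- W at 1. apply (rectint_small f s sl st (u N) (s l0 t0) (f (s l0 t0)) v); auto; try lra.
    - intros l t Hl Ht. apply Hf; lra.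
    - apply Rmult_le_pos; [lra|apply Rmult_le_pos; nra].
    - intros l t Hl Ht. apply HK; lra.
    - intros l t Hl Ht. specialize (Dist l t Hl Ht).
      eapply Rle_trans; [apply A; lra|]. apply Rmult_le_compat_l; lra. }
  assert (P4 : 4 ^ N * (h * h) = 1).
  { unfold h. rewrite <- !Rpow_mult_distr. replace (4 * (/ 2 * / 2)) with 1 by field. apply pow1. }
  eapply Rle_trans; [exact B|].
  apply Rle_trans with (4 ^ N * (2 * (w * h) * (eta / D * (K * (w * h)) * K))).
  - apply Rmult_le_compat_l; auto. apply pow_le; lra.
  - replace (4 ^ N * (2 * (w * h) * (eta / D * (K * (w * h)) * K))) with
      ((4 ^ N * (h * h)) * (eta / D) * (2 * w * w * K * K)) by ring.
    rewrite P4. apply Rle_trans with (1 * (eta / D) * D); [apply Rmult_le_compat_l; [lra|unfold D; lra]|].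
    right; field; lra.
Qed.

(** * Cauchy's formula and its consequences *)

Definition cis (t : R) : C := (cos t, sin t).

Lemma cis_cder t : cder cis t (Ci * cis t).
Proof.
  eapply cder_eq; [apply (cder_pair cos sin t (- sin t) (cos t))|].
  - apply is_derive_Reals, derivable_pt_lim_cos.
  - apply is_derive_Reals, derivable_pt_lim_sin.
  - unfold cis, Ci, Cmult; simpl; f_equal; ring.
Qed.

Lemma cis_Cmod t : Cmod (cis t) = 1.
Proof.
  unfold Cmod, cis; simpl. transitivity (sqrt 1); [f_equal|apply sqrt_1].
  pose proof (sin2_cos2 t). unfold Rsqr in *. lra.
Qed.

Lemma cis_2PI : cis (2 * PI) = cis 0.
Proof. unfold cis. rewrite cos_2PI, sin_2PI, cos_0, sin_0. auto. Qed.

Lemma cis_cont t : ccont cis t.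
Proof. eapply cder_ccont, cis_cder. Qed.

Lemma cis_neq0 t : cis t <> 0.
Proof. apply Cmod_gt_0. rewrite cis_Cmod. lra. Qed.

Definition circ (rho t : R) : C := (RtoC rho * cis t)%C.

Lemma circ_Cmod rho t : 0 < rho -> Cmod (circ rho t) = rho.
Proof. intros. unfold circ. rewrite Cmod_mult, cis_Cmod, Cmod_R, Rabs_pos_eq; lra. Qed.

Lemma circ_cont rho t : ccont (circ rho) t.
Proof. apply ccont_mult; [apply ccont_const|apply cis_cont]. Qed.

Lemma circ_sep rho t w : 0 < rho -> rho - Cmod w <= Cmod (circ rho t - w).
Proof. intros. rewrite <- (circ_Cmod rho t) at 1 by auto. apply Cmod_rev. Qed.

Lemma circ_neq rho t w : 0 < rho -> Cmod w < rho -> (circ rho t - w)%C <> 0.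
Proof. intros. apply Cmod_gt_0. pose proof (circ_sep rho t w H). lra. Qed.

Lemma RtoC_linear_cder (a b : R) l : cder (fun l => RtoC (a + l * b)) l (RtoC b).
Proof.
  apply (cder_pair (fun l => a + l * b) (fun _ => 0)); auto_derive; auto; ring.
Qed.

(** The linear homotopy from the circle of radius [e] about [w], at l = 0, to the circle of radius
    [rho] about 0, at l = 1. *)
Lemma circle_homotopy_C1 (w : C) (e rho : R) :
  C1_map (fun l t => RtoC (1 + l * -1) * w + RtoC (e + l * (rho - e)) * cis t)%C
    (fun l t => RtoC (-1) * w + RtoC (rho - e) * cis t)%C
    (fun l t => RtoC (e + l * (rho - e)) * (Ci * cis t))%C.
Proof.
  repeat split; intros l t.
  - eapply cder_eq; [apply cder_plus; (apply cder_mult; [apply RtoC_linear_cder|apply cder_const])|].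
    simpl. ring.
  - eapply cder_eq; [apply cder_plus; [apply cder_const|apply cder_scal, cis_cder]|]. ring.
  - apply ccont_const.
  - repeat (apply ccont_mult; [apply ccont_const|]). apply cis_cont.
Qed.

(** Goursat for F z / (z - w) along the homotopy of circles. On the large circle dz = i z dt, which
    explains the factor [circ rho t] in the numerator; on the small one the velocity i (z - w)
    cancels the denominator and leaves [F] alone. *)
Lemma circle_shrink (F : C -> C) (rho e : R) (w : C) :
  (forall z, exists l, hol F z l) -> 0 < e -> e < rho -> Cmod w < rho ->
  CI (fun t => F (circ rho t) * circ rho t / (circ rho t - w))%C 0 (2 * PI) =
  CI (fun t => F (w + RtoC e * cis t)%C) 0 (2 * PI).
Proof.
  intros HF He HeR Hw. pose proof PI_RGT_0 as Hpi.
  set (s := fun l t => (RtoC (1 + l * -1) * w + RtoC (e + l * (rho - e)) * cis t)%C).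
  set (sl := fun (l t : R) => (RtoC (-1) * w + RtoC (rho - e) * cis t)%C).
  set (st := fun l t => (RtoC (e + l * (rho - e)) * (Ci * cis t))%C).
  set (f := fun z => (F z / (z - w))%C).
  (* The homotopy avoids [w]: the distance is at least (1 - l) e + l (rho - |w|). *)
  assert (S : forall l t, 0 <= l <= 1 -> (s l t - w)%C <> 0).
  { intros l t Hl. unfold s. apply Cmod_gt_0.
    replace (RtoC (1 + l * -1) * w + RtoC (e + l * (rho - e)) * cis t - w)%C with
      (RtoC (e + l * (rho - e)) * cis t - RtoC l * w)%C
      by (rewrite !RtoC_plus, !RtoC_mult, !RtoC_minus; ring).
    pose proof (Cmod_rev (RtoC (e + l * (rho - e)) * cis t) (RtoC l * w)) as A.
    rewrite !Cmod_mult, cis_Cmod, !Cmod_R, !Rabs_pos_eq in A by nra.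
    pose proof (Cmod_ge_0 w).
    destruct (Req_dec l 0); [subst; lra|]. nra. }
  assert (G : rectint f s sl st (Rect 0 1 0 (2 * PI)) = RtoC 0).
  { apply goursat with (K := Cmod w + rho); simpl; try lra.
    - apply circle_homotopy_C1.
    - intros l t Hl Ht. simpl in *. destruct (HF (s l t)) as [v Hv]. eexists.
      apply (hol_div F (fun z => z - w)%C); [exact Hv| |apply S; auto].
      apply (hol_plus (fun z => z)); [apply hol_id|apply hol_const].
    - intros l t Hl Ht. pose proof (Cmod_ge_0 w). split.
      + unfold sl. eapply Rle_trans; [apply Cmod_triangle|].
        rewrite !Cmod_mult, cis_Cmod, !Cmod_R, (Rabs_pos_eq (rho - e)), Rabs_left by lra. lra.
      + unfold st. rewrite !Cmod_mult, cis_Cmod, Cmod_Ci, Cmod_R, Rabs_pos_eq by nra. nra. }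
  simpl in G. unfold edge in G.
  (* The edges at angles 0 and 2 PI are the same arc, so they cancel in [G] and only the two circles
     remain. *)
  assert (E : CI (fun t => f (s t 0) * sl t 0)%C 0 1 = CI (fun t => f (s t (2 * PI)%R) * sl t (2 * PI)%R)%C 0 1).
  { apply CI_ext. intros t _. unfold s, sl. rewrite cis_2PI. auto. }
  rewrite E in G.
  assert (I1 : CI (fun t => f (s 1 t) * st 1 t)%C 0 (2 * PI) =
    (Ci * CI (fun t => F (circ rho t) * circ rho t / (circ rho t - w))%C 0 (2 * PI))%C).
  { rewrite <- CI_scal.
    - apply CI_ext. intros t _. unfold f, s, st, circ.
      replace (1 + 1 * -1) with 0 by ring. replace (e + 1 * (rho - e)) with rho by ring.
      replace (0 * w + RtoC rho * cis t)%C with (circ rho t) by (unfold circ; ring).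
      fold (circ rho t). unfold Cdiv. unfold circ at 4. ring.
    - intros t _. apply (ccont_mult (fun t => F (circ rho t) * circ rho t)%C (fun t => / (circ rho t - w))%C).
      + apply (ccont_mult (fun t => F (circ rho t))); [|apply circ_cont].
        apply hcont_comp; [apply circ_cont|]. destruct (HF (circ rho t)) as [v Hv]. eapply hol_hcont; eauto.
      + apply (hcont_comp (fun z => / (z - w))%C); [apply circ_cont|]. eapply hol_hcont.
        apply (hol_inv (fun z => z - w)%C); [|apply circ_neq; lra].
        apply (hol_plus (fun z => z)); [apply hol_id|apply hol_const]. }
  assert (I0 : CI (fun t => f (s 0 t) * st 0 t)%C 0 (2 * PI) =
    (Ci * CI (fun t => F (w + RtoC e * cis t)%C) 0 (2 * PI))%C).
  { rewrite <- CI_scal.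
    - apply CI_ext. intros t _. unfold f, s, st.
      replace (1 + 0 * -1) with 1 by ring. replace (e + 0 * (rho - e)) with e by ring.
      replace (1 * w + RtoC e * cis t)%C with (w + RtoC e * cis t)%C by ring.
      replace (w + RtoC e * cis t - w)%C with (RtoC e * cis t)%C by ring.
      field. split; [apply cis_neq0|apply RtoC_neq0; lra].
    - intros t _. apply hcont_comp.
      + apply ccont_plus; [apply ccont_const|]. apply ccont_mult; [apply ccont_const|apply cis_cont].
      + destruct (HF (w + RtoC e * cis t)%C) as [v Hv]. eapply hol_hcont; eauto. }
  rewrite I1, I0 in G.
  set (X := CI (fun t => F (circ rho t) * circ rho t / (circ rho t - w))%C 0 (2 * PI)) in *.
  set (Y := CI (fun t => F (w + RtoC e * cis t)%C) 0 (2 * PI)) in *.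
  set (Z := CI (fun t => f (s t (2 * PI)%R) * sl t (2 * PI)%R)%C 0 1) in *.
  assert (G' : (Ci * (X - Y))%C = RtoC 0) by (rewrite <- G; ring).
  apply Ceq_minus. destruct (Ceq_dec (X - Y) 0) as [|N]; auto. exfalso.
  apply (Cmult_neq_0 Ci (X - Y)); auto. apply Ci_nz.
Qed.

(** By [circle_shrink] the integral is also the one over arbitrarily small circles about [w], where
    continuity of [F] applies. *)
Lemma cauchy_formula (F : C -> C) (rho : R) (w : C) :
  (forall z, exists l, hol F z l) -> 0 < rho -> Cmod w < rho ->
  CI (fun t => F (circ rho t) * circ rho t / (circ rho t - w))%C 0 (2 * PI) = (RtoC (2 * PI) * F w)%C.
Proof.
  intros HF HR Hw. pose proof PI_RGT_0 as Hpi.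
  apply Ceq_minus, Cmod_eq_0, Rle_antisym; [|apply Cmod_ge_0].
  apply le_epsilon. intros eta Heta. rewrite Rplus_0_l.
  destruct (HF w) as [l Hl]. apply hol_hcont in Hl.
  destruct (Hl (eta / (2 * PI)) ltac:(apply Rdiv_lt_0_compat; lra)) as [d [Hd A]].
  set (e := Rmin d rho / 2). assert (0 < Rmin d rho) by (apply Rmin_pos; auto).
  pose proof (Rmin_l d rho). pose proof (Rmin_r d rho).
  rewrite (circle_shrink F rho e w HF) by (unfold e; lra).
  assert (HC : forall t, ccont (fun t => F (w + RtoC e * cis t)%C) t).
  { intros t. apply hcont_comp.
    - apply ccont_plus; [apply ccont_const|]. apply ccont_mult; [apply ccont_const|apply cis_cont].
    - destruct (HF (w + RtoC e * cis t)%C) as [v Hv]. eapply hol_hcont; eauto. }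
  replace (RtoC (2 * PI) * F w)%C with (CI (fun _ => F w) 0 (2 * PI)) by (rewrite CI_const, Rminus_0_r; auto).
  rewrite <- CI_minus; [|intros t _; auto|intros t _; apply ccont_const].
  replace eta with (Rabs (2 * PI - 0) * (eta / (2 * PI))).
  2:{ rewrite Rabs_pos_eq by lra. field. lra. }
  apply CI_bound.
  - intros t _. apply (ccont_plus (fun t => F (w + RtoC e * cis t)%C) (fun _ => - F w)%C); auto. apply ccont_const.
  - intros t _. left. apply A. replace (w + RtoC e * cis t - w)%C with (RtoC e * cis t)%C by ring.
    rewrite Cmod_mult, cis_Cmod, Cmod_R, Rabs_pos_eq; unfold e; lra.
Qed.

(** The Cauchy transform of a density [g] on the circle; [cauchy_int_sq] is its derivative in [w].
    Allowing any continuous density, and not only boundary values of [F], is what later gives the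
    quotient by a linear factor. *)
Definition cauchy_int (rho : R) (g : R -> C) (w : C) : C := CI (fun t => g t * / (circ rho t - w))%C 0 (2 * PI).
Definition cauchy_int_sq (rho : R) (g : R -> C) (w : C) : C :=
  CI (fun t => g t * (/ (circ rho t - w) * / (circ rho t - w)))%C 0 (2 * PI).

Lemma circ_inv_cont rho w t : 0 < rho -> Cmod w < rho -> ccont (fun t => / (circ rho t - w))%C t.
Proof.
  intros HR Hw.
  apply (hcont_comp (fun z => / (z - w))%C); [apply circ_cont|]. eapply hol_hcont.
  apply (hol_inv (fun z => z - w)%C); [|apply circ_neq; lra].
  apply (hol_plus (fun z => z)); [apply hol_id|apply hol_const].
Qed.

Lemma circ_inv_bound rho w t : 0 < rho -> Cmod w <= rho / 2 -> Cmod (/ (circ rho t - w)) <= 2 / rho.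
Proof.
  intros HR Hw. rewrite Cmod_inv by (apply circ_neq; lra).
  replace (2 / rho) with (/ (rho / 2)) by (field; lra).
  apply Rinv_le_contravar; [lra|]. pose proof (circ_sep rho t w HR). lra.
Qed.

Lemma cauchy_int_bound rho g G w : 0 < rho -> (forall t, ccont g t) -> (forall t, 0 <= t <= 2 * PI -> Cmod (g t) <= G) ->
  Cmod w <= rho / 2 -> Cmod (cauchy_int rho g w) <= 2 * PI * (G * (2 / rho)).
Proof.
  intros HR Cg HG Hw. pose proof PI_RGT_0 as Hpi. unfold cauchy_int.
  replace (2 * PI) with (Rabs (2 * PI - 0)) at 2 by (rewrite Rabs_pos_eq; lra).
  apply CI_bound.
  - intros t _. apply (ccont_mult g); auto. apply circ_inv_cont; lra.
  - rewrite Rmin_left, Rmax_right by lra. intros t Ht. rewrite Cmod_mult.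
    apply Rmult_le_compat; try apply Cmod_ge_0; auto. apply circ_inv_bound; auto.
Qed.

Lemma cauchy_int_sq_bound rho g G w : 0 < rho -> (forall t, ccont g t) -> (forall t, 0 <= t <= 2 * PI -> Cmod (g t) <= G) ->
  Cmod w <= rho / 2 -> Cmod (cauchy_int_sq rho g w) <= 2 * PI * (G * (2 / rho * (2 / rho))).
Proof.
  intros HR Cg HG Hw. pose proof PI_RGT_0 as Hpi. unfold cauchy_int_sq.
  replace (2 * PI) with (Rabs (2 * PI - 0)) at 2 by (rewrite Rabs_pos_eq; lra).
  apply CI_bound.
  - intros t _. apply (ccont_mult g); auto. apply ccont_mult; apply circ_inv_cont; lra.
  - rewrite Rmin_left, Rmax_right by lra. intros t Ht. rewrite !Cmod_mult.
    apply Rmult_le_compat; try apply Cmod_ge_0; auto.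
    + apply Rmult_le_pos; apply Cmod_ge_0.
    + apply Rmult_le_compat; try apply Cmod_ge_0; apply circ_inv_bound; auto.
Qed.

Lemma cauchy_int_taylor rho g G w w' : 0 < rho -> (forall t, ccont g t) -> (forall t, 0 <= t <= 2 * PI -> Cmod (g t) <= G) ->
  Cmod w <= rho / 2 -> Cmod w' <= rho / 2 ->
  Cmod (cauchy_int rho g w' - cauchy_int rho g w - cauchy_int_sq rho g w * (w' - w)) <=
    2 * PI * (G * (2 / rho * (2 / rho) * (2 / rho))) * (Cmod (w' - w) * Cmod (w' - w)).
Proof.
  intros HR Cg HG Hw Hw'. pose proof PI_RGT_0 as Hpi. unfold cauchy_int, cauchy_int_sq.
  assert (C1 : forall v, Cmod v <= rho / 2 -> forall t, ccont (fun t => g t * / (circ rho t - v))%C t).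
  { intros v Hv t. apply (ccont_mult g); auto. apply circ_inv_cont; lra. }
  assert (C2 : forall t, ccont (fun t => g t * (/ (circ rho t - w) * / (circ rho t - w)))%C t).
  { intros t. apply (ccont_mult g); auto. apply ccont_mult; apply circ_inv_cont; lra. }
  rewrite (Cmult_comm (CI _ _ _) (w' - w)).
  rewrite <- CI_scal by (intros t _; auto).
  rewrite <- !CI_minus; try (intros t _; auto).
  2: apply (ccont_plus (fun t => g t * / (circ rho t - w'))%C (fun t => - (g t * / (circ rho t - w)))%C); auto.
  2:{ apply (hcont_comp (fun z => - z)%C (fun t => g t * / (circ rho t - w))%C); auto.
      apply hol_hcont with (l := (- (1))%C). intros e He. exists 1; split; [lra|]. intros z _.
      match goal with |- Cmod ?x <= _ => replace x with (RtoC 0) by ring end. rewrite Cmod_0. pose proof (Cmod_ge_0 (z - g t * / (circ rho t - w))). nra. }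
  2:{ apply ccont_mult; auto. apply ccont_const. }
  (* With c the point on the circle, 1/(c - w') - 1/(c - w) - (w' - w)/(c - w)^2 equals (w' - w)^2 /
     ((c - w)^2 (c - w')) exactly. *)
  rewrite (CI_ext _ (fun t => (w' - w) * (w' - w) * (g t * (/ (circ rho t - w) * / (circ rho t - w) * / (circ rho t - w'))))%C).
  2:{ intros t _. field. split; apply circ_neq; lra. }
  rewrite CI_scal.
  2:{ intros t _. apply (ccont_mult g); auto. repeat apply ccont_mult; apply circ_inv_cont; lra. }
  rewrite !Cmod_mult, Rmult_comm.
  apply Rmult_le_compat_r; [apply Rmult_le_pos; apply Cmod_ge_0|].
  replace (2 * PI) with (Rabs (2 * PI - 0)) at 2 by (rewrite Rabs_pos_eq; lra).
  apply CI_bound.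
  - intros t _. apply (ccont_mult g); auto. repeat apply ccont_mult; apply circ_inv_cont; lra.
  - rewrite Rmin_left, Rmax_right by lra. intros t Ht. rewrite !Cmod_mult.
    apply Rmult_le_compat; try apply Cmod_ge_0; auto.
    + repeat apply Rmult_le_pos; apply Cmod_ge_0.
    + apply Rmult_le_compat; try apply Cmod_ge_0; try (apply circ_inv_bound; auto).
      * apply Rmult_le_pos; apply Cmod_ge_0.
      * apply Rmult_le_compat; try apply Cmod_ge_0; apply circ_inv_bound; auto.
Qed.

Lemma ccont_bounded f a b : a <= b -> (forall t, a <= t <= b -> ccont f t) ->
  exists M, 0 <= M /\ forall t, a <= t <= b -> Cmod (f t) <= M.
Proof.
  intros Hab H. destruct (continuity_ab_maj (fun t => Cmod (f t)) a b Hab) as [x [Hx _]].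
  - intros t Ht. apply continuity_pt_filterlim. intros P [e He]. apply locally_R.
    destruct (H t Ht e (cond_pos e)) as [d [Hd A]]. exists d. split; auto. intros s Hs. apply He.
    specialize (A s Hs). change (Rabs (Cmod (f s) - Cmod (f t)) < e).
    pose proof (Cmod_rev (f s) (f t)). pose proof (Cmod_rev (f t) (f s)). rewrite (Cmod_sym (f t)) in H1.
    apply Rabs_def1; lra.
  - exists (Cmod (f x)). split; [apply Cmod_ge_0|auto].
Qed.

Lemma hol_of_taylor f z l C d : 0 < d -> 0 <= C ->
  (forall w, Cmod (w - z) < d -> Cmod (f w - f z - l * (w - z)) <= C * (Cmod (w - z) * Cmod (w - z))) ->
  hol f z l.
Proof.
  intros Hd HC H e He. exists (Rmin d (e / (C + 1))). split.
  - apply Rmin_pos; auto. apply Rdiv_lt_0_compat; lra.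
  - intros w Hw. pose proof (Rmin_l d (e / (C + 1))). pose proof (Rmin_r d (e / (C + 1))).
    eapply Rle_trans; [apply H; lra|]. pose proof (Cmod_ge_0 (w - z)).
    assert (Cmod (w - z) * (C + 1) < e).
    { apply Rlt_le_trans with (e / (C + 1) * (C + 1)). apply Rmult_lt_compat_r; lra. right; field; lra. }
    nra.
Qed.

Lemma cauchy_int_hol rho g w : 0 < rho -> (forall t, ccont g t) -> Cmod w < rho / 2 -> hol (cauchy_int rho g) w (cauchy_int_sq rho g w).
Proof.
  intros HR Cg Hw. pose proof PI_RGT_0 as Hpi.
  destruct (ccont_bounded g 0 (2 * PI)) as [G [HG0 HG]]; [lra|auto|].
  assert (0 < 2 / rho) by (apply Rdiv_lt_0_compat; lra).
  apply (hol_of_taylor _ _ _ (2 * PI * (G * (2 / rho * (2 / rho) * (2 / rho)))) (rho / 2 - Cmod w)); [lra| |].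
  - set (i := 2 / rho) in *. clearbody i. set (p := PI) in *. clearbody p. repeat apply Rmult_le_pos; lra.
  - intros w' Hw'. apply cauchy_int_taylor; auto; try lra.
    pose proof (Cmod_rev w' w). lra.
Qed.

(** The density whose Cauchy transform is [F]: the boundary values with the normalisation and the
    factor coming from dz = i z dt. *)
Definition circ_data (F : C -> C) (rho t : R) : C := (/ RtoC (2 * PI) * (F (circ rho t) * circ rho t))%C.

Lemma circ_data_cont F rho t : (forall z, exists l, hol F z l) -> ccont (circ_data F rho) t.
Proof.
  intros HF. apply ccont_mult; [apply ccont_const|].
  apply (ccont_mult (fun t => F (circ rho t))); [|apply circ_cont].
  apply hcont_comp; [apply circ_cont|]. destruct (HF (circ rho t)) as [v Hv]. eapply hol_hcont; eauto.
Qed.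

Lemma cauchy_rep F rho w : (forall z, exists l, hol F z l) -> 0 < rho -> Cmod w < rho ->
  F w = cauchy_int rho (circ_data F rho) w.
Proof.
  intros HF HR Hw. pose proof PI_RGT_0 as Hpi. unfold cauchy_int.
  rewrite (CI_ext _ (fun t => / RtoC (2 * PI) * (F (circ rho t) * circ rho t / (circ rho t - w)))%C).
  2:{ intros t _. unfold circ_data. unfold Cdiv. ring. }
  rewrite CI_scal.
  - rewrite cauchy_formula by auto. field. apply RtoC_neq0; lra.
  - intros t _. apply (ccont_mult (fun t => F (circ rho t) * circ rho t)%C).
    + apply (ccont_mult (fun t => F (circ rho t))); [|apply circ_cont].
      apply hcont_comp; [apply circ_cont|]. destruct (HF (circ rho t)) as [v Hv]. eapply hol_hcont; eauto.
    + apply circ_inv_cont; auto.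
Qed.

Lemma hol_locally_eq f g z l d : 0 < d -> (forall w, Cmod (w - z) < d -> f w = g w) -> hol f z l -> hol g z l.
Proof.
  intros Hd E H e He. destruct (H e He) as [d' [Hd' A]]. exists (Rmin d d').
  split; [apply Rmin_pos; auto|]. intros w Hw. pose proof (Rmin_l d d'). pose proof (Rmin_r d d').
  rewrite <- !E; try lra; [apply A; lra|]. replace (z - z)%C with (RtoC 0) by ring. rewrite Cmod_0; auto.
Qed.

(** The Cauchy representation on a circle of more than twice the radius bounds [F], its derivative
    and the quadratic remainder at once. The circle has radius 2 (r + 1), so that the disc of radius
    [r] lies strictly inside half of it. *)
Lemma taylor_on_disc F F' r : (forall z, hol F z (F' z)) ->
  exists M, 0 <= M /\
  (forall z, Cmod z <= r -> Cmod (F z) <= M) /\ (forall z, Cmod z <= r -> Cmod (F' z) <= M) /\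
  (forall z w, Cmod z <= r -> Cmod w <= r ->
    Cmod (F w - F z - F' z * (w - z)) <= M * (Cmod (w - z) * Cmod (w - z))).
Proof.
  intros HF. pose proof PI_RGT_0 as Hpi.
  destruct (Rlt_le_dec r 0) as [Hr|Hr].
  { exists 0. split; [lra|]. repeat split; intros z; intros; pose proof (Cmod_ge_0 z); lra. }
  assert (HE : forall z, exists l, hol F z l) by eauto.
  set (rho := 2 * (r + 1)). assert (HR : 0 < rho) by (unfold rho; lra).
  set (g := circ_data F rho). assert (Cg : forall t, ccont g t) by (intros; apply circ_data_cont; auto).
  destruct (ccont_bounded g 0 (2 * PI)) as [G [HG0 HG]]; [lra|auto|].
  assert (Rep : forall w, Cmod w < rho -> F w = cauchy_int rho g w) by (intros; apply cauchy_rep; auto).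
  assert (Der : forall z, Cmod z <= r -> F' z = cauchy_int_sq rho g z).
  { intros z Hz. apply (hol_unique F z); auto.
    apply (hol_locally_eq (cauchy_int rho g) F z _ (rho - Cmod z)); [unfold rho; lra| |apply cauchy_int_hol; auto; unfold rho; lra].
    intros w Hw. symmetry. apply Rep. pose proof (Cmod_rev w z). lra. }
  assert (0 < 2 / rho) by (apply Rdiv_lt_0_compat; lra).
  set (M1 := 2 * PI * (G * (2 / rho))). set (M2 := 2 * PI * (G * (2 / rho * (2 / rho)))).
  set (M3 := 2 * PI * (G * (2 / rho * (2 / rho) * (2 / rho)))).
  assert (0 <= M1) by (unfold M1; set (i := 2 / rho) in *; clearbody i; set (p := PI) in *; clearbody p; repeat apply Rmult_le_pos; lra).
  assert (0 <= M2) by (unfold M2; set (i := 2 / rho) in *; clearbody i; set (p := PI) in *; clearbody p; repeat apply Rmult_le_pos; lra).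
  assert (0 <= M3) by (unfold M3; set (i := 2 / rho) in *; clearbody i; set (p := PI) in *; clearbody p; repeat apply Rmult_le_pos; lra).
  exists (M1 + M2 + M3). split; [lra|]. split; [|split].
  - intros z Hz. rewrite Rep by (unfold rho; lra).
    eapply Rle_trans; [apply (cauchy_int_bound rho g G); auto; unfold rho; lra|]. fold M1. lra.
  - intros z Hz. rewrite Der by auto.
    eapply Rle_trans; [apply (cauchy_int_sq_bound rho g G); auto; unfold rho; lra|]. fold M2. lra.
  - intros z w Hz Hw. rewrite Der, !Rep by (auto; unfold rho; lra).
    eapply Rle_trans; [apply (cauchy_int_taylor rho g G); auto; unfold rho; lra|]. fold M3.
    apply Rmult_le_compat_r; [apply Rmult_le_pos; apply Cmod_ge_0|lra].
Qed.

(** A crude maximum principle. The factor 2 reflects a distance of at least [rho / 2] to the circle;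
    it is harmless against the geometric decay in [zero_order]. *)
Lemma circle_max F rho B z : (forall z, exists l, hol F z l) -> 0 < rho -> Cmod z <= rho / 2 ->
  (forall t, Cmod (F (circ rho t)) <= B) -> Cmod (F z) <= 2 * B.
Proof.
  intros HF HR Hz HB. pose proof PI_RGT_0 as Hpi.
  rewrite (cauchy_rep F rho) by (auto; lra).
  eapply Rle_trans; [apply (cauchy_int_bound rho _ (/ (2 * PI) * (B * rho)))|]; auto.
  - intros; apply circ_data_cont; auto.
  - intros t _. unfold circ_data. rewrite !Cmod_mult, Cmod_inv by (apply RtoC_neq0; lra).
    rewrite Cmod_R, Rabs_pos_eq, circ_Cmod by lra.
    apply Rmult_le_compat_l; [left; apply Rinv_0_lt_compat; lra|].
    apply Rmult_le_compat_r; [lra|auto].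
  - right. field. lra.
Qed.

(** Removability of the singularity of F z / (z - b): away from [b] this is the quotient rule, and
    near [b] the quotient is itself a Cauchy transform. *)
Lemma divide_zero F F' b : (forall z, hol F z (F' z)) -> F b = RtoC 0 ->
  exists F1 F1', (forall z, hol F1 z (F1' z)) /\ forall z, F z = ((z - b) * F1 z)%C.
Proof.
  intros HF Hb. pose proof PI_RGT_0 as Hpi.
  assert (HE : forall z, exists l, hol F z l) by eauto.
  set (F1 := fun z => if Ceq_dec z b then F' b else (F z / (z - b))%C).
  assert (H1 : forall z, exists l, hol F1 z l).
  { intros z. destruct (Ceq_dec z b) as [->|Hn].
    - set (rho := 2 * (Cmod b + 1)). pose proof (Cmod_ge_0 b).
      assert (HR : 0 < rho) by (unfold rho; lra).
      set (g := circ_data F rho). assert (Cg : forall t, ccont g t) by (intros; apply circ_data_cont; auto).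
      assert (Rep : forall w, Cmod w < rho -> F w = cauchy_int rho g w) by (intros; apply cauchy_rep; auto).
      (* The difference quotient of 1/(c - w) between w and b is 1/((c - w)(c - b)), so dividing the
         density by c - b represents the quotient; at w = b the transform gives [F' b]. *)
      set (g1 := fun t => (g t * / (circ rho t - b))%C).
      assert (Cg1 : forall t, ccont g1 t).
      { intros t. apply (ccont_mult g); auto. apply circ_inv_cont; auto. unfold rho; lra. }
      exists (cauchy_int_sq rho g1 b). apply (hol_locally_eq (cauchy_int rho g1) F1 b _ 1); [lra| |apply cauchy_int_hol; auto; unfold rho; lra].
      intros w Hw. assert (Hw' : Cmod w < rho) by (pose proof (Cmod_rev w b); unfold rho; lra).
      assert (Hb' : Cmod b < rho) by (unfold rho; lra).
      unfold F1. destruct (Ceq_dec w b) as [->|Hn].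
      + transitivity (cauchy_int_sq rho g b).
        * apply CI_ext. intros t _. unfold g1. ring.
        * apply (hol_unique F b); auto.
          apply (hol_locally_eq (cauchy_int rho g) F b _ (rho - Cmod b)); [lra| |apply cauchy_int_hol; auto; unfold rho; lra].
          intros v Hv. symmetry. apply Rep. pose proof (Cmod_rev v b). lra.
      + assert (Hwb : (w - b)%C <> 0) by (apply Cminus_eq_contra; auto).
        assert (X : ((w - b) * cauchy_int rho g1 w)%C = (F w - F b)%C).
        { rewrite !Rep by auto. unfold cauchy_int. rewrite <- CI_scal, <- CI_minus.
          - apply CI_ext. intros t _. unfold g1. field. split; apply circ_neq; auto.
          - intros t _. apply (ccont_mult g); auto. apply circ_inv_cont; auto.
          - intros t _. apply (ccont_mult g); auto. apply circ_inv_cont; auto.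
          - intros t _. apply (ccont_mult g1); auto. apply circ_inv_cont; auto. }
        rewrite Hb in X. replace (F w) with ((w - b) * cauchy_int rho g1 w)%C by (rewrite X; ring). field; auto.
    - assert (Hzb : (z - b)%C <> 0) by (apply Cminus_eq_contra; auto).
      eexists. apply (hol_locally_eq (fun z => F z / (z - b))%C F1 z _ (Cmod (z - b))).
      + apply Cmod_gt_0; auto.
      + intros w Hw. unfold F1. destruct (Ceq_dec w b) as [->|]; auto. rewrite Cmod_sym in Hw. lra.
      + apply (hol_div F (fun z => z - b)%C); [apply HF| |auto].
        apply (hol_plus (fun z => z)); [apply hol_id|apply hol_const]. }
  exists F1, (fun z => epsilon (inhabits (RtoC 0)) (fun l => hol F1 z l)). split.
  - intros z. apply epsilon_spec, H1.
  - intros z. unfold F1. destruct (Ceq_dec z b) as [->|Hn].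
    + rewrite Hb. ring.
    + field. apply Cminus_eq_contra; auto.
Qed.

(** If [z - b] could be divided out for ever, [circle_max] applied to the n-th quotient would bound
    |F z| by a multiple of 2^-n at every z. The multiplicity is [S m], so m = 0 is a simple zero. *)
Lemma zero_order F F' b : (forall z, hol F z (F' z)) -> F b = RtoC 0 -> ~ (forall z, F z = RtoC 0) ->
  exists (m : nat) h h', (forall z, hol h z (h' z)) /\ h b <> 0 /\
    forall z, F z = ((z - b) ^ S m * h z)%C.
Proof.
  intros HF Hb Hnz. apply Classical_Prop.NNPP. intros N.
  assert (A : forall m, exists h h', (forall z, hol h z (h' z)) /\ forall z, F z = ((z - b) ^ S m * h z)%C).
  { induction m as [|m (h & h' & Hh & E)].
    - destruct (divide_zero F F' b HF Hb) as (h & h' & Hh & E). exists h, h'. split; auto.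
      intros z. rewrite E. simpl. ring.
    - destruct (Ceq_dec (h b) 0) as [H0|H0]; [|exfalso; apply N; exists m, h, h'; auto].
      destruct (divide_zero h h' b Hh H0) as (k & k' & Hk & E'). exists k, k'. split; auto.
      intros z. rewrite E, E'. simpl. ring. }
  apply Hnz. intros z. apply Cmod_eq_0, Rle_antisym; [|apply Cmod_ge_0].
  apply le_epsilon. intros eta Heta. rewrite Rplus_0_l.
  pose proof (Cmod_ge_0 z). pose proof (Cmod_ge_0 b).
  (* This radius puts the circle at distance at least 2 (|z - b| + 1) from [b], the source of the
     factor 2^-n, and keeps [z] in the half disc. *)
  set (rho := 2 * Cmod z + 3 * Cmod b + 2). assert (HR : 0 < rho) by (unfold rho; lra).
  destruct (taylor_on_disc F F' rho HF) as (M & HM & HB & _).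
  destruct (pow_lt_1_zero (/ 2) ltac:(rewrite Rabs_pos_eq; lra) (eta / (2 * M + 1))) as [n Hn].
  { apply Rdiv_lt_0_compat; lra. }
  specialize (Hn (S n) ltac:(lia)). rewrite Rabs_pos_eq in Hn by (left; apply pow_lt; lra).
  destruct (A n) as (h & h' & Hh & E).
  set (p := Cmod (z - b)). assert (Hp : 0 <= p) by apply Cmod_ge_0.
  assert (Hp' : p <= Cmod z + Cmod b) by apply Cmod_minus_le.
  assert (Hhz : Cmod (h z) <= 2 * (M / (2 * (p + 1)) ^ S n)).
  { apply (circle_max h rho); eauto; [unfold rho; lra|].
    intros t. pose proof (circ_sep rho t b HR) as S1.
    assert (P : 0 < (2 * (p + 1)) ^ S n) by (apply pow_lt; lra).
    apply Rmult_le_reg_r with ((2 * (p + 1)) ^ S n); auto.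
    replace (M / (2 * (p + 1)) ^ S n * (2 * (p + 1)) ^ S n) with M by (field; apply Rgt_not_eq, P).
    apply Rle_trans with (Cmod (h (circ rho t)) * Cmod (circ rho t - b) ^ S n).
    - apply Rmult_le_compat_l; [apply Cmod_ge_0|]. apply pow_incr. unfold rho in S1 at 1. lra.
    - rewrite <- Cmod_pow, <- Cmod_mult, Cmult_comm, <- E. apply HB. rewrite circ_Cmod; lra. }
  rewrite E, Cmod_mult, Cmod_pow. fold p.
  assert (P : 0 < (p + 1) ^ S n) by (apply pow_lt; lra).
  apply Rle_trans with ((p + 1) ^ S n * (2 * (M / (2 * (p + 1)) ^ S n))).
  - apply Rmult_le_compat; auto; [apply pow_le; auto|apply Cmod_ge_0|]. apply pow_incr. lra.
  - rewrite Rpow_mult_distr.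
    replace ((p + 1) ^ S n * (2 * (M / (2 ^ S n * (p + 1) ^ S n)))) with (2 * M * (/ 2) ^ S n).
    2:{ rewrite pow_inv. field. split; apply Rgt_not_eq; auto. apply pow_lt; lra. }
    apply Rle_trans with ((2 * M + 1) * (eta / (2 * M + 1))); [|right; field; lra].
    assert (0 < (/ 2) ^ S n) by (apply pow_lt; lra). nra.
Qed.

(** * Existence and uniqueness of solutions *)

Definition lip_on (F : C -> C) (r L : R) : Prop :=
  0 <= L /\ forall z w, Cmod z <= r -> Cmod w <= r -> Cmod (F w - F z) <= L * Cmod (w - z).

Lemma lip_on_disc F F' r : (forall z, hol F z (F' z)) -> exists L, lip_on F r L.
Proof.
  intros HF. destruct (taylor_on_disc F F' r HF) as (M & HM & _ & H1 & H2).
  destruct (Rlt_le_dec r 0) as [Hr|Hr].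
  { exists 0. split; [lra|]. intros z w Hz. pose proof (Cmod_ge_0 z). lra. }
  exists (M + M * (2 * r)). split.
  { assert (0 <= M * (2 * r)) by (apply Rmult_le_pos; lra). lra. }
  intros z w Hz Hw. specialize (H1 z Hz). specialize (H2 z w Hz Hw).
  replace (F w - F z)%C with ((F w - F z - F' z * (w - z)) + F' z * (w - z))%C by ring.
  eapply Rle_trans; [apply Cmod_triangle|]. rewrite Cmod_mult.
  assert (Cmod (w - z) <= 2 * r) by (eapply Rle_trans; [apply Cmod_minus_le|lra]).
  pose proof (Cmod_ge_0 (w - z)).
  assert (M * (Cmod (w - z) * Cmod (w - z)) <= M * (2 * r * Cmod (w - z))) by (apply Rmult_le_compat_l; nra).
  nra.
Qed.

(** The intervals of radius 2 B 2^-n about [x n] are nested: the next radius plus the step, B 2^-n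
    each, make up the present radius. *)
Lemma geometric_cauchy_R (x : nat -> R) B : (forall n, Rabs (x (S n) - x n) <= B * (/ 2) ^ n) ->
  exists l, forall n, Rabs (x n - l) <= 2 * B * (/ 2) ^ n.
Proof.
  intros H. assert (P : forall n, 0 < (/ 2) ^ n) by (intros; apply pow_lt; lra).
  assert (HB : 0 <= B). { specialize (H O). pose proof (Rabs_pos (x 1%nat - x O)). simpl in H. lra. }
  destruct (nested_intervals (fun n => x n - 2 * B * (/ 2) ^ n) (fun n => x n + 2 * B * (/ 2) ^ n)) as [l Hl].
  - intros n. specialize (H n). apply Rabs_le_between in H. simpl. lra.
  - intros n. specialize (H n). apply Rabs_le_between in H. simpl. lra.
  - intros n. specialize (P n). assert (0 <= B * (/ 2) ^ n) by (apply Rmult_le_pos; lra). lra.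
  - exists l. intros n. specialize (Hl n). apply Rabs_le. lra.
Qed.

Lemma geometric_cauchy (z : nat -> C) B : (forall n, Cmod (z (S n) - z n) <= B * (/ 2) ^ n) ->
  exists l, forall n, Cmod (z n - l) <= 4 * B * (/ 2) ^ n.
Proof.
  intros H.
  destruct (geometric_cauchy_R (fun n => fst (z n)) B) as [a Ha].
  { intros n. eapply Rle_trans; [|apply H]. exact (Cmod_abs_fst (z (S n) - z n)). }
  destruct (geometric_cauchy_R (fun n => snd (z n)) B) as [b Hb].
  { intros n. eapply Rle_trans; [|apply H]. exact (Cmod_abs_snd (z (S n) - z n)). }
  exists (a, b). intros n. eapply Rle_trans; [apply Cmod_le_sum|].
  specialize (Ha n). specialize (Hb n). unfold Rminus in *. simpl. lra.
Qed.

(** The nearest-point projection to [- T, T]. Precomposing with it keeps functions total while their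
    bounds hold on the whole line. *)
Definition clamp (T t : R) : R := Rmax (- T) (Rmin T t).

Lemma clamp_bound T t : 0 <= T -> - T <= clamp T t <= T.
Proof. unfold clamp, Rmax, Rmin. intros. repeat destruct Rle_dec; lra. Qed.

Lemma clamp_id T t : - T <= t <= T -> clamp T t = t.
Proof. unfold clamp, Rmax, Rmin. intros. repeat destruct Rle_dec; lra. Qed.

Lemma clamp_lip T t s : Rabs (clamp T t - clamp T s) <= Rabs (t - s).
Proof. unfold clamp, Rmax, Rmin. repeat destruct Rle_dec; unfold Rabs; repeat destruct Rcase_abs; lra. Qed.

Lemma ccont_clamp f T t : (forall s, ccont f s) -> ccont (fun s => f (clamp T s)) t.
Proof.
  intros H e He. destruct (H (clamp T t) e He) as [d [Hd A]]. exists d; split; auto.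
  intros s Hs. apply A. eapply Rle_lt_trans; [apply clamp_lip|auto].
Qed.

Lemma lip_hcont G L z : 0 <= L -> (forall z w, Cmod (G w - G z) <= L * Cmod (w - z)) -> hcont G z.
Proof.
  intros HL H e He. exists (e / (L + 1)). split; [apply Rdiv_lt_0_compat; lra|].
  intros w Hw. eapply Rle_lt_trans; [apply H|].
  assert (Cmod (w - z) * (L + 1) < e).
  { apply Rlt_le_trans with (e / (L + 1) * (L + 1)). apply Rmult_lt_compat_r; lra. right; field; lra. }
  pose proof (Cmod_ge_0 (w - z)). nra.
Qed.

(** The coefficient [c] covers the given equation, with c = 1, and the auxiliary fields of the
    transport. The bound [c0 * L * T <= / 2] makes the clamped Picard map a contraction by 1/2 in
    the supremum norm. *)
Lemma picard (G : C -> C) (c : R -> C) (x : C) (L M c0 T : R) :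
  0 <= L -> 0 <= M -> 0 <= c0 -> 0 <= T ->
  (forall z w, Cmod (G w - G z) <= L * Cmod (w - z)) -> (forall z, Cmod (G z) <= M) ->
  (forall t, ccont c t) -> (forall t, Cmod (c t) <= c0) -> c0 * L * T <= / 2 ->
  exists phi, phi 0 = x /\ forall t, Rabs t < T ->
    cder phi t (c t * G (phi t)) /\ Cmod (phi t - x) <= T * (c0 * M).
Proof.
  intros HL HM Hc0 HT HG HGM Cc Hc Hs.
  assert (CG : forall p, (forall t, ccont p t) -> forall t, ccont (fun s => c s * G (p s))%C t).
  { intros p Hp t. apply ccont_mult; auto. apply (hcont_comp G p t); auto. apply lip_hcont with L; auto. }
  set (P := fun (p : R -> C) t => (x + CI (fun s => c s * G (p s))%C 0 (clamp T t))%C).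
  assert (CP : forall p, (forall t, ccont p t) -> forall t, ccont (P p) t).
  { intros p Hp t. apply ccont_plus; [apply ccont_const|].
    apply (ccont_clamp (fun t => CI (fun s => c s * G (p s))%C 0 t)).
    intros s. eapply cder_ccont, CI_cder. intros; apply CG; auto. }
  assert (Contr : forall p q D, (forall t, ccont p t) -> (forall t, ccont q t) ->
    (forall t, Cmod (p t - q t) <= D) -> forall t, Cmod (P p t - P q t) <= / 2 * D).
  { intros p q D Hp Hq HD t. unfold P.
    assert (D0 : 0 <= D) by (eapply Rle_trans; [apply Cmod_ge_0|apply (HD 0)]).
    match goal with |- Cmod (x + ?a - (x + ?b)) <= _ => replace (x + a - (x + b))%C with (a - b)%C by ring end.
    rewrite <- CI_minus by (intros ? _; apply CG; auto).
    eapply Rle_trans; [apply CI_bound with (M := c0 * (L * D))|].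
    - intros u _. apply (ccont_plus (fun t => c t * G (p t))%C (fun t => - (c t * G (q t)))%C); [apply CG; auto|].
      eapply (hcont_comp (fun z => - z)%C (fun t => c t * G (q t))%C); [apply CG; auto|].
      apply lip_hcont with 1; [lra|]. intros z w. replace (- w - - z)%C with (z - w)%C by ring. rewrite Cmod_sym. lra.
    - intros u _. replace (c u * G (p u) - c u * G (q u))%C with (c u * (G (p u) - G (q u)))%C by ring.
      rewrite Cmod_mult. apply Rmult_le_compat; try apply Cmod_ge_0; auto.
      eapply Rle_trans; [apply HG|]. apply Rmult_le_compat_l; auto.
    - pose proof (clamp_bound T t HT).
      assert (Rabs (clamp T t - 0) <= T) by (apply Rabs_le; lra).
      apply Rle_trans with (T * (c0 * (L * D))).
      + apply Rmult_le_compat_r; auto. repeat apply Rmult_le_pos; auto.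
      + replace (T * (c0 * (L * D))) with (c0 * L * T * D) by ring. apply Rmult_le_compat_r; auto. }
  set (u := fix u n := match n with O => (fun _ : R => x) | S n => P (u n) end).
  assert (Cu : forall n t, ccont (u n) t).
  { induction n; intros t; simpl; [apply ccont_const|apply CP; auto]. }
  assert (PM : forall p t, (forall t, ccont p t) -> Cmod (P p t - x) <= T * (c0 * M)).
  { intros p t Hp. unfold P. match goal with |- Cmod (x + ?a - x) <= _ => replace (x + a - x)%C with a by ring end.
    pose proof (clamp_bound T t HT).
    assert (Rabs (clamp T t - 0) <= T) by (apply Rabs_le; lra).
    eapply Rle_trans; [apply CI_bound with (M := c0 * M)|].
    - intros ? _; apply CG; auto.
    - intros s _. rewrite Cmod_mult. apply Rmult_le_compat; try apply Cmod_ge_0; auto.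
    - apply Rmult_le_compat_r; auto. apply Rmult_le_pos; auto. }
  set (B := T * (c0 * M)).
  assert (Du : forall n t, Cmod (u (S n) t - u n t) <= B * (/ 2) ^ n).
  { induction n; intros t.
    - simpl. rewrite Rmult_1_r. apply PM. intros; apply ccont_const.
    - change (Cmod (P (u (S n)) t - P (u n) t) <= B * (/ 2) ^ S n).
      eapply Rle_trans; [apply Contr; auto|]. simpl. lra. }
  assert (Lim : exists phi, forall t n, Cmod (u n t - phi t) <= 4 * B * (/ 2) ^ n).
  { exists (fun t => epsilon (inhabits x) (fun l => forall n, Cmod (u n t - l) <= 4 * B * (/ 2) ^ n)).
    intros t. apply epsilon_spec. apply geometric_cauchy. intros; apply Du. }
  destruct Lim as [phi Hphi].
  assert (HB : 0 <= B) by (unfold B; repeat apply Rmult_le_pos; auto).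
  assert (Small : forall e, 0 < e -> exists n, 4 * B * (/ 2) ^ n < e).
  { intros e He. destruct (pow_lt_1_zero (/ 2) ltac:(rewrite Rabs_pos_eq; lra) (e / (4 * B + 1))) as [n Hn].
    { apply Rdiv_lt_0_compat; lra. }
    exists n. specialize (Hn n (Nat.le_refl _)). rewrite Rabs_pos_eq in Hn by (left; apply pow_lt; lra).
    assert (0 < (/ 2) ^ n) by (apply pow_lt; lra).
    assert ((/ 2) ^ n * (4 * B + 1) < e).
    { apply Rlt_le_trans with (e / (4 * B + 1) * (4 * B + 1)). apply Rmult_lt_compat_r; lra. right; field; lra. }
    nra. }
  assert (Cphi : forall t, ccont phi t).
  { intros t e He. destruct (Small (e / 4) ltac:(lra)) as [n Hn].
    destruct (Cu n t (e / 4) ltac:(lra)) as [d [Hd A]]. exists d; split; auto. intros s Hst.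
    specialize (A s Hst). pose proof (Hphi s n) as A1. pose proof (Hphi t n) as A2. rewrite Cmod_sym in A1.
    replace (phi s - phi t)%C with ((phi s - u n s) + (u n s - u n t) + (u n t - phi t))%C by ring.
    eapply Rle_lt_trans; [apply Cmod_triangle|].
    eapply Rle_lt_trans; [apply Rplus_le_compat_r, Cmod_triangle|]. lra. }
  assert (Fix : forall t, phi t = P phi t).
  { intros t. apply Ceq_minus, Cmod_eq_0, Rle_antisym; [|apply Cmod_ge_0].
    apply le_epsilon. intros e He. rewrite Rplus_0_l.
    destruct (Small (e / 2) ltac:(lra)) as [n Hn].
    pose proof (Hphi t (S n)) as A1. rewrite Cmod_sym in A1.
    pose proof (Contr (u n) phi (4 * B * (/ 2) ^ n) (Cu n) Cphi (fun s => Hphi s n) t) as A2.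
    change (P (u n) t) with (u (S n) t) in A2.
    eapply Rle_trans; [apply (Cmod_tri _ (u (S n) t))|]. simpl pow in A1.
    assert (0 <= 4 * B * (/ 2) ^ n) by (eapply Rle_trans; [apply Cmod_ge_0|apply (Hphi t n)]). lra. }
  exists phi. split.
  - rewrite Fix. unfold P. rewrite clamp_id by lra. unfold CI. rewrite RInt_point. apply Cplus_0_r.
  - intros t Ht. apply Rabs_lt_between in Ht. split.
    + assert (D : cder (fun t => x + CI (fun s => c s * G (phi s))%C 0 t)%C t (c t * G (phi t))).
      { eapply cder_eq; [apply cder_plus; [apply cder_const|apply CI_cder; intros; apply CG; auto]|]. simpl. ring. }
      intros e He. destruct (D e He) as [d [Hd A]].
      exists (Rmin d (Rmin (T - t) (T + t))). split; [repeat apply Rmin_pos; lra|].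
      intros s Hst. pose proof (Rmin_l d (Rmin (T - t) (T + t))). pose proof (Rmin_r d (Rmin (T - t) (T + t))).
      pose proof (Rmin_l (T - t) (T + t)). pose proof (Rmin_r (T - t) (T + t)).
      rewrite (Fix s), (Fix t) at 1. unfold P.
      assert (Hst' := Hst). apply Rabs_lt_between in Hst'.
      rewrite !clamp_id by lra. apply A. lra.
    + rewrite Fix. apply PM; auto.
Qed.

(** Projection to a square that contains the disc of radius [r] and lies in the disc of radius 2 r:
    composed with it, [F] becomes bounded and Lipschitz on the plane and is unchanged on the smaller
    disc. *)
Definition trunc (r : R) (z : C) : C := (clamp r (fst z), clamp r (snd z)).

Lemma trunc_id r z : Cmod z <= r -> trunc r z = z.
Proof.
  intros H. pose proof (Cmod_abs_fst z) as A. pose proof (Cmod_abs_snd z) as B.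
  assert (A' : Rabs (fst z) <= r) by lra. assert (B' : Rabs (snd z) <= r) by lra.
  apply Rabs_le_between in A'. apply Rabs_le_between in B'.
  unfold trunc. rewrite !clamp_id by lra. destruct z; auto.
Qed.

Lemma trunc_bound r z : 0 <= r -> Cmod (trunc r z) <= 2 * r.
Proof.
  intros H. eapply Rle_trans; [apply Cmod_le_sum|]. simpl.
  pose proof (clamp_bound r (fst z) H). pose proof (clamp_bound r (snd z) H).
  assert (Rabs (clamp r (fst z)) <= r) by (apply Rabs_le; lra).
  assert (Rabs (clamp r (snd z)) <= r) by (apply Rabs_le; lra). lra.
Qed.

Lemma trunc_lip r z w : Cmod (trunc r w - trunc r z) <= 2 * Cmod (w - z).
Proof.
  eapply Rle_trans; [apply Cmod_le_sum|]. simpl.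
  pose proof (clamp_lip r (fst w) (fst z)) as A. pose proof (clamp_lip r (snd w) (snd z)) as B.
  pose proof (Cmod_abs_fst (w - z)) as A'. pose proof (Cmod_abs_snd (w - z)) as B'. simpl in A', B'.
  unfold Rminus in *. lra.
Qed.

(** Only the product of field strength and time is restricted, so a weak enough coefficient allows
    any prescribed time. *)
Lemma flow_exists F F' r : (forall z, hol F z (F' z)) -> 0 <= r ->
  exists delta, 0 < delta /\ forall (c : R -> C) c0 T x,
    (forall t, ccont c t) -> (forall t, Cmod (c t) <= c0) -> 0 <= T -> c0 * T <= delta -> Cmod x <= r ->
    exists phi, phi 0 = x /\ forall t, Rabs t < T ->
      cder phi t (c t * F (phi t)) /\ Cmod (phi t) <= r + 1.
Proof.
  intros HF Hr.
  destruct (lip_on_disc F F' (2 * (r + 1)) HF) as (L & HL & HLip).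
  destruct (taylor_on_disc F F' (2 * (r + 1)) HF) as (M & HM & HMb & _).
  set (G := fun z => F (trunc (r + 1) z)).
  (* The truncated field has Lipschitz constant 2 L, so 4 L gives the contraction by 1/2; [M] keeps
     the solution within distance 1 of [x], where truncation does nothing; 1 makes the denominator
     positive. *)
  exists (/ (4 * L + M + 1)). split; [apply Rinv_0_lt_compat; lra|].
  intros c c0 T x Cc Hc HT Hd Hx.
  assert (Hc0 : 0 <= c0) by (eapply Rle_trans; [apply Cmod_ge_0|apply (Hc 0)]).
  assert (Hd' : c0 * T * (4 * L + M + 1) <= 1).
  { apply Rle_trans with (/ (4 * L + M + 1) * (4 * L + M + 1)).
    apply Rmult_le_compat_r; lra. right; field; lra. }
  assert (0 <= c0 * T) by (apply Rmult_le_pos; auto).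
  destruct (picard G c x (2 * L) M c0 T) as (phi & P0 & P1); auto; try lra.
  - intros z w. unfold G. eapply Rle_trans; [apply HLip; apply trunc_bound; lra|].
    pose proof (trunc_lip (r + 1) z w). nra.
  - intros z. apply HMb, trunc_bound; lra.
  - assert (0 <= c0 * T * M) by (apply Rmult_le_pos; auto). nra.
  - exists phi. split; auto. intros t Ht. destruct (P1 t Ht) as [D B].
    assert (Cmod (phi t) <= r + 1).
    { pose proof (Cmod_rev (phi t) x).
      assert (0 <= c0 * T * L) by (apply Rmult_le_pos; auto).
      assert (T * (c0 * M) <= 1) by nra. lra. }
    split; auto. unfold G in D. rewrite trunc_id in D by auto. exact D.
Qed.

Lemma cder_shift f t s l : cder f (t + s) l -> cder (fun u => f (u + s)) t l.
Proof.
  intros H e He. destruct (H e He) as [d [Hd A]]. exists d; split; auto. intros u Hu.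
  specialize (A (u + s)). replace (u + s - (t + s)) with (u - t) in A by ring. auto.
Qed.

Lemma cder_reverse f t l : cder f (- t) l -> cder (fun u => f (- u)) t (- l).
Proof.
  intros H e He. destruct (H e He) as [d [Hd A]]. exists d; split; auto. intros u Hu.
  specialize (A (- u)). replace (- u - - t) with (- (u - t)) in A by ring. rewrite Rabs_Ropp in A.
  specialize (A Hu). rewrite RtoC_opp in A.
  replace (f (- u)%R - f (- t)%R - RtoC (u - t) * - l)%C with (f (- u)%R - f (- t)%R - - RtoC (u - t) * l)%C by ring. exact A.
Qed.

Lemma flow_dist F r L c c0 phi psi T : lip_on F r L -> 0 <= T ->
  (forall t, 0 <= t <= T -> Cmod (c t) <= c0) ->
  (forall t, 0 <= t <= T -> cder phi t (c t * F (phi t)) /\ Cmod (phi t) <= r) ->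
  (forall t, 0 <= t <= T -> cder psi t (c t * F (psi t)) /\ Cmod (psi t) <= r) ->
  Cmod (phi T - psi T) <= Cmod (phi 0 - psi 0) * exp ((2 * (c0 * L) + 1) * T).
Proof.
  intros [HL HLip] HT Hc Hphi Hpsi.
  assert (Hc0 : 0 <= c0) by (eapply Rle_trans; [apply Cmod_ge_0|apply (Hc 0); lra]).
  pose proof (gronwall (fun t => phi t - psi t)%C (fun t => c t * F (phi t) - c t * F (psi t))%C (c0 * L) 0 T) as G.
  simpl in G. rewrite Rplus_0_r in G. apply G; auto; try lra.
  - apply Rmult_le_pos; auto.
  - intros t Ht. destruct (Hphi t Ht), (Hpsi t Ht). apply cder_minus; auto.
  - intros t Ht. rewrite Rplus_0_r. destruct (Hphi t Ht), (Hpsi t Ht).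
    replace (c t * F (phi t) - c t * F (psi t))%C with (c t * (F (phi t) - F (psi t)))%C by ring.
    rewrite Cmod_mult, Rmult_assoc. apply Rmult_le_compat; auto; apply Cmod_ge_0.
Qed.

Lemma flow_dist_back F r L c c0 phi psi T : lip_on F r L -> 0 <= T ->
  (forall t, 0 <= t <= T -> Cmod (c t) <= c0) ->
  (forall t, 0 <= t <= T -> cder phi t (c t * F (phi t)) /\ Cmod (phi t) <= r) ->
  (forall t, 0 <= t <= T -> cder psi t (c t * F (psi t)) /\ Cmod (psi t) <= r) ->
  Cmod (phi 0 - psi 0) <= Cmod (phi T - psi T) * exp ((2 * (c0 * L) + 1) * T).
Proof.
  intros HL HT Hc Hphi Hpsi.
  assert (Rv : forall p, (forall t, 0 <= t <= T -> cder p t (c t * F (p t)) /\ Cmod (p t) <= r) ->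
    forall t, 0 <= t <= T -> cder (fun u => p (- u + T)) t (- c (- t + T)%R * F (p (- t + T)%R)) /\ Cmod (p (- t + T)) <= r).
  { intros p Hp t Ht. destruct (Hp (- t + T) ltac:(lra)) as [D B]. split; auto.
    replace (- c (- t + T)%R * F (p (- t + T)%R))%C with (- (c (- t + T)%R * F (p (- t + T)%R)))%C by ring.
    apply (cder_reverse (fun u => p (u + T))), cder_shift. exact D. }
  pose proof (flow_dist F r L (fun t => - c (- t + T)%R)%C c0 (fun u => phi (- u + T)) (fun u => psi (- u + T)) T HL HT) as A.
  simpl in A. replace (- T + T) with 0 in A by ring. replace (- 0 + T) with T in A by ring. apply A.
  - intros t Ht. rewrite Cmod_opp. apply Hc; lra.
  - intros t Ht. apply (Rv phi); auto.
  - intros t Ht. apply (Rv psi); auto.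
Qed.

Lemma flow_unique F F' c c0 phi psi T : (forall z, hol F z (F' z)) -> 0 <= T ->
  (forall t, 0 <= t <= T -> Cmod (c t) <= c0) ->
  (forall t, 0 <= t <= T -> cder phi t (c t * F (phi t))) ->
  (forall t, 0 <= t <= T -> cder psi t (c t * F (psi t))) ->
  phi 0 = psi 0 -> phi T = psi T.
Proof.
  intros HF HT Hc Hphi Hpsi E.
  destruct (ccont_bounded phi 0 T HT) as [m1 [Hm1 B1]]; [intros; eapply cder_ccont; eauto|].
  destruct (ccont_bounded psi 0 T HT) as [m2 [Hm2 B2]]; [intros; eapply cder_ccont; eauto|].
  destruct (lip_on_disc F F' (m1 + m2) HF) as [L HL].
  apply Ceq_minus, Cmod_eq_0, Rle_antisym; [|apply Cmod_ge_0].
  eapply Rle_trans; [apply (flow_dist F (m1 + m2) L c c0); auto|].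
  - intros t Ht. split; auto. specialize (B1 t Ht). lra.
  - intros t Ht. split; auto. specialize (B2 t Ht). lra.
  - rewrite E. replace (psi 0 - psi 0)%C with (RtoC 0) by ring. rewrite Cmod_0. lra.
Qed.

(** * Maximal solutions *)

Definition between (al : Rbar) (t : R) (be : Rbar) : Prop := Rbar_lt al t /\ Rbar_lt t be.

Definition sol_on (F : C -> C) (al be : Rbar) (phi : R -> C) : Prop :=
  forall t, between al t be -> cder phi t (F (phi t)).

Lemma between_mid al be s t u : between al s be -> between al t be -> s <= u <= t -> between al u be.
Proof.
  intros [A1 A2] [B1 B2] H. destruct al, be; unfold between in *; simpl in *; try tauto; lra.
Qed.

Lemma between_open al be t : between al t be -> exists d, 0 < d /\ forall s, Rabs (s - t) < d -> between al s be.
Proof.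
  intros [A1 A2].
  assert (H1 : exists d, 0 < d /\ forall s, Rabs (s - t) < d -> Rbar_lt al s).
  { destruct al; simpl in *; try tauto.
    - exists (t - r). split; [lra|]. intros s Hs. apply Rabs_lt_between in Hs. lra.
    - exists 1. split; [lra|auto]. }
  assert (H2 : exists d, 0 < d /\ forall s, Rabs (s - t) < d -> Rbar_lt s be).
  { destruct be; simpl in *; try tauto.
    - exists (r - t). split; [lra|]. intros s Hs. apply Rabs_lt_between in Hs. lra.
    - exists 1. split; [lra|auto]. }
  destruct H1 as [d1 [Hd1 H1]]. destruct H2 as [d2 [Hd2 H2]]. exists (Rmin d1 d2).
  split; [apply Rmin_pos; auto|]. intros s Hs. pose proof (Rmin_l d1 d2). pose proof (Rmin_r d1 d2).
  split; [apply H1|apply H2]; lra.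
Qed.

Lemma cder_locally_eq f g t l d : 0 < d -> (forall s, Rabs (s - t) < d -> f s = g s) -> cder f t l -> cder g t l.
Proof.
  intros Hd E H e He. destruct (H e He) as [d' [Hd' A]]. exists (Rmin d d').
  split; [apply Rmin_pos; auto|]. intros w Hw. pose proof (Rmin_l d d'). pose proof (Rmin_r d d').
  rewrite <- !E; try lra; [apply A; lra|]. replace (t - t) with 0 by ring. rewrite Rabs_R0; auto.
Qed.

(** Time reversal: if phi solves [F], then t -> phi (- t) solves [neg_field F]. Statements about the
    left end are thus obtained from those about the right end. *)
Definition neg_field (F : C -> C) (z : C) : C := (- F z)%C.

Lemma neg_field_invol F : neg_field (neg_field F) = F.
Proof. apply functional_extensionality. intros z. unfold neg_field. ring. Qed.

Lemma hol_neg F F' : (forall z, hol F z (F' z)) -> forall z, hol (neg_field F) z (neg_field F' z).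
Proof.
  intros H z. eapply hol_eq; [apply (hol_locally_eq (fun z => - (1) * F z)%C _ z (- (1) * F' z) 1); [lra| |apply hol_scal; auto]|].
  - intros; unfold neg_field; ring.
  - unfold neg_field; ring.
Qed.

Lemma solution_iff F x al be phi :
  solution F x al be phi <-> between al 0 be /\ phi 0 = x /\ sol_on F al be phi.
Proof.
  unfold solution, sol_on, between. split.
  - intros (A & B & D & E). repeat split; auto. intros t [H1 H2]. apply cder_iff; auto.
  - intros ([A B] & D & E). do 3 (split; [auto|]). intros t H1 H2. apply cder_iff; auto.
Qed.

Lemma sol_unique_right F F' al be phi al' be' psi t0 t : (forall z, hol F z (F' z)) ->
  sol_on F al be phi -> sol_on F al' be' psi ->
  between al t0 be -> between al' t0 be' -> between al t be -> between al' t be' ->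
  t0 <= t -> phi t0 = psi t0 -> phi t = psi t.
Proof.
  intros HF H1 H2 A1 A2 B1 B2 Ht E.
  assert (D : forall p a b, sol_on F a b p -> between a t0 b -> between a t b ->
    forall s, 0 <= s <= t - t0 -> cder (fun u => p (u + t0)) s (1 * F (p (s + t0)))).
  { intros p a b Hp Ha Hb s Hs. rewrite Cmult_1_l. apply cder_shift. apply Hp.
    apply (between_mid a b t0 t); auto; lra. }
  pose proof (flow_unique F F' (fun _ => RtoC 1) 1 (fun u => phi (u + t0)) (fun u => psi (u + t0)) (t - t0) HF) as U.
  simpl in U. replace (t - t0 + t0) with t in U by ring. apply U; try lra.
  - intros. rewrite Cmod_1. lra.
  - apply (D phi al be); auto.
  - apply (D psi al' be'); auto.
  - rewrite !Rplus_0_l. auto.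
Qed.

Lemma between_opp al t be : between (Rbar_opp be) (- t) (Rbar_opp al) <-> between al t be.
Proof. unfold between. change (Finite (- t)) with (Rbar_opp t). rewrite !Rbar_opp_lt. tauto. Qed.

Lemma sol_on_opp F al be phi : sol_on F al be phi ->
  sol_on (neg_field F) (Rbar_opp be) (Rbar_opp al) (fun t => phi (- t)).
Proof.
  intros H t Ht. apply cder_reverse, H. apply between_opp. rewrite Ropp_involutive. auto.
Qed.

Lemma sol_unique F F' al be phi al' be' psi t0 t : (forall z, hol F z (F' z)) ->
  sol_on F al be phi -> sol_on F al' be' psi ->
  between al t0 be -> between al' t0 be' -> between al t be -> between al' t be' ->
  phi t0 = psi t0 -> phi t = psi t.
Proof.
  intros HF H1 H2 A1 A2 B1 B2 E. destruct (Rle_dec t0 t).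
  - apply (sol_unique_right F F' al be phi al' be' psi t0 t); auto.
  - apply sol_on_opp in H1. apply sol_on_opp in H2.
    apply between_opp in A1. apply between_opp in A2. apply between_opp in B1. apply between_opp in B2.
    pose proof (sol_unique_right _ _ _ _ _ _ _ _ (- t0) (- t) (hol_neg _ _ HF) H1 H2 A1 A2 B1 B2 ltac:(lra)) as U.
    simpl in U. rewrite !Ropp_involutive in U. auto.
Qed.

(** By uniqueness the two curves agree where both are defined, so near every time the glued curve
    coincides with one of them. *)
Lemma sol_glue F F' al be phi al' be' psi t0 a b : (forall z, hol F z (F' z)) ->
  sol_on F al be phi -> sol_on F al' be' psi ->
  between al t0 be -> between al' t0 be' -> phi t0 = psi t0 ->
  (forall t, between a t b -> between al t be \/ between al' t be') ->
  exists chi, sol_on F a b chi /\ (forall t, between al t be -> chi t = phi t) /\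
    (forall t, between al' t be' -> chi t = psi t).
Proof.
  intros HF H1 H2 A1 A2 E Hab.
  set (chi := fun t => if excluded_middle_informative (between al t be) then phi t else psi t).
  assert (E1 : forall t, between al t be -> chi t = phi t).
  { intros t Ht. unfold chi. destruct excluded_middle_informative; tauto. }
  assert (E2 : forall t, between al' t be' -> chi t = psi t).
  { intros t Ht. unfold chi. destruct excluded_middle_informative as [Hb|]; auto.
    apply (sol_unique F F' al be phi al' be' psi t0 t); auto. }
  exists chi. split; auto. intros t Ht. destruct (Hab t Ht) as [B|B].
  - destruct (between_open _ _ _ B) as [d [Hd A]]. rewrite E1 by auto.
    apply (cder_locally_eq phi chi t _ d); auto. intros s Hs. symmetry; apply E1; auto.
  - destruct (between_open _ _ _ B) as [d [Hd A]]. rewrite E2 by auto.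
    apply (cder_locally_eq psi chi t _ d); auto. intros s Hs. symmetry; apply E2; auto.
Qed.

(** The lifespan [T] is uniform on the disc, which is what prevents a bounded solution from ending
    in finite time. *)
Lemma local_solution F F' r : (forall z, hol F z (F' z)) -> 0 <= r ->
  exists T, 0 < T /\ forall x t0, Cmod x <= r -> exists phi, phi t0 = x /\ sol_on F (t0 - T) (t0 + T) phi.
Proof.
  intros HF Hr. destruct (flow_exists F F' r HF Hr) as [T [HT H]]. exists T. split; auto.
  intros x t0 Hx. destruct (H (fun _ => RtoC 1) 1 T x) as [phi [P0 P1]]; auto; try lra.
  - intros; apply ccont_const.
  - intros. rewrite Cmod_1. lra.
  - exists (fun u => phi (u + - t0)). split.
    + rewrite Rplus_opp_r. auto.
    + intros t [A1 A2]. simpl in *. apply cder_shift.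
      destruct (P1 (t + - t0)) as [D _]; [apply Rabs_def1; lra|]. rewrite Cmult_1_l in D. exact D.
Qed.

Lemma Rbar_between_dense (a b : Rbar) : Rbar_lt a b -> exists c : R, Rbar_lt a c /\ Rbar_lt c b.
Proof.
  destruct a as [a| |], b as [b| |]; simpl; try tauto; intros.
  - exists ((a + b) / 2). lra.
  - exists (a + 1). lra.
  - exists (b - 1). lra.
  - exists 0. auto.
Qed.

(** The union of all solutions on finite intervals about 0, compatible by uniqueness. It has no
    proper extension, because an extension restricted to a finite interval is already one of
    them. *)
Lemma maximal_exists F F' x : (forall z, hol F z (F' z)) ->
  exists al be phi, maximal_solution F x al be phi.
Proof.
  intros HF.
  set (S := fun (a b : R) (p : R -> C) => a < 0 < b /\ p 0 = x /\ sol_on F a b p).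
  destruct (local_solution F F' (Cmod x) HF (Cmod_ge_0 x)) as [T [HT HL]].
  destruct (HL x 0 (Rle_refl _)) as [p0 [Hp0 Sp0]].
  assert (S0 : S (0 - T) (0 + T) p0) by (split; [lra|split; auto]).
  set (be := Lub_Rbar (fun b => exists a p, S a b p)).
  set (al := Glb_Rbar (fun a => exists b p, S a b p)).
  destruct (Lub_Rbar_correct (fun b => exists a p, S a b p)) as [Ub Lb]. fold be in Ub, Lb.
  destruct (Glb_Rbar_correct (fun a => exists b p, S a b p)) as [Ua La]. fold al in Ua, La.
  assert (Z : between al 0 be).
  { split.
    - apply Rbar_le_lt_trans with (0 - T); [apply Ua; do 2 eexists; exact S0|simpl; lra].
    - apply Rbar_lt_le_trans with (0 + T); [simpl; lra|apply Ub; do 2 eexists; exact S0]. }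
  assert (Un : forall a b p a' b' p' t, S a b p -> S a' b' p' -> a < t < b -> a' < t < b' -> p t = p' t).
  { intros a b p a' b' p' t (A1 & A2 & A3) (B1 & B2 & B3) Ht Ht'.
    apply (sol_unique F F' a b p a' b' p' 0 t); auto; unfold between; simpl; try lra. congruence. }
  assert (Cov : forall t, between al t be -> exists a b p, S a b p /\ a < t < b).
  { intros t [A1 A2]. destruct (Rle_dec 0 t) as [Ht|Ht].
    - apply Classical_Prop.NNPP. intros N. apply Rbar_lt_not_le in A2. apply A2. apply Lb.
      intros b (a & p & Hs). simpl. apply Rnot_lt_le. intros Hb. apply N. exists a, b, p. split; auto.
      destruct Hs; lra.
    - apply Classical_Prop.NNPP. intros N. apply Rbar_lt_not_le in A1. apply A1. apply La.
      intros a (b & p & Hs). simpl. apply Rnot_lt_le. intros Hb. apply N. exists a, b, p. split; auto.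
      destruct Hs; lra. }
  set (phi := fun t => epsilon (inhabits x) (fun y => exists a b p, S a b p /\ a < t < b /\ y = p t)).
  assert (Ephi : forall a b p t, S a b p -> a < t < b -> phi t = p t).
  { intros a b p t Hs Ht.
    assert (Ex : exists y, exists a b p, S a b p /\ a < t < b /\ y = p t) by (exists (p t), a, b, p; auto).
    apply (epsilon_spec (inhabits x)) in Ex. fold (phi t) in Ex. destruct Ex as (a' & b' & p' & Hs' & Ht' & ->).
    apply (Un a' b' p' a b p t); auto. }
  assert (Sphi : sol_on F al be phi).
  { intros t Ht. destruct (Cov t Ht) as (a & b & p & Hs & Hab).
    destruct (between_open a b t) as [d [Hd A]]; [exact Hab|].
    rewrite (Ephi a b p t Hs Hab). apply (cder_locally_eq p phi t _ d); auto.
    - intros s Hst. symmetry. apply (Ephi a b); auto. apply (A s Hst).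
    - destruct Hs as (_ & _ & D). apply D. exact Hab. }
  exists al, be, phi. split.
  - apply solution_iff. split; auto. split; auto.
    rewrite (Ephi _ _ p0 0 S0); auto. lra.
  - intros al' be' psi Hs Ha Hb Hag. apply solution_iff in Hs. destruct Hs as (Z' & P0 & Sp).
    assert (Sub : forall a b : R, a < 0 < b -> Rbar_lt al' a -> Rbar_lt b be' -> S a b psi).
    { intros a b Hab H1 H2. split; auto. split; auto. intros t [A1 A2]. apply Sp. split.
      - eapply Rbar_lt_trans; [exact H1|exact A1].
      - eapply Rbar_lt_trans; [exact A2|exact H2]. }
    destruct Z' as [Z1 Z2].
    destruct (Rbar_between_dense _ _ Z1) as [a0 [Ha0 Ha0']].
    destruct (Rbar_between_dense _ _ Z2) as [b0 [Hb0 Hb0']]. simpl in Ha0', Hb0.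
    split; apply Rbar_le_antisym; auto.
    + apply Rbar_not_lt_le. intros L. destruct (Rbar_between_dense _ _ L) as [a [H1 H2]].
      assert (H3 : Rbar_lt a 0) by (eapply Rbar_lt_trans; [exact H2|apply Z]). simpl in H3.
      apply Rbar_lt_not_le in H2. apply H2. apply Ua. exists b0, psi. apply Sub; auto.
    + apply Rbar_not_lt_le. intros L. destruct (Rbar_between_dense _ _ L) as [b [H1 H2]].
      assert (H3 : Rbar_lt 0 b) by (eapply Rbar_lt_trans; [apply Z|exact H1]). simpl in H3.
      apply Rbar_lt_not_le in H1. apply H1. apply Ub. exists a0, psi. apply Sub; auto.
Qed.

Lemma maximal_right F F' x al be phi al' be' psi t0 : (forall z, hol F z (F' z)) ->
  maximal_solution F x al be phi -> sol_on F al' be' psi ->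
  between al t0 be -> between al' t0 be' -> phi t0 = psi t0 -> Rbar_le be' be.
Proof.
  intros HF [Hs Hm] Hpsi A1 A2 E. apply solution_iff in Hs. destruct Hs as (Z & P0 & Sp).
  apply Rbar_not_lt_le. intros L.
  destruct (sol_glue F F' al be phi al' be' psi t0 al be' HF Sp Hpsi A1 A2 E) as (chi & S & E1 & E2).
  { intros t [B1 B2]. destruct (Rbar_lt_dec t be) as [Q|Q]; [left; split; auto|].
    right. split; auto. apply Rbar_not_lt_le in Q. apply Rbar_lt_trans with t0; [apply A2|].
    eapply Rbar_lt_le_trans; [apply A1|auto]. }
  destruct (Hm al be' chi) as [_ Q].
  - apply solution_iff. split; [|split; auto].
    + split; [apply Z|]. eapply Rbar_lt_trans; [apply Z|auto].
    + rewrite E1; auto.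
  - apply Rbar_le_refl.
  - apply Rbar_lt_le; auto.
  - intros t B1 B2. apply E1. split; auto.
  - rewrite Q in L. apply Rbar_lt_not_eq in L. auto.
Qed.

Lemma maximal_opp F x al be phi : maximal_solution F x al be phi ->
  maximal_solution (neg_field F) x (Rbar_opp be) (Rbar_opp al) (fun t => phi (- t)).
Proof.
  intros [Hs Hm]. apply solution_iff in Hs. destruct Hs as (Z & P0 & Sp). split.
  - apply solution_iff. split; [|split].
    + rewrite <- Ropp_0. apply between_opp; auto.
    + rewrite Ropp_0; auto.
    + apply sol_on_opp; auto.
  - intros al' be' psi Hs' Ha Hb Hag. apply solution_iff in Hs'. destruct Hs' as (Z' & P0' & Sp').
    destruct (Hm (Rbar_opp be') (Rbar_opp al') (fun t => psi (- t))) as [Q1 Q2].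
    + apply solution_iff. split; [|split].
      * rewrite <- Ropp_0. apply between_opp; auto.
      * rewrite Ropp_0; auto.
      * rewrite <- (neg_field_invol F). apply sol_on_opp; auto.
    + rewrite <- (Rbar_opp_involutive al). apply Rbar_opp_le. auto.
    + rewrite <- (Rbar_opp_involutive be). apply Rbar_opp_le. auto.
    + intros t B1 B2. rewrite Hag.
      * rewrite Ropp_involutive; auto.
      * apply (between_opp al t be). split; auto.
      * apply (between_opp al t be). split; auto.
    + rewrite <- Q1, <- Q2, !Rbar_opp_involutive. auto.
Qed.

Lemma maximal_left F F' x al be phi al' be' psi t0 : (forall z, hol F z (F' z)) ->
  maximal_solution F x al be phi -> sol_on F al' be' psi ->
  between al t0 be -> between al' t0 be' -> phi t0 = psi t0 -> Rbar_le al al'.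
Proof.
  intros HF Hm Hpsi A1 A2 E. rewrite <- (Rbar_opp_involutive al), <- (Rbar_opp_involutive al').
  apply Rbar_opp_le.
  apply (maximal_right _ _ x (Rbar_opp be) (Rbar_opp al) (fun t => phi (- t)) (Rbar_opp be') (Rbar_opp al') (fun t => psi (- t)) (- t0) (hol_neg _ _ HF)).
  - apply maximal_opp; auto.
  - apply sol_on_opp; auto.
  - apply between_opp; auto.
  - apply between_opp; auto.
  - rewrite Ropp_involutive; auto.
Qed.

Lemma maximal_sol F x al be phi : maximal_solution F x al be phi ->
  between al 0 be /\ phi 0 = x /\ sol_on F al be phi.
Proof. intros [H _]. apply solution_iff; auto. Qed.

Lemma Rbar_eq_opp (a b : Rbar) : Rbar_opp a = Rbar_opp b -> a = b.
Proof. intros H. rewrite <- (Rbar_opp_involutive a), H. apply Rbar_opp_involutive. Qed.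

Lemma maximal_bounded_right F F' x al be phi r t1 : (forall z, hol F z (F' z)) ->
  maximal_solution F x al be phi -> between al t1 be ->
  (forall t, between al t be -> t1 <= t -> Cmod (phi t) <= r) -> be = p_infty.
Proof.
  intros HF Hm Ht1 Hb. destruct (maximal_sol _ _ _ _ _ Hm) as (Z & P0 & Sp).
  assert (Hr : 0 <= r) by (eapply Rle_trans; [apply Cmod_ge_0|apply (Hb t1); auto; lra]).
  destruct (local_solution F F' r HF Hr) as [T [HT HL]].
  destruct be as [b| |]; auto; [exfalso|destruct Ht1; simpl in *; tauto].
  (* A local solution restarted within T / 2 of the finite end [b] lasts beyond it. *)
  set (t0 := Rmax t1 (b - T / 2)).
  assert (Hb1 : t1 < b) by apply Ht1.
  assert (Q : t1 <= t0 < b /\ b - T / 2 <= t0) by (unfold t0, Rmax; destruct Rle_dec; lra).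
  assert (A : between al t0 b).
  { split; [|simpl; lra]. eapply Rbar_lt_le_trans; [apply Ht1|simpl; lra]. }
  destruct (HL (phi t0) t0 (Hb t0 A (proj1 (proj1 Q)))) as [psi [E Sps]].
  pose proof (maximal_right F F' x al b phi _ _ psi t0 HF Hm Sps A) as W.
  assert (W' : Rbar_le (t0 + T) b) by (apply W; [split; simpl; lra|auto]). simpl in W'. lra.
Qed.

Lemma maximal_unique F F' x al be phi al' be' psi : (forall z, hol F z (F' z)) ->
  maximal_solution F x al be phi -> maximal_solution F x al' be' psi ->
  al = al' /\ be = be' /\ forall t, between al t be -> phi t = psi t.
Proof.
  intros HF H H'. destruct (maximal_sol _ _ _ _ _ H) as (Z & P0 & S).
  destruct (maximal_sol _ _ _ _ _ H') as (Z' & P0' & S').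
  assert (E : phi 0 = psi 0) by congruence. assert (E' : psi 0 = phi 0) by congruence.
  assert (al = al').
  { apply Rbar_le_antisym; [eapply (maximal_left F F' x al be phi)|eapply (maximal_left F F' x al' be' psi)]; eauto. }
  assert (be = be').
  { apply Rbar_le_antisym; [eapply (maximal_right F F' x al' be' psi)|eapply (maximal_right F F' x al be phi)]; eauto. }
  subst al' be'. repeat split; auto. intros t Ht. apply (sol_unique F F' al be phi al be psi 0 t); auto.
Qed.


Lemma between_shift al be (s t : R) : between (Rbar_plus al s) (t + s) (Rbar_plus be s) <-> between al t be.
Proof.
  destruct al, be; unfold between; simpl; split; intros [? ?]; split; try tauto; lra.
Qed.

Lemma Rbar_plus_shift_inv (a : Rbar) (s : R) : Rbar_plus (Rbar_plus a s) (- s) = a.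
Proof. destruct a; simpl; auto. f_equal. ring. Qed.

Lemma sol_on_shift F al be phi (s : R) : sol_on F al be phi ->
  sol_on F (Rbar_plus al (- s)) (Rbar_plus be (- s)) (fun t => phi (t + s)).
Proof.
  intros H t Ht. apply cder_shift, H. apply (between_shift _ _ (- s)).
  replace (t + s + - s) with t by ring. auto.
Qed.

Lemma maximal_shift F x al be phi (s : R) : maximal_solution F x al be phi -> between al s be ->
  (forall z, exists l, hol F z l) ->
  maximal_solution F (phi s) (Rbar_plus al (- s)) (Rbar_plus be (- s)) (fun t => phi (t + s)).
Proof.
  intros Hm Hs HE. destruct (maximal_sol _ _ _ _ _ Hm) as (Z & P0 & S).
  split.
  - apply solution_iff. split; [|split].
    + apply (between_shift _ _ s). rewrite <- (Ropp_involutive s) at 2 5. rewrite !Rbar_plus_shift_inv, Rplus_0_l. auto.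
    + rewrite Rplus_0_l; auto.
    + apply sol_on_shift; auto.
  - intros al' be' psi H' Ha Hb Hag. apply solution_iff in H'. destruct H' as (Z' & P0' & S').
    assert (HF : forall z, hol F z (epsilon (inhabits (RtoC 0)) (hol F z))).
    { intros z. apply epsilon_spec, HE. }
    pose proof (sol_on_shift F al' be' psi (- s) S') as S2. rewrite Ropp_involutive in S2.
    assert (B : between (Rbar_plus al' s) s (Rbar_plus be' s)).
    { replace s with (0 + s) at 2 by ring. apply between_shift; auto. }
    assert (E : phi s = psi (s + - s)) by (rewrite Rplus_opp_r; auto).
    pose proof (maximal_right F _ x al be phi _ _ (fun t => psi (t + - s)) s HF Hm S2 Hs B E) as W1.
    pose proof (maximal_left F _ x al be phi _ _ (fun t => psi (t + - s)) s HF Hm S2 Hs B E) as W2.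
    split; apply Rbar_le_antisym; auto.
    + destruct al, al'; simpl in *; try tauto; lra.
    + destruct be, be'; simpl in *; try tauto; lra.
Qed.

(** * Limit sets *)

Definition clim (z : nat -> C) (y : C) : Prop :=
  forall e, 0 < e -> exists N, forall n, (N <= n)%nat -> Cmod (z n - y) < e.

Lemma clim_iff z y : filterlim z eventually (locally (T := C_UniformSpace) y) <-> clim z y.
Proof.
  split.
  - intros H e He. apply (H (fun w => Cmod (w - y) < e)). apply locally_Cmod. exists e; auto.
  - intros H P HP. apply locally_Cmod in HP. destruct HP as [e [He HP]].
    destruct (H e He) as [N HN]. exists N. intros n Hn. apply HP, HN, Hn.
Qed.

Lemma choice_nat {A : Type} (P : nat -> A -> Prop) : (forall n, exists x, P n x) -> exists f, forall n, P n (f n).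
Proof.
  intros H. exists (fun n => proj1_sig (constructive_indefinite_description _ (H n))).
  intros n. apply proj2_sig.
Qed.

Lemma inv_succ_small e : 0 < e -> exists N, forall n, (N <= n)%nat -> / (INR n + 1) < e.
Proof.
  intros He. destruct (archimed_cor1 e He) as [N [HN HN']]. exists N. intros n Hn.
  eapply Rlt_trans; [|exact HN]. apply Rinv_lt_contravar.
  - apply Rmult_lt_0_compat; [apply lt_0_INR; auto|]. pose proof (pos_INR n); lra.
  - apply le_INR in Hn. lra.
Qed.

Lemma bounded_subseq_R (x : nat -> R) M : (forall n, Rabs (x n) <= M) ->
  exists l (s : nat -> nat), (forall n, (n <= s n)%nat) /\ forall n, Rabs (x (s n) - l) < / (INR n + 1).
Proof.
  intros H. destruct (Bolzano_Weierstrass x (fun c => - M <= c <= M) (compact_P3 _ _)) as [l Hl].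
  { intros n. apply Rabs_le_between, H. }
  exists l.
  destruct (choice_nat (fun n s => (n <= s)%nat /\ Rabs (x s - l) < / (INR n + 1))) as [s Hs].
  - intros n. assert (P : 0 < / (INR n + 1)) by (apply Rinv_0_lt_compat; pose proof (pos_INR n); lra).
    destruct (Hl (disc l (mkposreal _ P)) n) as [p [Hp Hd]]; [exists (mkposreal _ P); intros y Hy; exact Hy|].
    exists p; auto.
  - exists s. split; intros n; apply Hs.
Qed.

Lemma bounded_subseq (z : nat -> C) M : (forall n, Cmod (z n) <= M) ->
  exists y (s : nat -> nat), (forall n, (n <= s n)%nat) /\ clim (fun n => z (s n)) y.
Proof.
  intros H.
  destruct (bounded_subseq_R (fun n => fst (z n)) M) as (a & s & Hs & Ha).
  { intros n. eapply Rle_trans; [apply Cmod_abs_fst|apply H]. }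
  destruct (bounded_subseq_R (fun n => snd (z (s n))) M) as (b & s' & Hs' & Hb).
  { intros n. eapply Rle_trans; [apply Cmod_abs_snd|apply H]. }
  exists (a, b), (fun n => s (s' n)). split.
  { intros n. eapply Nat.le_trans; [apply Hs'|apply Hs]. }
  intros e He. destruct (inv_succ_small (e / 2) ltac:(lra)) as [N HN]. exists N. intros n Hn.
  eapply Rle_lt_trans; [apply Cmod_le_sum|]. simpl.
  specialize (Ha (s' n)). specialize (Hb n).
  pose proof (HN n Hn). pose proof (HN (s' n) ltac:(specialize (Hs' n); lia)).
  unfold Rminus in *. lra.
Qed.

Lemma clim_unique z a b : clim z a -> clim z b -> a = b.
Proof.
  intros Ha Hb. apply Ceq_minus, Cmod_eq_0, Rle_antisym; [|apply Cmod_ge_0].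
  apply le_epsilon. intros e He. rewrite Rplus_0_l.
  destruct (Ha (e / 2) ltac:(lra)) as [N1 H1]. destruct (Hb (e / 2) ltac:(lra)) as [N2 H2].
  specialize (H1 (N1 + N2)%nat ltac:(lia)). specialize (H2 (N1 + N2)%nat ltac:(lia)).
  eapply Rle_trans; [apply (Cmod_tri _ (z (N1 + N2)%nat))|]. rewrite Cmod_sym. lra.
Qed.

Lemma clim_dist (z : nat -> C) y a e : clim z y -> (forall n, Cmod (z n - a) = e) -> Cmod (y - a) = e.
Proof.
  intros H E. apply cond_eq. intros d Hd. destruct (H d Hd) as [N HN]. specialize (HN N (Nat.le_refl _)).
  specialize (E N). pose proof (Cmod_tri y (z N) a). pose proof (Cmod_tri (z N) y a).
  rewrite (Cmod_sym y (z N)) in H0. apply Rabs_def1; lra.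
Qed.

Lemma is_lim_seq_extraction (u : nat -> R) (s : nat -> nat) l : (forall n, (n <= s n)%nat) ->
  is_lim_seq u l -> is_lim_seq (fun n => u (s n)) l.
Proof.
  intros Hs H. apply (filterlim_comp _ _ _ s u eventually eventually); auto.
  intros P [N HN]. exists N. intros n Hn. apply HN. eapply Nat.le_trans; [exact Hn|apply Hs].
Qed.

Lemma is_lim_seq_squeeze_end al be (t u : nat -> R) : (forall n, between al (u n) be) ->
  (forall n, t n <= u n) -> is_lim_seq t be -> is_lim_seq u be.
Proof.
  intros Hu Hle Ht. destruct be as [b| |].
  - apply (is_lim_seq_le_le t u (fun _ => b)); auto; [|apply is_lim_seq_const].
    intros n. split; auto. left. apply (proj2 (Hu n)).
  - apply (is_lim_seq_le_p_loc t u); auto. exists O; auto.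
  - destruct (Hu O) as [_ []].
Qed.

Lemma ccont_dist f a t : ccont f t -> continuity_pt (fun s => Cmod (f s - a)) t.
Proof.
  intros H. apply continuity_pt_filterlim. intros P [e He]. apply locally_R.
  destruct (H e (cond_pos e)) as [d [Hd A]]. exists d. split; auto. intros s Hs. apply He.
  specialize (A s Hs). change (Rabs (Cmod (f s - a) - Cmod (f t - a)) < e).
  pose proof (Cmod_tri (f s) (f t) a) as T1. pose proof (Cmod_tri (f t) (f s) a) as T2. rewrite (Cmod_sym (f t) (f s)) in T2.
  apply Rabs_def1; lra.
Qed.

(* An accumulation point that is the only one is a limit: otherwise the orbit crosses a small
   circle around it infinitely often and accumulates on that circle too. *)
Lemma unique_limit_point_cv al be phi t a :
  (forall s, between al s be -> ccont phi s) ->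
  (forall n : nat, between al (t n) be) -> is_lim_seq t be -> clim (fun n => phi (t n)) a ->
  (forall y s, (forall n : nat, between al (s n) be) -> is_lim_seq s be -> clim (fun n => phi (s n)) y -> y = a) ->
  forall e, 0 < e -> exists T, between al T be /\ forall s, T <= s -> between al s be -> Cmod (phi s - a) < e.
Proof.
  intros Hc Ht Hlim Ha Hu e He. apply Classical_Prop.NNPP. intros N.
  destruct (Ha e He) as [N0 HN0].
  assert (Step : forall n, exists u, t (N0 + n)%nat <= u /\ between al u be /\ Cmod (phi u - a) = e).
  { intros n. set (T := t (N0 + n)%nat). assert (HT : Cmod (phi T - a) < e) by (apply HN0; lia).
    assert (Ex : exists s, T <= s /\ between al s be /\ e <= Cmod (phi s - a)).
    { apply Classical_Prop.NNPP. intros M. apply N. exists T. split; [apply Ht|].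
      intros s Hs1 Hs2. apply Rnot_le_lt. intros Q. apply M. exists s; auto. }
    destruct Ex as (s & Hs1 & Hs2 & Hs3).
    destruct (Rle_lt_or_eq_dec _ _ Hs3) as [L|L]; [|exists s; auto].
    destruct (IVT_interv (fun u => Cmod (phi u - a) - e) T s) as [u [[Hu1 Hu2] Hu3]]; try lra.
    - intros u Hu1. apply (continuity_pt_minus (fun u => Cmod (phi u - a)) (fun _ => e)).
      + apply ccont_dist, Hc. apply (between_mid al be T s); auto. apply Ht.
      + apply continuity_pt_const. intros x y; auto.
    - destruct (Req_dec T s) as [E|E]; [|lra]. exfalso. rewrite <- E in L. lra.
    - exists u. split; auto. split; [|lra]. apply (between_mid al be T s); auto. apply Ht. }
  destruct (choice_nat _ Step) as [u Hu'].
  destruct (bounded_subseq (fun n => phi (u n)) (e + Cmod a)) as (y & s & Hs & Hy).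
  { intros n. destruct (Hu' n) as (_ & _ & E). pose proof (Cmod_rev (phi (u n)) a). lra. }
  assert (Ey : Cmod (y - a) = e).
  { apply (clim_dist (fun n => phi (u (s n)))); auto. intros n. apply Hu'. }
  assert (y = a).
  { apply (Hu y (fun n => u (s n))); auto.
    - intros n. apply Hu'.
    - apply (is_lim_seq_extraction u s); auto.
      apply (is_lim_seq_squeeze_end al be (fun n => t (N0 + n)%nat)); [intros; apply Hu'|intros; apply Hu'|].
      apply (is_lim_seq_extraction t (fun n => (N0 + n)%nat)); auto. intros; lia. }
  subst y. replace (a - a)%C with (RtoC 0) in Ey by ring. rewrite Cmod_0 in Ey. lra.
Qed.

Definition tends (phi : R -> C) (a : C) : Prop :=
  forall e, 0 < e -> exists T, forall t, T <= t -> Cmod (phi t - a) < e.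

(** The domain reaches slightly to the left of 0 because the derivative at 0 is two-sided. *)
Definition conv (F : C -> C) (x a : C) : Prop :=
  exists phi e, 0 < e /\ phi 0 = x /\ sol_on F (- e) p_infty phi /\ tends phi a.

Lemma tends_shift phi a s : tends phi a -> tends (fun t => phi (t + s)) a.
Proof. intros H e He. destruct (H e He) as [T HT]. exists (T - s). intros t Ht. apply HT. lra. Qed.

Lemma tends_clim phi a (t : nat -> R) : tends phi a -> is_lim_seq t p_infty -> clim (fun n => phi (t n)) a.
Proof.
  intros H Ht e He. destruct (H e He) as [T HT]. apply is_lim_seq_spec in Ht. destruct (Ht T) as [N HN].
  exists N. intros n Hn. apply HT. left. apply HN; auto.
Qed.

Lemma conv_maximal F F' x a al be phi : (forall z, hol F z (F' z)) ->
  conv F x a -> maximal_solution F x al be phi -> be = p_infty /\ tends phi a.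
Proof.
  intros HF (psi & e & He & P0 & Sp & Ht) Hm. destruct (maximal_sol _ _ _ _ _ Hm) as (Z & Q0 & Sq).
  assert (Z' : between (- e) 0 p_infty) by (split; simpl; auto; lra).
  assert (E : phi 0 = psi 0) by congruence.
  pose proof (maximal_right F F' x al be phi (- e) p_infty psi 0 HF Hm Sp Z Z' E) as W.
  assert (Ebe : be = p_infty) by (destruct be; simpl in W; tauto). split; auto. subst be.
  intros d Hd. destruct (Ht d Hd) as [T HT]. exists (Rmax 0 T). intros t Ht'.
  pose proof (Rmax_l 0 T). pose proof (Rmax_r 0 T).
  rewrite (sol_unique F F' al p_infty phi (- e) p_infty psi 0 t); auto.
  - apply HT; lra.
  - split; simpl; auto. apply Rbar_lt_le_trans with 0; [apply Z|simpl; lra].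
  - split; simpl; auto. lra.
Qed.

(** Limit sets leave the base point on the orbit free; here uniqueness of maximal solutions reduces
    that freedom to a time shift. *)
Lemma orbit_maximal F F' x y al be phi al' be' psi : (forall z, hol F z (F' z)) ->
  maximal_solution F x al be phi -> orbit F x y -> maximal_solution F y al' be' psi ->
  exists t1, between al t1 be /\ al' = Rbar_plus al (- t1) /\ be' = Rbar_plus be (- t1) /\
    forall t, between al' t be' -> psi t = phi (t + t1).
Proof.
  intros HF Hm (al1 & be1 & phi1 & Hm1 & t1 & A1 & A2 & <-) Hm'.
  destruct (maximal_unique F F' x _ _ _ _ _ _ HF Hm Hm1) as (<- & <- & E).
  exists t1. split; [split; auto|]. rewrite <- E in Hm' by (split; auto).
  assert (Hs : maximal_solution F (phi t1) (Rbar_plus al (- t1)) (Rbar_plus be (- t1)) (fun t => phi (t + t1))).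
  { apply (maximal_shift F x); eauto. split; auto. }
  destruct (maximal_unique F F' _ _ _ _ _ _ _ HF Hm' Hs) as (-> & -> & E'). auto.
Qed.

(** A single forward limit point forces convergence, hence boundedness near the right end, hence an
    infinite right end. *)
Lemma H_plus_conv F F' x a : (forall z, hol F z (F' z)) -> (H_plus F a x <-> conv F x a).
Proof.
  intros HF. destruct (maximal_exists F F' x HF) as (al & be & phi & Hm).
  destruct (maximal_sol _ _ _ _ _ Hm) as (Z & P0 & S). split.
  - intros H. destruct (proj2 (H a) eq_refl) as (x' & al' & be' & psi & t & Hx' & Hm' & Ht & Hlim & Hcv).
    apply clim_iff in Hcv.
    destruct (maximal_sol _ _ _ _ _ Hm') as (Z' & P0' & S').
    pose proof (unique_limit_point_cv al' be' psi t a) as U.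
    assert (V : forall e, 0 < e -> exists T, between al' T be' /\ forall s, T <= s -> between al' s be' -> Cmod (psi s - a) < e).
    { apply U; auto.
      - intros s Hs. eapply cder_ccont, S'; auto.
      - intros y s Hs Hs' Hy. apply H. exists x', al', be', psi, s. split; auto. split; auto. split; auto. split; auto.
        apply clim_iff; auto. }
    destruct (V 1 Rlt_0_1) as (T1 & HT1 & HB).
    assert (Ebe : be' = p_infty).
    { apply (maximal_bounded_right F F' x' al' be' psi (1 + Cmod a) T1 HF Hm' HT1).
      intros s Hs Hs1. pose proof (HB s Hs1 Hs). pose proof (Cmod_rev (psi s) a). lra. }
    destruct (orbit_maximal F F' x x' al be phi al' be' psi HF Hm Hx' Hm') as (t1 & Ht1 & Ea & Eb & E).
    assert (Ebe' : be = p_infty).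
    { rewrite Ebe in Eb. destruct be; simpl in Eb; auto; discriminate. }
    subst be be'.
    destruct (Rbar_between_dense _ _ (proj1 Z)) as [e [He1 He2]]. simpl in He2.
    exists phi, (- e). split; [lra|]. split; auto. split.
    + intros s [Hs1 Hs2]. apply S. split; auto. simpl in Hs1. rewrite Ropp_involutive in Hs1.
      apply Rbar_lt_trans with e; auto.
    + intros d Hd. destruct (V d Hd) as (T & HT & HT'). exists (T + t1). intros s Hs.
      assert (B : between al' (s - t1) p_infty).
      { split; simpl; auto. apply Rbar_lt_le_trans with T; [apply HT|simpl; lra]. }
      replace s with (s - t1 + t1) by ring. rewrite <- E by auto. apply HT'; auto. lra.
  - intros Hc. destruct (conv_maximal F F' x a al be phi HF Hc Hm) as [-> Ht]. intros y. split.
    + intros (x' & al' & be' & psi & t & Hx' & Hm' & Htb & Hlim & Hcv). apply clim_iff in Hcv.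
      destruct (orbit_maximal F F' x x' al p_infty phi al' be' psi HF Hm Hx' Hm') as (t1 & Ht1 & Ea & Eb & E).
      simpl in Eb. subst be'.
      apply (clim_unique (fun n => psi (t n))); auto.
      intros e He. destruct (tends_clim _ _ t (tends_shift _ _ t1 Ht) Hlim e He) as [N HN].
      exists N. intros n Hn. rewrite E by apply Htb. auto.
    + intros ->. exists x, al, p_infty, phi, (fun n => INR n).
      split; [exists al, p_infty, phi; split; auto; exists 0; repeat split; auto; apply Z|].
      split; auto. split.
      { intros n. split; simpl; auto. apply Rbar_lt_le_trans with 0; [apply Z|simpl; apply pos_INR]. }
      split; [apply is_lim_seq_INR|]. apply clim_iff. apply (tends_clim phi); auto. apply is_lim_seq_INR.
Qed.

Lemma orbit_neg F x y : orbit F x y -> orbit (neg_field F) x y.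
Proof.
  intros (al & be & phi & Hm & t & A1 & A2 & E).
  exists (Rbar_opp be), (Rbar_opp al), (fun t => phi (- t)). split; [apply maximal_opp; auto|].
  exists (- t). rewrite Ropp_involutive.
  assert (B : between (Rbar_opp be) (- t) (Rbar_opp al)) by (apply between_opp; split; auto).
  destruct B. auto.
Qed.

Lemma w_minus_neg F x y : w_minus F (orbit F x) y -> w_plus (neg_field F) (orbit (neg_field F) x) y.
Proof.
  intros (x' & al & be & phi & t & Hx & Hm & Ht & Hlim & Hcv).
  exists x', (Rbar_opp be), (Rbar_opp al), (fun t => phi (- t)), (fun n => - t n).
  split; [apply orbit_neg; auto|]. split; [apply maximal_opp; auto|]. split; [|split].
  - intros n. apply between_opp. apply Ht.
  - apply (is_lim_seq_opp t). auto.
  - apply clim_iff. apply clim_iff in Hcv. intros e He. destruct (Hcv e He) as [N HN].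
    exists N. intros n Hn. rewrite Ropp_involutive. auto.
Qed.

Lemma w_plus_neg F x y : w_plus (neg_field F) (orbit (neg_field F) x) y -> w_minus F (orbit F x) y.
Proof.
  intros (x' & al & be & phi & t & Hx & Hm & Ht & Hlim & Hcv).
  exists x', (Rbar_opp be), (Rbar_opp al), (fun t => phi (- t)), (fun n => - t n).
  rewrite <- (neg_field_invol F) at 1 2.
  split; [apply orbit_neg; auto|]. split; [apply maximal_opp; auto|]. split; [|split].
  - intros n. apply between_opp. apply Ht.
  - apply (is_lim_seq_opp t). auto.
  - apply clim_iff. apply clim_iff in Hcv. intros e He. destruct (Hcv e He) as [N HN].
    exists N. intros n Hn. rewrite Ropp_involutive. auto.
Qed.

Lemma H_minus_conv F F' x a : (forall z, hol F z (F' z)) -> (H_minus F a x <-> conv (neg_field F) x a).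
Proof.
  intros HF. rewrite <- (H_plus_conv _ _ x a (hol_neg _ _ HF)). unfold H_minus, H_plus, set_eq.
  split; intros H z; specialize (H z); rewrite <- H; split; try apply w_minus_neg; apply w_plus_neg.
Qed.

(** * Transporting a bounded solution to nearby initial values *)

Lemma hcont_lower F x : hcont F x -> F x <> 0 ->
  exists d, 0 < d /\ forall z, Cmod (z - x) < d -> Cmod (F x) / 2 <= Cmod (F z).
Proof.
  intros H Hx. assert (P : 0 < Cmod (F x)) by (apply Cmod_gt_0; auto).
  destruct (H (Cmod (F x) / 2) ltac:(lra)) as [d [Hd A]]. exists d. split; auto.
  intros z Hz. specialize (A z Hz). pose proof (Cmod_rev (F x) (F z)). rewrite Cmod_sym in A. lra.
Qed.

(* The flow of [c u * F] in the parameter [u] commutes with the flow of [F] in time: the defect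
   [E u = h s u - h t u - (s - t) F (h t u)] satisfies a linear differential inequality
   up to an error of order [(s - t)^2]. *)
Lemma flows_commute F F' (c : R -> C) c0 r (phi : R -> C) (h : R -> R -> C) t :
  (forall z, hol F z (F' z)) -> (forall u, Cmod (c u) <= c0) ->
  (forall s, h s 0 = phi s) ->
  (forall s u, 0 <= u <= 1 -> cder (h s) u (c u * F (h s u)) /\ Cmod (h s u) <= r) ->
  cder phi t (F (phi t)) -> cder (fun s => h s 1) t (F (h t 1)).
Proof.
  intros HF Hc H0 Hh Hphi e He.
  assert (Hc0 : 0 <= c0) by (eapply Rle_trans; [apply Cmod_ge_0|apply (Hc 0)]).
  destruct (lip_on_disc F F' r HF) as [L HL].
  destruct (taylor_on_disc F F' r HF) as (M & HM & HMF & HMF' & HMT).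
  pose proof HL as [HL0 _].
  assert (Hbt : forall s, Cmod (phi s) <= r) by (intros s; rewrite <- H0; apply Hh; lra).
  set (K := exp (2 * (c0 * L) + 1)). assert (HK : 0 < K) by apply exp_pos.
  assert (HcL : 0 <= c0 * L) by (apply Rmult_le_pos; auto).
  assert (HcM : 0 <= c0 * M) by (apply Rmult_le_pos; auto).
  (* [D] is the Gronwall factor for the defect up to u = 1. [Q * (s - t)^2] bounds the Taylor
     remainder of [F] between [h t u] and [h s u], whose distance is at most (M + 1) K |s - t|. *)
  set (D := exp ((2 * (c0 * M) + 1) * 1)). assert (HD : 0 < D) by apply exp_pos.
  set (Q := c0 * M * ((M + 1) * K * ((M + 1) * K))).
  assert (HQ : 0 <= Q).
  { unfold Q. apply Rmult_le_pos; auto. apply Rle_0_sqr. }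
  destruct (Hphi 1 Rlt_0_1) as [d1 [Hd1 A1]].
  destruct (Hphi (e / (2 * D)) ltac:(apply Rdiv_lt_0_compat; lra)) as [d2 [Hd2 A2]].
  assert (HD3 : 0 < e / (2 * D * (Q + 1))).
  { apply Rdiv_lt_0_compat; auto. apply Rmult_lt_0_compat; lra. }
  (* [d1] yields the Lipschitz bound for [phi]; [d2] spends half of [e] on the initial defect [E 0],
     and the third bound spends the other half on the quadratic error. *)
  exists (Rmin d1 (Rmin d2 (e / (2 * D * (Q + 1))))). split; [repeat apply Rmin_pos; auto|].
  intros s Hs. set (k := Rabs (s - t)) in *.
  assert (Hk1 : k < d1) by (eapply Rlt_le_trans; [exact Hs|apply Rmin_l]).
  assert (Hk2 : k < d2) by (eapply Rlt_le_trans; [exact Hs|eapply Rle_trans; [apply Rmin_r|apply Rmin_l]]).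
  assert (Hk3 : k < e / (2 * D * (Q + 1))) by (eapply Rlt_le_trans; [exact Hs|eapply Rle_trans; [apply Rmin_r|apply Rmin_r]]).
  specialize (A1 s Hk1). specialize (A2 s Hk2). fold k in A1, A2.
  assert (k0 : 0 <= k) by apply Rabs_pos.
  assert (Lphi : Cmod (phi s - phi t) <= (M + 1) * k).
  { replace (phi s - phi t)%C with ((phi s - phi t - RtoC (s - t) * F (phi t)) + RtoC (s - t) * F (phi t))%C by ring.
    eapply Rle_trans; [apply Cmod_triangle|]. rewrite Cmod_mult, Cmod_R. fold k.
    specialize (HMF (phi t) (Hbt t)). nra. }
  assert (Lh : forall u, 0 <= u <= 1 -> Cmod (h s u - h t u) <= (M + 1) * K * k).
  { intros u Hu. eapply Rle_trans; [apply (flow_dist F r L c c0 (h s) (h t) u); auto; try lra|].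
    - intros v Hv. apply Hh; lra.
    - intros v Hv. apply Hh; lra.
    - rewrite !H0. replace ((M + 1) * K * k) with ((M + 1) * k * K) by ring.
      apply Rmult_le_compat; auto; [apply Cmod_ge_0|left; apply exp_pos|].
      unfold K. destruct (Req_dec u 1) as [->|]; [rewrite Rmult_1_r; lra|].
      left. apply exp_increasing. nra. }
  set (E := fun u => (h s u - h t u - RtoC (s - t) * F (h t u))%C).
  set (E' := fun u => (c u * F (h s u) - c u * F (h t u) - RtoC (s - t) * (F' (h t u) * (c u * F (h t u))))%C).
  pose proof (gronwall E E' (c0 * M) (Q * (k * k)) 1) as G. fold D in G.
  assert (G' : Cmod (E 1) <= (Cmod (E 0) + Q * (k * k)) * D).
  { apply G; try lra.
    - apply Rmult_le_pos; auto. nra.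
    - intros u Hu. destruct (Hh s u Hu) as [Ds _]. destruct (Hh t u Hu) as [Dt _].
      apply cder_minus; [apply cder_minus; auto|]. apply cder_scal. apply (cder_comp F (h t)); auto.
    - intros u Hu. destruct (Hh s u Hu) as [Ds Bs]. destruct (Hh t u Hu) as [Dt Bt].
      unfold E'. replace (c u * F (h s u) - c u * F (h t u) - RtoC (s - t) * (F' (h t u) * (c u * F (h t u))))%C with
        (c u * ((F (h s u) - F (h t u) - F' (h t u) * (h s u - h t u)) + F' (h t u) * E u))%C by (unfold E; ring).
      rewrite Cmod_mult.
      apply Rle_trans with (c0 * (M * ((M + 1) * K * k * ((M + 1) * K * k)) + M * Cmod (E u))).
      + apply Rmult_le_compat; try apply Cmod_ge_0; auto.
        eapply Rle_trans; [apply Cmod_triangle|]. rewrite Cmod_mult. apply Rplus_le_compat.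
        * eapply Rle_trans; [apply HMT; auto|]. apply Rmult_le_compat_l; auto.
          specialize (Lh u Hu). apply Rmult_le_compat; auto; apply Cmod_ge_0.
        * apply Rmult_le_compat_r; [apply Cmod_ge_0|apply HMF'; auto].
      + unfold Q. right. ring. }
  change (h s 1 - h t 1 - RtoC (s - t) * F (h t 1))%C with (E 1).
  eapply Rle_trans; [exact G'|].
  assert (E0 : Cmod (E 0) <= e / (2 * D) * k) by (unfold E; rewrite !H0; exact A2).
  assert (Hkk : k * (2 * D * (Q + 1)) <= e).
  { apply Rle_trans with (e / (2 * D * (Q + 1)) * (2 * D * (Q + 1))).
    apply Rmult_le_compat_r; [|lra]. repeat apply Rmult_le_pos; lra. right; field; lra. }
  apply Rle_trans with ((e / (2 * D) * k) * D + Q * (k * k) * D).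
  { rewrite <- Rmult_plus_distr_r. apply Rmult_le_compat_r; lra. }
  replace (e / (2 * D) * k * D) with (e / 2 * k) by (field; lra).
  assert (k * (D * Q) <= e / 2). { assert (0 <= k * D) by (apply Rmult_le_pos; lra). nra. }
  assert (k * (D * Q) * k <= e / 2 * k) by (apply Rmult_le_compat_r; auto). lra.
Qed.

Lemma transport F F' phi r : (forall z, hol F z (F' z)) ->
  (forall t, cder phi t (F (phi t)) /\ Cmod (phi t) <= r) -> F (phi 0) <> 0 ->
  exists eta K, 0 < eta /\ 0 < K /\ forall y, Cmod (y - phi 0) < eta ->
    exists psi, psi 0 = y /\ forall t, cder psi t (F (psi t)) /\
      forall a, F a = RtoC 0 -> Cmod a <= r ->
        Cmod (psi t - a) <= Cmod (phi t - a) * K /\ Cmod (phi t - a) <= Cmod (psi t - a) * K.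
Proof.
  intros HF Hphi Hx. set (x := phi 0) in *.
  assert (Hr : 0 <= r) by (eapply Rle_trans; [apply Cmod_ge_0|apply (Hphi 0)]).
  destruct (hcont_lower F x) as [d [Hd Hlow]]; auto; [eapply hol_hcont; eauto|].
  set (p := Cmod (F x) / 2) in *.
  assert (Hp : 0 < p) by (unfold p; assert (0 < Cmod (F x)) by (apply Cmod_gt_0; auto); lra).
  destruct (flow_exists F F' r HF Hr) as [delta [Hdelta Hflow]].
  destruct (lip_on_disc F F' (r + 1) HF) as [L HL].
  (* The auxiliary flow runs for |u| < 2, so that u = 1 is interior; strength [delta / 2] is then
     admissible. *)
  set (c0 := delta / 2). assert (Hc0 : 0 < c0) by (unfold c0; lra).
  (* [d / 2] keeps the segment in the region where |F| is at least [p], even prolonged to |u| = 2;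
     [c0 * p] makes the coefficient at most [c0]. *)
  exists (Rmin (d / 2) (c0 * p)), (exp ((2 * (c0 * L) + 1) * 1)). split.
  { apply Rmin_pos; [lra|apply Rmult_lt_0_compat; lra]. }
  split; [apply exp_pos|].
  intros y Hy.
  assert (Hy1 : Cmod (y - x) < d / 2) by (eapply Rlt_le_trans; [exact Hy|apply Rmin_l]).
  assert (Hy2 : Cmod (y - x) < c0 * p) by (eapply Rlt_le_trans; [exact Hy|apply Rmin_r]).
  set (seg := fun u => (x + RtoC u * (y - x))%C).
  assert (Hseg : forall u, p <= Cmod (F (seg (clamp 2 u)))).
  { intros u. apply Hlow. unfold seg.
    match goal with |- Cmod ?z < _ => replace z with (RtoC (clamp 2 u) * (y - x))%C by ring end.
    rewrite Cmod_mult, Cmod_R. pose proof (clamp_bound 2 u ltac:(lra)).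
    assert (Rabs (clamp 2 u) <= 2) by (apply Rabs_le; lra).
    pose proof (Cmod_ge_0 (y - x)). nra. }
  assert (Hseg0 : forall u, F (seg (clamp 2 u)) <> 0) by (intros u; apply Cmod_gt_0; specialize (Hseg u); lra).
  (* This coefficient makes the straight segment [seg] an integral curve of [c u * F], so the
     auxiliary flow carries x to exactly y at u = 1. *)
  set (c := fun u => ((y - x) * / F (seg (clamp 2 u)))%C).
  assert (Cseg : forall u, cder seg u (y - x)).
  { intros u. eapply cder_eq; [apply cder_plus; [apply cder_const|apply (cder_mult (fun u => RtoC u) (fun _ => (y - x)%C) u 1 0)]|].
    - eapply cder_ext; [|apply (RtoC_linear_cder 0 1)]. intros; simpl; f_equal; ring.
    - apply cder_const.
    - simpl. ring. }
  assert (Cc : forall u, ccont c u).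
  { intros u. apply ccont_mult; [apply ccont_const|].
    apply (hcont_comp (fun z => / F z)%C (fun u => seg (clamp 2 u))).
    - apply (ccont_clamp seg). intros s. eapply cder_ccont; apply Cseg.
    - eapply hol_hcont. apply (hol_inv F); auto. }
  assert (Hc : forall u, Cmod (c u) <= c0).
  { intros u. unfold c. rewrite Cmod_mult, Cmod_inv by auto. specialize (Hseg u).
    apply Rmult_le_reg_r with (Cmod (F (seg (clamp 2 u)))); [lra|].
    rewrite Rmult_assoc, Rinv_l, Rmult_1_r by lra. nra. }
  assert (Ex : forall t, exists h, h 0 = phi t /\ forall u, Rabs u < 2 -> cder h u (c u * F (h u)) /\ Cmod (h u) <= r + 1).
  { intros t. apply (Hflow c c0 2 (phi t)); auto; try lra. unfold c0; lra. apply Hphi. }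
  set (h := fun t => proj1_sig (constructive_indefinite_description _ (Ex t))).
  assert (Hh : forall t, h t 0 = phi t /\ forall u, Rabs u < 2 -> cder (h t) u (c u * F (h t u)) /\ Cmod (h t u) <= r + 1).
  { intros t. apply (proj2_sig (constructive_indefinite_description _ (Ex t))). }
  assert (Hh1 : forall t u, 0 <= u <= 1 -> cder (h t) u (c u * F (h t u)) /\ Cmod (h t u) <= r + 1).
  { intros t u Hu. apply Hh. rewrite Rabs_pos_eq; lra. }
  exists (fun t => h t 1). split.
  - transitivity (seg 1); [|unfold seg; ring].
    apply (flow_unique F F' c c0 (h 0) seg 1 HF); auto; try lra.
    + intros u Hu. apply Hh1; auto.
    + intros u Hu. eapply cder_eq; [apply Cseg|]. unfold c. specialize (Hseg0 u).
      rewrite clamp_id in * by lra. field; auto.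
    + rewrite (proj1 (Hh 0)). fold x. unfold seg. ring.
  - intros t. split.
    + apply (flows_commute F F' c c0 (r + 1) phi h t HF Hc); auto. apply Hh. apply Hphi.
    + intros a Ha Har.
      (* An equilibrium is a constant solution of every field [c u * F]; comparing it with [h t]
         gives a factor independent of t. *)
      assert (Ka : forall u, 0 <= u <= 1 -> cder (fun _ => a) u (c u * F a) /\ Cmod a <= r + 1).
      { intros u Hu. split; [|lra]. rewrite Ha, Cmult_0_r. apply cder_const. }
      rewrite <- (proj1 (Hh t)). split.
      * apply (flow_dist F (r + 1) L c c0 (h t) (fun _ => a) 1); auto; lra.
      * apply (flow_dist_back F (r + 1) L c c0 (h t) (fun _ => a) 1); auto; lra.
Qed.

(** * Local dynamics at a zero *)

Lemma linear_cder (p q : C) t : cder (fun t => p + RtoC t * q)%C t q.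
Proof.
  eapply cder_eq; [apply cder_plus; [apply cder_const|apply (cder_mult (fun u => RtoC u) (fun _ => q) t 1 0)]|].
  - eapply cder_ext; [|apply (RtoC_linear_cder 0 1)]. intros; simpl; f_equal; ring.
  - apply cder_const.
  - simpl. ring.
Qed.

Lemma segment_in_disc b z w rho l : 0 <= l <= 1 -> Cmod (z - b) < rho -> Cmod (w - b) < rho ->
  Cmod (z + RtoC l * (w - z) - b) < rho.
Proof.
  intros Hl Hz Hw.
  replace (z + RtoC l * (w - z) - b)%C with (RtoC (1 - l) * (z - b) + RtoC l * (w - b))%C by (rewrite RtoC_minus; ring).
  eapply Rle_lt_trans; [apply Cmod_triangle|]. rewrite !Cmod_mult, !Cmod_R, !Rabs_pos_eq by lra.
  destruct (Req_dec l 0); [subst; lra|]. nra.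
Qed.

(** The primitive integrates [f] along the radius from [b]. Goursat on the cone from [b] over the
    segment from z to w, one of whose four edges collapses to [b], turns the difference of two
    values into an integral along that segment. *)
Lemma primitive_on_disc (f : C -> C) b rho : 0 < rho ->
  (forall z, Cmod (z - b) < rho -> exists l, hol f z l) ->
  exists k, forall z, Cmod (z - b) < rho -> hol k z (f z).
Proof.
  intros Hrho Hf.
  set (k := fun z => CI (fun t => f (b + RtoC t * (z - b)) * (z - b))%C 0 1). exists k.
  assert (Bb : Cmod (b - b) < rho) by (replace (b - b)%C with (RtoC 0) by ring; rewrite Cmod_0; auto).
  assert (Cf : forall z w t, 0 <= t <= 1 -> Cmod (z - b) < rho -> Cmod (w - b) < rho ->
    ccont (fun t => f (z + RtoC t * (w - z)))%C t).
  { intros z w t Ht Hz Hw. apply (hcont_comp f).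
    - eapply cder_ccont, linear_cder.
    - destruct (Hf (z + RtoC t * (w - z))%C) as [v Hv]; [apply segment_in_disc; auto|]. eapply hol_hcont; eauto. }
  assert (Diff : forall z w, Cmod (z - b) < rho -> Cmod (w - b) < rho ->
    (k w - k z)%C = CI (fun l => f (z + RtoC l * (w - z)) * (w - z))%C 0 1).
  { intros z w Hz Hw.
    set (s := fun l t => (b + RtoC t * (z + RtoC l * (w - z) - b))%C).
    set (sl := fun (l t : R) => (RtoC t * (w - z))%C).
    set (st := fun (l t : R) => (z + RtoC l * (w - z) - b)%C).
    assert (G : rectint f s sl st (Rect 0 1 0 1) = RtoC 0).
    { apply (goursat f s sl st (Rect 0 1 0 1) (Cmod (w - z) + rho)); simpl; try lra.
      - split; [|split; [|split]]; intros l t.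
        + eapply cder_ext; [|apply (linear_cder (b + RtoC t * (z - b)) (RtoC t * (w - z)))].
          intros u. unfold s. ring.
        + apply linear_cder.
        + apply (ccont_const (RtoC t * (w - z))%C).
        + apply (ccont_const (z + RtoC l * (w - z) - b)%C).
      - intros l t Hl Ht. simpl in *. apply Hf. unfold s. apply segment_in_disc; auto. apply segment_in_disc; auto.
      - intros l t Hl Ht. split.
        + unfold sl. rewrite Cmod_mult, Cmod_R, Rabs_pos_eq by lra. pose proof (Cmod_ge_0 (w - z)). nra.
        + unfold st. pose proof (segment_in_disc b z w rho l Hl Hz Hw). pose proof (Cmod_ge_0 (w - z)). lra. }
    simpl in G. unfold edge in G.
    assert (E1 : CI (fun l => f (s l 0) * sl l 0)%C 0 1 = RtoC 0).
    { rewrite (CI_ext _ (fun _ => RtoC 0)); [rewrite CI_const; ring|]. intros t _. unfold sl. ring. }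
    assert (E2 : CI (fun t => f (s 1 t) * st 1 t)%C 0 1 = k w).
    { apply CI_ext. intros t _. unfold s, st. replace (z + 1 * (w - z) - b)%C with (w - b)%C by ring. auto. }
    assert (E3 : CI (fun l => f (s l 1) * sl l 1)%C 0 1 = CI (fun l => f (z + RtoC l * (w - z)) * (w - z))%C 0 1).
    { apply CI_ext. intros l _. unfold s, sl.
      replace (b + 1 * (z + RtoC l * (w - z) - b))%C with (z + RtoC l * (w - z))%C by ring. ring. }
    assert (E4 : CI (fun t => f (s 0 t) * st 0 t)%C 0 1 = k z).
    { apply CI_ext. intros t _. unfold s, st. replace (z + 0 * (w - z) - b)%C with (z - b)%C by ring. auto. }
    rewrite E1, E2, E3, E4 in G. apply Ceq_minus. rewrite <- G. ring. }
  intros z Hz e He. destruct (Hf z Hz) as [v Hv]. apply hol_hcont in Hv.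
  destruct (Hv e He) as [d [Hd A]]. exists (Rmin d (rho - Cmod (z - b))). split; [apply Rmin_pos; lra|].
  intros w Hw. pose proof (Rmin_l d (rho - Cmod (z - b))). pose proof (Rmin_r d (rho - Cmod (z - b))).
  assert (Hwb : Cmod (w - b) < rho) by (pose proof (Cmod_tri w z b); lra).
  rewrite Diff by auto.
  replace (f z * (w - z))%C with (CI (fun _ => f z * (w - z))%C 0 1) by (rewrite CI_const; rewrite Rminus_0_r; ring).
  assert (Cc : forall t, 0 <= t <= 1 -> ccont (fun l => f (z + RtoC l * (w - z)) * (w - z))%C t).
  { intros t Ht. apply ccont_mult; [apply Cf; auto|apply ccont_const]. }
  rewrite <- CI_minus.
  - eapply Rle_trans; [apply CI_bound with (M := e * Cmod (w - z))|].
    + apply ccont_on_le; [lra|]. intros t Ht.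
      apply (ccont_plus (fun l => f (z + RtoC l * (w - z)) * (w - z))%C (fun _ => - (f z * (w - z)))%C); auto. apply ccont_const.
    + rewrite Rmin_left, Rmax_right by lra. intros t Ht.
      match goal with |- Cmod ?u <= _ => replace u with ((f (z + RtoC t * (w - z)) - f z) * (w - z))%C by ring end.
      rewrite Cmod_mult. apply Rmult_le_compat_r; [apply Cmod_ge_0|]. left. apply A.
      replace (z + RtoC t * (w - z) - z)%C with (RtoC t * (w - z))%C by ring.
      rewrite Cmod_mult, Cmod_R, Rabs_pos_eq by lra. pose proof (Cmod_ge_0 (w - z)). nra.
    + rewrite Rminus_0_r, Rabs_R1. lra.
  - apply ccont_on_le; [lra|]. auto.
  - intros t _. apply ccont_const.
Qed.

(** Continuous induction: since the bound [r] improves itself to a strict one, the times up to which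
    it holds cannot have a supremum before [t1]. *)
Lemma never_exits (f : R -> R) r :
  (forall t, 0 <= t -> continuity_pt f t) -> f 0 < r ->
  (forall T, 0 <= T -> (forall t, 0 <= t <= T -> f t <= r) -> f T < r) ->
  forall t, 0 <= t -> f t < r.
Proof.
  intros Hc H0 Hstep t1 Ht1. apply Rnot_le_lt. intros N.
  assert (Loc : forall t, 0 <= t -> f t < r -> exists d, 0 < d /\ forall s, Rabs (s - t) < d -> f s < r).
  { intros t Ht Hf. destruct (Hc t Ht (r - f t) ltac:(lra)) as [d [Hd A]]. exists d. split; auto.
    intros s Hs. destruct (Req_dec s t) as [->|Hn]; auto.
    specialize (A s). simpl in A. unfold Rdist, D_x, no_cond in A.
    assert (Q : Rabs (f s - f t) < r - f t) by (apply A; auto). apply Rabs_lt_between in Q. lra. }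
  assert (Loc' : forall t, 0 <= t -> r < f t -> exists d, 0 < d /\ forall s, Rabs (s - t) < d -> r < f s).
  { intros t Ht Hf. destruct (Hc t Ht (f t - r) ltac:(lra)) as [d [Hd A]]. exists d. split; auto.
    intros s Hs. destruct (Req_dec s t) as [->|Hn]; auto.
    specialize (A s). simpl in A. unfold Rdist, D_x, no_cond in A.
    assert (Q : Rabs (f s - f t) < f t - r) by (apply A; auto). apply Rabs_lt_between in Q. lra. }
  destruct (completeness (fun T => 0 <= T <= t1 /\ forall t, 0 <= t <= T -> f t <= r)) as [s [Hu Hl]].
  { exists t1. intros T [HT _]. lra. }
  { exists 0. split; [lra|]. intros t Ht. replace t with 0 by lra. lra. }
  assert (Hs0 : 0 <= s). { apply Hu. split; [lra|]. intros t Ht. replace t with 0 by lra. lra. }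
  assert (Hs1 : s <= t1). { apply Hl. intros T [HT _]. lra. }
  assert (Hlt : forall t, 0 <= t < s -> f t <= r).
  { intros t Ht. apply Rnot_lt_le. intros Q. assert (s <= t); [|lra]. apply Hl. intros T [HT1 HT2].
    apply Rnot_lt_le. intros Q'. specialize (HT2 t ltac:(lra)). lra. }
  assert (Hs : f s <= r).
  { apply Rnot_lt_le. intros Q. destruct (Loc' s Hs0 Q) as [d [Hd A]].
    destruct (Req_dec s 0) as [->|Hn]; [lra|].
    set (t := Rmax 0 (s - d / 2)). assert (0 <= t < s /\ s - d / 2 <= t) by (unfold t, Rmax; destruct Rle_dec; lra).
    specialize (Hlt t ltac:(lra)). specialize (A t). rewrite Rabs_left in A by lra. specialize (A ltac:(lra)). lra. }
  assert (Hs' : f s < r).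
  { apply Hstep; auto. intros t Ht. destruct (Req_dec t s) as [->|]; auto. apply Hlt; lra. }
  assert (s < t1). { destruct (Req_dec s t1) as [E|]; [rewrite E in Hs'; lra|lra]. }
  destruct (Loc s Hs0 Hs') as [d [Hd A]].
  set (T := Rmin t1 (s + d / 2)). assert (HT : s < T <= t1 /\ T <= s + d / 2) by (unfold T, Rmin; destruct Rle_dec; lra).
  assert (T <= s); [|lra]. apply Hu. split; [lra|]. intros t Ht.
  destruct (Rlt_le_dec t s); [apply Hlt; lra|]. left. apply A. rewrite Rabs_pos_eq; lra.
Qed.

(** The condition concerns solutions that exist for all forward time, as heteroclinic ones do in
    both directions. *)
Definition stays_near (F : C -> C) (b : C) (r : R) (y : C) : Prop :=
  forall phi e, 0 < e -> phi 0 = y -> sol_on F (- e) p_infty phi ->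
    forall t, 0 <= t -> Cmod (phi t - b) < r.

Lemma stays_near_mono F b r r' y : r' <= r -> stays_near F b r' y -> stays_near F b r y.
Proof. intros Hr H phi e He H0 Hs t Ht. eapply Rlt_le_trans; [eapply H; eauto|auto]. Qed.

Lemma stays_near_intro F b r y : 0 < r -> Cmod (y - b) < r ->
  (forall phi e T, 0 < e -> phi 0 = y -> sol_on F (- e) p_infty phi -> 0 <= T ->
    (forall t, 0 <= t <= T -> Cmod (phi t - b) <= r) -> Cmod (phi T - b) < r) ->
  stays_near F b r y.
Proof.
  intros Hr Hy H phi e He H0 Hs.
  apply (never_exits (fun t => Cmod (phi t - b)) r).
  - intros t Ht. apply ccont_dist. eapply cder_ccont, Hs. split; simpl; auto; lra.
  - rewrite H0; auto.
  - intros T HT HB. apply (H phi e T); auto.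
Qed.

(* [V z = |z - b|^2 exp (2 Re k)], where [k' = - h1 / h] and [h = h b + (z - b) h1], satisfies
   [V' = 2 Re (h b) V] along solutions. *)
Lemma simple_zero_traps F F' h h' b : (forall z, hol F z (F' z)) -> (forall z, hol h z (h' z)) ->
  (forall z, F z = ((z - b) * h z)%C) -> h b <> 0 -> fst (h b) <= 0 ->
  forall r, 0 < r -> exists r', 0 < r' /\ forall y, Cmod (y - b) < r' -> stays_near F b r y.
Proof.
  intros HF Hh E Hb Hre r0 Hr0.
  destruct (divide_zero (fun z => h z + - h b)%C (fun z => h' z + 0)%C b) as (h1 & h1' & Hh1 & E1).
  { intros z. apply hol_plus; auto. apply hol_const. }
  { ring. }
  destruct (hcont_lower h b) as [rho [Hrho Hlow]]; auto; [eapply hol_hcont; eauto|].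
  assert (Hnz : forall z, Cmod (z - b) < rho -> h z <> 0).
  { intros z Hz. apply Cmod_gt_0. specialize (Hlow z Hz). apply Cmod_gt_0 in Hb. lra. }
  destruct (primitive_on_disc (fun z => - (1) * h1 z / h z)%C b rho Hrho) as [k Hk].
  { intros z Hz. eexists. apply (hol_div (fun z => - (1) * h1 z)%C h); [apply hol_scal, Hh1|apply Hh|apply Hnz; auto]. }
  assert (Bb : Cmod (b - b) < rho) by (replace (b - b)%C with (RtoC 0) by ring; rewrite Cmod_0; auto).
  destruct (hol_hcont _ _ _ (Hk b Bb) 1 Rlt_0_1) as [d [Hd Ak]].
  set (r := Rmin r0 (Rmin (rho / 2) (d / 2))).
  assert (Hr : 0 < r <= r0 /\ r < rho /\ r < d).
  { unfold r. pose proof (Rmin_l r0 (Rmin (rho / 2) (d / 2))). pose proof (Rmin_r r0 (Rmin (rho / 2) (d / 2))).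
    pose proof (Rmin_l (rho / 2) (d / 2)). pose proof (Rmin_r (rho / 2) (d / 2)).
    assert (0 < Rmin r0 (Rmin (rho / 2) (d / 2))) by (repeat apply Rmin_pos; lra). lra. }
  assert (e2 : exp (-2) < 1) by (rewrite <- exp_0; apply exp_increasing; lra).
  pose proof (exp_pos (-2)) as e2p.
  (* On the disc of radius [r], Re k differs from its value at [b] by at most 1, so exp (2 Re k)
     varies by at most the factor exp 4, and distances by its square root exp 2. *)
  exists (r * exp (-2)). split; [apply Rmult_lt_0_compat; lra|].
  intros y Hy. apply (stays_near_mono F b r0 r); [lra|].
  assert (Hyr : Cmod (y - b) < r) by nra.
  apply stays_near_intro; auto; [lra|]. intros phi e T He H0 Hs HT HB.
  set (V := fun t => (Cmod (phi t - b) * Cmod (phi t - b)) * exp (2 * fst (k (phi t)))).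
  assert (HV : V T <= V 0).
  { apply (decr_of_derive V (fun t => 2 * fst (h b) * V t)); auto.
    - intros t Ht.
      assert (Dphi : cder phi t (F (phi t))) by (apply Hs; split; simpl; auto; lra).
      assert (Hin : Cmod (phi t - b) < rho) by (specialize (HB t Ht); lra).
      pose proof (cder_sq _ _ _ (cder_plus _ _ _ _ _ Dphi (cder_const (- b)%C t))) as D1. simpl in D1.
      pose proof (cder_fst _ _ _ (cder_comp k phi t _ _ Dphi (Hk _ Hin))) as D2. simpl in D2.
      set (q := fst (- (1) * h1 (phi t) / h (phi t) * F (phi t))%C) in D2.
      (* The derivative k' F is - (z - b) h1 = h b - h z, so the growth rate 2 Re (h z) of |z - b|^2
         is corrected to the constant 2 Re (h b). *)
      assert (Q : q = fst (h b) - fst (h (phi t))).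
      { unfold q. rewrite E.
        replace (- (1) * h1 (phi t) / h (phi t) * ((phi t - b) * h (phi t)))%C with (- ((phi t - b) * h1 (phi t)))%C
          by (field; apply Hnz; auto).
        rewrite <- E1. simpl. ring. }
      assert (D3 : is_derive (fun s => exp (2 * fst (k (phi s)))) t (2 * q * exp (2 * fst (k (phi t))))).
      { apply (is_derive_comp (V := R_NormedModule) exp (fun s => 2 * fst (k (phi s)))).
        - apply is_derive_exp.
        - apply (is_derive_scal (fun s => fst (k (phi s)))). exact D2. }
      pose proof (is_derive_mult (K := R_AbsRing) _ _ _ _ _ D1 D3 Rmult_comm) as D4.
      eapply is_derive_ext; [|eapply (eq_ind _ (fun l => is_derive _ t l)); [exact D4|]].
      + intros s. reflexivity.
      + unfold plus, mult; simpl. unfold V. rewrite Q.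
        replace (fst (F (phi t)) + 0) with (fst (F (phi t))) by ring.
        replace (snd (F (phi t)) + 0) with (snd (F (phi t))) by ring.
        pose proof (Cmod_sq (phi t - b)) as W. simpl in W.
        replace (phi t + - b)%C with (phi t - b)%C by reflexivity. rewrite W.
        rewrite E. simpl. ring.
    - intros t Ht. assert (0 <= V t).
      { unfold V. apply Rmult_le_pos; [apply Rle_0_sqr|left; apply exp_pos]. } nra. }
  assert (Kb : forall z, Cmod (z - b) <= r -> fst (k b) - 1 <= fst (k z) <= fst (k b) + 1).
  { intros z Hz. specialize (Ak z ltac:(lra)). pose proof (Cmod_abs_fst (k z - k b)) as W.
    assert (W' : Rabs (fst (k z - k b)%C) <= 1) by lra. apply Rabs_le_between in W'. simpl in W'. lra. }
  destruct (Kb (phi T) (HB T ltac:(lra))) as [K1 _].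
  destruct (Kb y ltac:(lra)) as [_ K2].
  unfold V in HV. rewrite H0 in HV.
  assert (X1 : exp (2 * fst (k b) - 2) <= exp (2 * fst (k (phi T)))).
  { destruct (Req_dec (2 * fst (k b) - 2) (2 * fst (k (phi T)))) as [->|]; [lra|]. left; apply exp_increasing; lra. }
  assert (X2 : exp (2 * fst (k y)) <= exp (2 * fst (k b) + 2)).
  { destruct (Req_dec (2 * fst (k y)) (2 * fst (k b) + 2)) as [->|]; [lra|]. left; apply exp_increasing; lra. }
  apply Rnot_le_lt. intros N.
  assert (Y1 : r * r * exp (2 * fst (k b) - 2) <= Cmod (phi T - b) * Cmod (phi T - b) * exp (2 * fst (k (phi T)))).
  { apply Rmult_le_compat; auto; [nra|left; apply exp_pos|nra]. }
  assert (Y2 : Cmod (y - b) * Cmod (y - b) * exp (2 * fst (k y)) < r * exp (-2) * (r * exp (-2)) * exp (2 * fst (k b) + 2)).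
  { pose proof (Cmod_ge_0 (y - b)). eapply Rle_lt_trans; [apply Rmult_le_compat_l; [nra|exact X2]|].
    apply Rmult_lt_compat_r; [apply exp_pos|]. nra. }
  replace (r * exp (-2) * (r * exp (-2)) * exp (2 * fst (k b) + 2)) with (r * r * exp (2 * fst (k b) - 2)) in Y2; [lra|].
  transitivity (r * r * (exp (-2) * exp (-2) * exp (2 * fst (k b) + 2))); [|ring].
  rewrite <- !exp_plus. f_equal. f_equal. ring.
Qed.

Lemma hol_shift_pow b n z : z <> b ->
  hol (fun w => (w - b) ^ n)%C z (RtoC (INR n) * (z - b) ^ n / (z - b))%C.
Proof.
  intros Hz. assert (Hzb : (z - b)%C <> 0) by (apply Cminus_eq_contra; auto). induction n.
  - eapply hol_eq; [apply (hol_const (RtoC 1))|]. simpl. field; auto.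
  - eapply hol_eq; [apply (hol_mult (fun w => w - b)%C (fun w => (w - b) ^ n)%C); [|exact IHn]|].
    + apply (hol_plus (fun w => w)); [apply hol_id|apply hol_const].
    + rewrite S_INR, RtoC_plus. simpl. field; auto.
Qed.

(** A primitive of 1 / (h0 (z - b)^(n + 1)), that is, the complex time of the model equation z' = h0
    (z - b)^(n + 1). *)
Definition petal_coord (h0 b : C) (n : nat) (z : C) : C := (- (1) / (RtoC (INR n) * h0 * (z - b) ^ n))%C.

Lemma petal_coord_hol (h0 b : C) n z : h0 <> 0 -> z <> b -> (0 < n)%nat ->
  hol (petal_coord h0 b n) z (1 / (h0 * (z - b) ^ S n))%C.
Proof.
  intros Hh0 Hz Hn. assert (Hzb : (z - b)%C <> 0) by (apply Cminus_eq_contra; auto).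
  assert (HnC : RtoC (INR n) <> 0) by (apply RtoC_neq0, not_0_INR; lia).
  pose proof (Cpow_nz (z - b) n Hzb) as Hp.
  eapply hol_eq; [apply (hol_div (fun _ => - (1))%C (fun z => RtoC (INR n) * h0 * (z - b) ^ n)%C)|].
  - apply hol_const.
  - apply hol_scal, hol_shift_pow; auto.
  - repeat apply Cmult_neq_0; auto.
  - simpl. field. repeat split; auto.
Qed.

Lemma petal_coord_Cmod (h0 b : C) n z : h0 <> 0 -> z <> b -> (0 < n)%nat ->
  Cmod (petal_coord h0 b n z) = / (INR n * Cmod h0 * Cmod (z - b) ^ n).
Proof.
  intros Hh0 Hz Hn. assert (Hzb : (z - b)%C <> 0) by (apply Cminus_eq_contra; auto).
  assert (HnC : RtoC (INR n) <> 0) by (apply RtoC_neq0, not_0_INR; lia).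
  pose proof (Cpow_nz (z - b) n Hzb) as Hp.
  unfold petal_coord. rewrite Cmod_div by (repeat apply Cmult_neq_0; auto).
  rewrite !Cmod_mult, Cmod_pow, Cmod_R, Rabs_pos_eq by apply pos_INR.
  rewrite Cmod_opp, Cmod_1. unfold Rdiv. ring.
Qed.

(* In the coordinate [w = petal_coord], the equation reads [w' = h z / h b], hence [w' ~ 1] near [b]
   (that is, near [w = oo]): solutions starting in the right half plane escape to [oo]. *)
Lemma multiple_zero_traps F F' h h' b n : (forall z, hol F z (F' z)) -> (forall z, hol h z (h' z)) ->
  (0 < n)%nat -> (forall z, F z = ((z - b) ^ S n * h z)%C) -> h b <> 0 ->
  forall r, 0 < r -> exists r', 0 < r' /\ forall y, Cmod (y - b) < r' -> y <> b ->
    0 <= fst (petal_coord (h b) b n y) -> stays_near F b r y.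
Proof.
  intros HF Hh Hn E Hb r0 Hr0.
  assert (Hb' : 0 < Cmod (h b)) by (apply Cmod_gt_0; auto).
  (* A relative error below 1/4 in [h] keeps the velocity in the new coordinate within 1/4 of 1. *)
  destruct (hol_hcont _ _ _ (Hh b) (Cmod (h b) / 4) ltac:(lra)) as [d [Hd Ah]].
  set (r := Rmin r0 (d / 2)).
  assert (Hr : 0 < r <= r0 /\ r < d).
  { unfold r. pose proof (Rmin_l r0 (d / 2)). pose proof (Rmin_r r0 (d / 2)).
    assert (0 < Rmin r0 (d / 2)) by (repeat apply Rmin_pos; lra). lra. }
  assert (Hn0 : 0 < INR n) by (apply lt_0_INR; auto).
  (* Halving the distance at least doubles the coordinate, so it starts with modulus at least 2 rad,
     where rad is the modulus on the circle of radius [r]. *)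
  exists (r / 2). split; [lra|]. intros y Hy Hyb Hre. apply (stays_near_mono F b r0 r); [lra|].
  apply stays_near_intro; [lra|lra|]. intros phi e T He H0 Hs HT HB.
  (* The coordinate is finite along the solution: by uniqueness [b] is not reached in finite
     time. *)
  assert (Hphib : forall t, 0 <= t <= T -> phi t <> b).
  { intros t Ht Eb. apply Hyb. rewrite <- H0.
    apply (sol_unique F F' (- e) p_infty phi (- e) p_infty (fun _ => b) t 0 HF Hs); auto;
      try (split; simpl; auto; lra).
    intros u _. rewrite E. replace (b - b)%C with (RtoC 0) by ring. simpl.
    eapply cder_eq; [apply cder_const|ring]. }
  set (w := fun t => petal_coord (h b) b n (phi t)).
  assert (Dw : forall t, 0 <= t <= T -> cder (fun s => w s - RtoC s)%C t (h (phi t) / h b - 1)).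
  { intros t Ht. specialize (Hphib t Ht).
    assert (Hzb : (phi t - b)%C <> 0) by (apply Cminus_eq_contra; auto).
    pose proof (Cpow_nz (phi t - b) n Hzb) as Hp.
    assert (Dphi : cder phi t (F (phi t))) by (apply Hs; split; simpl; auto; lra).
    apply cder_minus.
    - eapply cder_eq; [apply (cder_comp (petal_coord (h b) b n) phi t); [exact Dphi|apply petal_coord_hol; auto]|].
      rewrite E. simpl. field. repeat split; auto.
    - eapply cder_ext; [|apply (RtoC_linear_cder 0 1)]. intros; simpl; f_equal; ring. }
  assert (Bw : Cmod (w T - w 0 - RtoC T) <= T / 4).
  { replace (w T - w 0 - RtoC T)%C with ((w T - RtoC T) - (w 0 - RtoC 0))%C by ring.
    rewrite <- (CI_ftc (fun s => w s - RtoC s)%C (fun t => h (phi t) / h b - 1)%C 0 T).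
    - eapply Rle_trans; [apply CI_bound with (M := / 4)|].
      + apply ccont_on_le; auto. intros t Ht.
        apply (ccont_plus (fun t => h (phi t) / h b)%C (fun _ => - (1))%C); [|apply ccont_const].
        apply ccont_mult; [|apply ccont_const]. apply (hcont_comp h phi).
        * eapply cder_ccont, Hs. split; simpl; auto; lra.
        * eapply hol_hcont, Hh.
      + rewrite Rmin_left, Rmax_right by lra. intros t Ht.
        replace (h (phi t) / h b - 1)%C with ((h (phi t) - h b) / h b)%C by (field; auto).
        rewrite Cmod_div by auto. specialize (HB t Ht). specialize (Ah (phi t) ltac:(lra)).
        apply Rmult_le_reg_r with (Cmod (h b)); auto. unfold Rdiv. rewrite Rmult_assoc, Rinv_l by lra. lra.
      + rewrite Rminus_0_r, Rabs_pos_eq by lra. lra.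
    - rewrite Rmin_left, Rmax_right by lra. exact Dw.
    - apply ccont_on_le; auto. intros t Ht.
      apply (ccont_plus (fun t => h (phi t) / h b)%C (fun _ => - (1))%C); [|apply ccont_const].
      apply ccont_mult; [|apply ccont_const]. apply (hcont_comp h phi).
      * eapply cder_ccont, Hs. split; simpl; auto; lra.
      * eapply hol_hcont, Hh. }
  set (rad := / (INR n * Cmod (h b) * r ^ n)).
  assert (Hrn : 0 < r ^ n) by (apply pow_lt; lra).
  assert (Hc : 0 < INR n * Cmod (h b)) by (apply Rmult_lt_0_compat; auto).
  assert (Hrad : 0 < rad) by (apply Rinv_0_lt_compat, Rmult_lt_0_compat; auto).
  assert (Hw0 : 2 * rad <= Cmod (w 0)).
  { unfold w. rewrite H0, petal_coord_Cmod by auto. unfold rad.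
    assert (Hyp : 0 < Cmod (y - b)) by (apply Cmod_gt_0, Cminus_eq_contra; auto).
    assert (P : 0 < Cmod (y - b) ^ n) by (apply pow_lt; auto).
    assert (Hpow : 2 * Cmod (y - b) ^ n <= r ^ n).
    { apply Rle_trans with (2 * (r / 2) ^ n).
      - apply Rmult_le_compat_l; [lra|]. apply pow_incr. lra.
      - unfold Rdiv. rewrite Rpow_mult_distr. destruct n as [|n']; [lia|].
        assert ((/ 2) ^ n' <= 1) by (rewrite <- (pow1 n'); apply pow_incr; lra).
        simpl pow at 2. simpl pow at 3. assert (0 < r ^ S n') by auto. simpl pow in *. nra. }
    replace (2 * / (INR n * Cmod (h b) * r ^ n)) with (/ (INR n * Cmod (h b) * (r ^ n / 2))) by (field; repeat split; lra).
    apply Rinv_le_contravar.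
    - apply Rmult_lt_0_compat; auto.
    - apply Rmult_le_compat_l; lra. }
  assert (Hre0 : 0 <= fst (w 0)) by (unfold w; rewrite H0; auto).
  (* As Re (w 0) >= 0, |w 0 + T| is at least both |w 0| and T. The deviation T / 4 therefore costs
     at most a quarter of it, leaving at least 3/2 rad. *)
  assert (HwT : rad < Cmod (w T)).
  { set (a := Cmod (w 0 + RtoC T)).
    assert (Ha : a * a = Cmod (w 0) * Cmod (w 0) + 2 * T * fst (w 0) + T * T).
    { unfold a. rewrite !Cmod_sq. simpl. ring. }
    assert (0 <= a) by apply Cmod_ge_0. pose proof (Cmod_ge_0 (w 0)).
    assert (0 <= T * fst (w 0)) by (apply Rmult_le_pos; auto).
    assert (T <= a) by (apply Rsqr_incr_0_var; auto; unfold Rsqr; nra).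
    assert (Cmod (w 0) <= a) by (apply Rsqr_incr_0_var; auto; unfold Rsqr; nra).
    pose proof (Cmod_rev (w 0 + RtoC T) (w T)) as Q. fold a in Q. rewrite Cmod_sym in Q.
    replace (w T - (w 0 + RtoC T))%C with (w T - w 0 - RtoC T)%C in Q by ring. lra. }
  unfold w in HwT. specialize (Hphib T ltac:(lra)). rewrite petal_coord_Cmod in HwT by auto.
  apply Rnot_le_lt. intros N. assert (r ^ n <= Cmod (phi T - b) ^ n) by (apply pow_incr; lra).
  apply Rlt_not_le in HwT. apply HwT. unfold rad. apply Rinv_le_contravar.
  - apply Rmult_lt_0_compat; auto.
  - apply Rmult_le_compat_l; lra.
Qed.

(** At a simple zero the sign of Re (h b) selects one time direction for all nearby points. At a
    multiple zero the direction depends on the point: time reversal changes the sign of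
    [petal_coord], so each point lies in the closed right half plane for one of the two fields. *)
Lemma zero_traps F F' b r : (forall z, hol F z (F' z)) -> F b = RtoC 0 -> ~ (forall z, F z = RtoC 0) -> 0 < r ->
  exists r', 0 < r' /\ forall y, Cmod (y - b) < r' -> stays_near F b r y \/ stays_near (neg_field F) b r y.
Proof.
  intros HF Hb Hnz Hr.
  destruct (zero_order F F' b HF Hb Hnz) as (m & h & h' & Hh & Hhb & E).
  assert (Hnb : neg_field h b <> 0).
  { unfold neg_field. intros Q. apply Hhb. replace (h b) with (- - h b)%C by ring. rewrite Q. ring. }
  destruct m as [|m].
  - destruct (Rle_dec (fst (h b)) 0) as [L|L].
    + destruct (simple_zero_traps F F' h h' b HF Hh) with (r := r) as [r' [Hr' H]]; auto.
      { intros z. rewrite E. simpl. ring. }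
      exists r'. split; auto.
    + destruct (simple_zero_traps (neg_field F) _ (neg_field h) _ b (hol_neg _ _ HF) (hol_neg _ _ Hh)) with (r := r) as [r' [Hr' H]]; auto.
      { intros z. unfold neg_field. rewrite E. simpl. ring. }
      { unfold neg_field. simpl. lra. }
      exists r'. split; auto.
  - destruct (multiple_zero_traps F F' h h' b (S m) HF Hh) with (r := r) as [r1 [Hr1 H1]]; auto; [lia|].
    destruct (multiple_zero_traps (neg_field F) _ (neg_field h) _ b (S m) (hol_neg _ _ HF) (hol_neg _ _ Hh)) with (r := r) as [r2 [Hr2 H2]]; auto; [lia| |].
    { intros z. unfold neg_field. rewrite E. ring. }
    exists (Rmin r1 r2). split; [apply Rmin_pos; auto|]. intros y Hy.
    pose proof (Rmin_l r1 r2). pose proof (Rmin_r r1 r2).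
    destruct (Ceq_dec y b) as [->|Hyb].
    + left. intros phi e He P0 Hs t Ht.
      replace (phi t) with b; [replace (b - b)%C with (RtoC 0) by ring; rewrite Cmod_0; auto|].
      symmetry. apply (sol_unique F F' (- e) p_infty phi (- e) p_infty (fun _ => b) 0 t HF Hs); auto;
        try (split; simpl; auto; lra).
      intros u _. rewrite Hb. apply cder_const.
    + destruct (Rle_dec 0 (fst (petal_coord (h b) b (S m) y))) as [L|L].
      * left. apply H1; auto. lra.
      * right. apply H2; auto; [lra|].
        assert (Hzb : (y - b)%C <> 0) by (apply Cminus_eq_contra; auto).
        replace (petal_coord (neg_field h b) b (S m) y) with (- petal_coord (h b) b (S m) y)%C; [simpl; simpl in L; lra|].
        unfold petal_coord, neg_field. field. repeat split; auto.
        -- apply Cpow_nz; auto.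
        -- apply RtoC_neq0, not_0_INR; lia.
Qed.

(** * The heteroclinic region *)

Definition global_sol (F : C -> C) (phi : R -> C) : Prop := forall t, cder phi t (F (phi t)).

Definition connecting (F : C -> C) (ap am : C) (phi : R -> C) : Prop :=
  global_sol F phi /\ tends phi ap /\ tends (fun t => phi (- t)) am.

Lemma global_sol_on F phi al be : global_sol F phi -> sol_on F al be phi.
Proof. intros H t _. apply H. Qed.

Lemma global_sol_neg F phi : global_sol F phi -> global_sol (neg_field F) (fun t => phi (- t)).
Proof. intros H t. apply cder_reverse, H. Qed.

Lemma between_infty t : between m_infty t p_infty.
Proof. split; simpl; auto. Qed.

Lemma global_sol_unique F F' phi psi : (forall z, hol F z (F' z)) -> global_sol F phi -> global_sol F psi ->
  phi 0 = psi 0 -> forall t, phi t = psi t.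
Proof.
  intros HF H1 H2 E t.
  apply (sol_unique F F' m_infty p_infty phi m_infty p_infty psi 0 t HF); auto using global_sol_on, between_infty.
Qed.

Lemma maximal_bounded_global F F' x al be phi r : (forall z, hol F z (F' z)) ->
  maximal_solution F x al be phi -> (forall t, between al t be -> Cmod (phi t) <= r) ->
  al = m_infty /\ be = p_infty.
Proof.
  intros HF Hm Hb. destruct (maximal_sol _ _ _ _ _ Hm) as (Z & _). split.
  - apply Rbar_eq_opp. apply (maximal_bounded_right _ _ x (Rbar_opp be) (Rbar_opp al) (fun t => phi (- t)) r 0 (hol_neg _ _ HF)).
    + apply maximal_opp; auto.
    + rewrite <- Ropp_0. apply between_opp; auto.
    + intros t Ht _. apply Hb. apply between_opp. rewrite Ropp_involutive. auto.
  - apply (maximal_bounded_right F F' x al be phi r 0 HF Hm Z). auto.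
Qed.

Lemma region_iff F F' ap am x : (forall z, hol F z (F' z)) ->
  (heteroclinic_region F ap am x <-> exists phi, phi 0 = x /\ connecting F ap am phi).
Proof.
  intros HF. unfold heteroclinic_region. rewrite (H_plus_conv F F' x ap HF), (H_minus_conv F F' x am HF). split.
  - intros [Hp Hm]. destruct (maximal_exists F F' x HF) as (al & be & phi & Hx).
    destruct (maximal_sol _ _ _ _ _ Hx) as (Z & P0 & S).
    destruct (conv_maximal F F' x ap al be phi HF Hp Hx) as [-> T1].
    destruct (conv_maximal _ _ x am _ _ _ (hol_neg _ _ HF) Hm (maximal_opp _ _ _ _ _ Hx)) as [E T2].
    assert (al = m_infty) by (apply Rbar_eq_opp; exact E). subst al.
    exists phi. split; auto. split; [|split; auto]. intros t. apply S, between_infty.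
  - intros (phi & P0 & G & T1 & T2). split.
    + exists phi, 1. split; [lra|]. split; auto. split; auto using global_sol_on.
    + exists (fun t => phi (- t)), 1. split; [lra|]. rewrite Ropp_0. split; auto. split; auto.
      apply global_sol_on, global_sol_neg; auto.
Qed.

Lemma connecting_shift F ap am phi s : connecting F ap am phi -> connecting F ap am (fun t => phi (t + s)).
Proof.
  intros (G & T1 & T2). split; [|split].
  - intros t. apply cder_shift, G.
  - apply tends_shift; auto.
  - intros e He. destruct (tends_shift _ _ (- s) T2 e He) as [T HT]. exists T. intros t Ht.
    replace (- t + s) with (- (t + - s)) by ring. apply HT; auto.
Qed.

Lemma connecting_bounded F ap am phi : connecting F ap am phi -> exists r, forall t, Cmod (phi t) <= r.
Proof.
  intros (G & T1 & T2).
  destruct (T1 1 Rlt_0_1) as [t1 H1]. destruct (T2 1 Rlt_0_1) as [t2 H2].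
  set (T := Rmax (Rabs t1) (Rabs t2)).
  assert (t1 <= T /\ t2 <= T /\ 0 <= T).
  { unfold T. pose proof (Rmax_l (Rabs t1) (Rabs t2)). pose proof (Rmax_r (Rabs t1) (Rabs t2)).
    pose proof (Rle_abs t1). pose proof (Rle_abs t2). pose proof (Rabs_pos t1). lra. }
  destruct (ccont_bounded phi (- T) T) as [M [HM HB]]; [lra|intros; eapply cder_ccont, G|].
  exists (M + Cmod ap + Cmod am + 1). intros t. pose proof (Cmod_ge_0 ap). pose proof (Cmod_ge_0 am).
  destruct (Rle_dec T t); [|destruct (Rle_dec t (- T))].
  - specialize (H1 t ltac:(lra)). pose proof (Cmod_rev (phi t) ap). lra.
  - specialize (H2 (- t) ltac:(lra)). rewrite Ropp_involutive in H2. pose proof (Cmod_rev (phi t) am). lra.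
  - specialize (HB t ltac:(lra)). lra.
Qed.

Lemma tends_const a b : tends (fun _ => a) b -> a = b.
Proof.
  intros H. apply Ceq_minus, Cmod_eq_0, Rle_antisym; [|apply Cmod_ge_0].
  apply le_epsilon. intros e He. destruct (H e He) as [T HT]. specialize (HT T ltac:(lra)). lra.
Qed.

Lemma connecting_nonequilibrium F F' ap am phi : (forall z, hol F z (F' z)) -> ap <> am ->
  connecting F ap am phi -> F (phi 0) <> 0.
Proof.
  intros HF Hne (G & T1 & T2) E. apply Hne.
  assert (Ec : forall t, phi t = phi 0).
  { apply (global_sol_unique F F' phi (fun _ => phi 0) HF G); auto. intros t. rewrite E. apply cder_const. }
  transitivity (phi 0).
  - symmetry. apply tends_const. intros e He. destruct (T1 e He) as [T HT]. exists T. intros t Ht. rewrite <- (Ec t). auto.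
  - apply tends_const. intros e He. destruct (T2 e He) as [T HT]. exists T. intros t Ht. rewrite <- (Ec (- t)). auto.
Qed.

Lemma tends_dominated phi psi a K : 0 < K -> (forall t, Cmod (psi t - a) <= Cmod (phi t - a) * K) ->
  tends phi a -> tends psi a.
Proof.
  intros HK H T e He. destruct (T (e / K)) as [t0 H0]; [apply Rdiv_lt_0_compat; auto|].
  exists t0. intros t Ht. eapply Rle_lt_trans; [apply H|].
  apply Rlt_le_trans with (e / K * K); [apply Rmult_lt_compat_r; auto|right; field; lra].
Qed.

(** Transport keeps the distances to [ap] and [am] comparable at all times, so convergence passes
    both ways between [phi] and its neighbour. The radius is enlarged so that the disc contains both
    ends. *)
Lemma bounded_sol_neighbours F F' ap am phi r : (forall z, hol F z (F' z)) ->
  F ap = RtoC 0 -> F am = RtoC 0 ->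
  global_sol F phi -> (forall t, Cmod (phi t) <= r) -> F (phi 0) <> 0 ->
  exists eta, 0 < eta /\ forall y, Cmod (y - phi 0) < eta ->
    (heteroclinic_region F ap am y <-> heteroclinic_region F ap am (phi 0)).
Proof.
  intros HF Hap Ham G Hb Hx.
  pose proof (Cmod_ge_0 ap) as Pp. pose proof (Cmod_ge_0 am) as Pm.
  assert (Hr : 0 <= r) by (eapply Rle_trans; [apply Cmod_ge_0|apply (Hb 0)]).
  destruct (transport F F' phi (r + Cmod ap + Cmod am) HF) as (eta & K & Heta & HK & H); auto.
  { intros t. split; [apply G|]. specialize (Hb t). lra. }
  exists eta. split; auto. intros y Hy. destruct (H y Hy) as (psi & Q0 & Hpsi).
  assert (Gp : global_sol F psi) by (intros t; apply Hpsi).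
  rewrite !(region_iff F F') by auto. split.
  - intros (chi & R0 & C0 & T1 & T2).
    assert (E : forall t, chi t = psi t) by (apply (global_sol_unique F F'); auto; congruence).
    exists phi. split; auto. split; [auto|split].
    + apply (tends_dominated chi phi ap K HK); auto. intros t. rewrite E. apply Hpsi; auto. lra.
    + apply (tends_dominated (fun t => chi (- t)) (fun t => phi (- t)) am K HK); auto. intros t. rewrite E. apply Hpsi; auto. lra.
  - intros (chi & R0 & C0 & T1 & T2).
    assert (E : forall t, chi t = phi t) by (apply (global_sol_unique F F'); auto; congruence).
    exists psi. split; auto. split; [auto|split].
    + apply (tends_dominated chi psi ap K HK); auto. intros t. rewrite E. apply Hpsi; auto. lra.
    + apply (tends_dominated (fun t => chi (- t)) (fun t => psi (- t)) am K HK); auto. intros t. rewrite E. apply Hpsi; auto. lra.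
Qed.

Lemma region_open F F' ap am x : (forall z, hol F z (F' z)) ->
  F ap = RtoC 0 -> F am = RtoC 0 -> ap <> am -> heteroclinic_region F ap am x ->
  exists eta, 0 < eta /\ forall y, Cmod (y - x) < eta -> heteroclinic_region F ap am y.
Proof.
  intros HF Hap Ham Hne Hx. assert (Hx' := Hx). apply (region_iff F F') in Hx'; auto.
  destruct Hx' as (phi & <- & Hc). destruct (connecting_bounded _ _ _ _ Hc) as [r Hr].
  destruct (bounded_sol_neighbours F F' ap am phi r HF Hap Ham) as (eta & Heta & H); auto.
  - apply Hc.
  - apply (connecting_nonequilibrium F F' ap am); auto.
  - exists eta. split; auto. intros y Hy. apply H; auto.
Qed.

Lemma closure_near D x eta : closure D x -> 0 < eta -> exists y, Cmod (y - x) < eta /\ D y.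
Proof.
  intros H He. destruct (H (fun y => Cmod (y - x) < eta)) as [y Hy]; [|exists y; auto].
  apply locally_Cmod. exists eta; auto.
Qed.

(** Points of the region near [b] would stay within [r] of [b] in one time direction, although their
    limits in both directions are at distance at least 2 r. *)
Lemma equilibrium_not_in_closure F F' ap am b : (forall z, hol F z (F' z)) ->
  ~ (forall z, F z = RtoC 0) -> F b = RtoC 0 -> b <> ap -> b <> am ->
  ~ closure (heteroclinic_region F ap am) b.
Proof.
  intros HF Hnz Hb Hp Hm Hcl.
  assert (Dp : 0 < Cmod (ap - b)) by (apply Cmod_gt_0, Cminus_eq_contra; auto).
  assert (Dm : 0 < Cmod (am - b)) by (apply Cmod_gt_0, Cminus_eq_contra; auto).
  set (r := Rmin (Cmod (ap - b)) (Cmod (am - b)) / 2).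
  assert (Hr : 0 < r /\ 2 * r <= Cmod (ap - b) /\ 2 * r <= Cmod (am - b)).
  { unfold r. pose proof (Rmin_l (Cmod (ap - b)) (Cmod (am - b))). pose proof (Rmin_r (Cmod (ap - b)) (Cmod (am - b))).
    assert (0 < Rmin (Cmod (ap - b)) (Cmod (am - b))) by (apply Rmin_pos; auto). lra. }
  destruct (zero_traps F F' b r HF Hb Hnz) as (r' & Hr' & H); [lra|].
  destruct (closure_near _ _ r' Hcl Hr') as (y & Hy & HyH).
  apply (region_iff F F') in HyH; auto. destruct HyH as (phi & P0 & G & T1 & T2).
  assert (X : forall psi a, tends psi a -> (forall t, 0 <= t -> Cmod (psi t - b) < r) -> 2 * r <= Cmod (a - b) -> False).
  { intros psi a T B D. destruct (T r ltac:(lra)) as [t0 H0].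
    set (t := Rmax 0 t0). specialize (B t (Rmax_l _ _)). specialize (H0 t (Rmax_r _ _)).
    pose proof (Cmod_tri a (psi t) b) as Q. rewrite (Cmod_sym a (psi t)) in Q. lra. }
  destruct (H y Hy) as [S|S].
  - apply (X phi ap); auto; [|lra]. apply (S phi 1); auto; [lra|]. apply global_sol_on; auto.
  - apply (X (fun t => phi (- t)) am); auto; [|lra]. apply (S (fun t => phi (- t)) 1); [lra|rewrite Ropp_0; auto|].
    apply global_sol_on, global_sol_neg; auto.
Qed.

Lemma boundary_orbit_unbounded F F' ap am x : (forall z, hol F z (F' z)) ->
  ~ (forall z, F z = RtoC 0) -> F ap = RtoC 0 -> F am = RtoC 0 -> ap <> am ->
  boundary (heteroclinic_region F ap am) x -> x <> ap -> x <> am -> unbounded (orbit F x).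
Proof.
  intros HF Hnz Hap Ham Hne [Hcl Hint] Hxp Hxm [M HM].
  destruct (Ceq_dec (F x) 0) as [E|E].
  { apply (equilibrium_not_in_closure F F' ap am x); auto. }
  destruct (maximal_exists F F' x HF) as (al & be & phi & Hx).
  destruct (maximal_sol _ _ _ _ _ Hx) as (Z & P0 & S).
  assert (Hb : forall t, between al t be -> Cmod (phi t) <= M).
  { intros t [H1 H2]. apply HM. exists al, be, phi. split; auto. exists t; auto. }
  destruct (maximal_bounded_global F F' x al be phi M HF Hx Hb) as [-> ->].
  assert (G : global_sol F phi) by (intros t; apply S, between_infty).
  rewrite <- P0 in E, Hcl, Hint.
  destruct (bounded_sol_neighbours F F' ap am phi M HF Hap Ham G) as (eta & Heta & H); auto.
  destruct (closure_near _ _ eta Hcl Heta) as (y & Hy & HyH).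
  (* The region point [y] near x puts x into the region, and x in turn puts every nearby z into it,
     so x would be interior. *)
  apply Hint. apply locally_Cmod. exists eta. split; auto. intros z Hz.
  apply H; auto. apply (H y); auto.
Qed.

(** A bound for [phi] on the compact interval from 0 to [t] fixes a Lipschitz constant; continuous
    dependence then approximates [phi t] by points of solutions bounded by [M]. *)
Lemma limit_of_bounded_sols F F' al be phi D M t : (forall z, hol F z (F' z)) ->
  sol_on F al be phi -> between al 0 be -> closure D (phi 0) ->
  (forall y, D y -> exists psi, psi 0 = y /\ global_sol F psi /\ forall s, Cmod (psi s) <= M) ->
  between al t be -> 0 <= t -> Cmod (phi t) <= M.
Proof.
  intros HF S Z Hcl HD Ht Ht0.
  assert (Sp : forall u, 0 <= u <= t -> cder phi u (F (phi u))).
  { intros u Hu. apply S. apply (between_mid al be 0 t); auto. }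
  destruct (ccont_bounded phi 0 t Ht0) as (m & Hm & Hb).
  { intros u Hu. eapply cder_ccont, Sp; auto. }
  assert (HM : 0 <= M).
  { destruct (closure_near _ _ 1 Hcl Rlt_0_1) as (y & _ & Hy). destruct (HD y Hy) as (psi & _ & _ & B).
    eapply Rle_trans; [apply Cmod_ge_0|apply (B 0)]. }
  destruct (lip_on_disc F F' (m + M) HF) as [L HL].
  set (K := exp ((2 * (1 * L) + 1) * t)). assert (HK : 0 < K) by apply exp_pos.
  apply le_epsilon. intros e He.
  destruct (closure_near _ _ (e / K) Hcl) as (y & Hy & HyD); [apply Rdiv_lt_0_compat; auto|].
  destruct (HD y HyD) as (psi & Q0 & G & B).
  assert (Q : Cmod (phi t - psi t) <= Cmod (phi 0 - psi 0) * K).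
  { apply (flow_dist F (m + M) L (fun _ => RtoC 1) 1); auto.
    - intros u _. rewrite Cmod_1. lra.
    - intros u Hu. rewrite Cmult_1_l. split; auto. specialize (Hb u Hu). lra.
    - intros u Hu. rewrite Cmult_1_l. split; auto. specialize (B u). lra. }
  rewrite Q0, (Cmod_sym (phi 0)) in Q.
  assert (Cmod (y - phi 0) * K <= e).
  { apply Rle_trans with (e / K * K); [apply Rmult_le_compat_r; lra|right; field; lra]. }
  pose proof (Cmod_rev (phi t) (psi t)) as W. specialize (B t). lra.
Qed.

Lemma boundary_orbit_bounded F F' ap am M x y : (forall z, hol F z (F' z)) ->
  (forall z, heteroclinic_region F ap am z -> Cmod z <= M) ->
  closure (heteroclinic_region F ap am) x -> orbit F x y -> Cmod y <= M.
Proof.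
  intros HF HM Hcl (al & be & phi & Hx & t & H1 & H2 & <-).
  destruct (maximal_sol _ _ _ _ _ Hx) as (Z & P0 & S).
  (* The region is invariant under time shifts, so a bound on the region bounds whole orbits in
     it. *)
  assert (B : forall y, heteroclinic_region F ap am y ->
    exists psi, psi 0 = y /\ global_sol F psi /\ forall s, Cmod (psi s) <= M).
  { intros y Hy. apply (region_iff F F') in Hy; auto. destruct Hy as (psi & Q0 & Hc).
    exists psi. split; auto. split; [apply Hc|]. intros s. apply HM. apply (region_iff F F'); auto.
    exists (fun t => psi (t + s)). split; [rewrite Rplus_0_l; auto|]. apply connecting_shift; auto. }
  rewrite <- P0 in Hcl. destruct (Rle_dec 0 t) as [Ht|Ht].
  - apply (limit_of_bounded_sols F F' al be phi (heteroclinic_region F ap am) M t); auto. split; auto.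
  - rewrite <- (Ropp_involutive t).
    apply (limit_of_bounded_sols (neg_field F) _ (Rbar_opp be) (Rbar_opp al) (fun t => phi (- t))
      (heteroclinic_region F ap am) M (- t) (hol_neg _ _ HF)).
    + apply sol_on_opp; auto.
    + rewrite <- Ropp_0. apply between_opp; auto.
    + rewrite Ropp_0. auto.
    + intros y Hy. destruct (B y Hy) as (psi & Q0 & G & Hb). exists (fun t => psi (- t)).
      rewrite Ropp_0. split; auto. split; auto. apply global_sol_neg; auto.
    + apply between_opp. split; auto.
    + lra.
Qed.

(** The first exit point of the ray: a limit of points of [D], and outside [D] by openness, which
    also makes its parameter positive. *)
Lemma ray_hits_boundary (D : C -> Prop) x d M : Cmod d = 1 -> D x ->
  (forall y, D y -> exists eta, 0 < eta /\ forall z, Cmod (z - y) < eta -> D z) ->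
  (forall z, D z -> Cmod z <= M) ->
  exists u, 0 < u /\ boundary D (x + RtoC u * d)%C.
Proof.
  intros Hd Hx Hopen HM.
  set (S := fun u => 0 <= u /\ forall v, 0 <= v <= u -> D (x + RtoC v * d)%C).
  assert (Hdist : forall u v, Cmod (x + RtoC u * d - (x + RtoC v * d)) = Rabs (u - v)).
  { intros u v. replace (x + RtoC u * d - (x + RtoC v * d))%C with (RtoC (u - v) * d)%C by (rewrite RtoC_minus; ring).
    rewrite Cmod_mult, Cmod_R, Hd. ring. }
  assert (S0 : S 0).
  { split; [lra|]. intros v Hv. replace v with 0 by lra. replace (x + 0 * d)%C with x by ring. auto. }
  destruct (completeness S) as [s [Hu Hl]].
  { exists (M + Cmod x). intros u [Hu1 Hu2]. specialize (HM _ (Hu2 u ltac:(lra))).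
    pose proof (Cmod_rev (RtoC u * d) (- x)) as Q. rewrite Cmod_opp, Cmod_mult, Cmod_R, Hd, Rabs_pos_eq in Q by auto.
    replace (RtoC u * d - - x)%C with (x + RtoC u * d)%C in Q by ring. lra. }
  { exists 0; auto. }
  assert (Hs0 : 0 <= s) by (apply Hu; auto).
  assert (Below : forall v, 0 <= v < s -> D (x + RtoC v * d)%C).
  { intros v Hv. apply Classical_Prop.NNPP. intros N. assert (s <= v); [|lra]. apply Hl.
    intros u [Hu1 Hu2]. apply Rnot_lt_le. intros L. apply N, Hu2. lra. }
  assert (Out : ~ D (x + RtoC s * d)%C).
  { intros Ds. destruct (Hopen _ Ds) as (eta & Heta & He).
    assert (s + eta / 2 <= s); [|lra]. apply Hu. split; [lra|]. intros v Hv.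
    destruct (Rlt_le_dec v s); [apply Below; lra|]. apply He. rewrite Hdist, Rabs_pos_eq; lra. }
  assert (Hs : 0 < s).
  { destruct (Req_dec s 0) as [E|]; [|lra]. exfalso. apply Out. rewrite E. apply S0. lra. }
  exists s. split; auto. split.
  - intros P HP. apply locally_Cmod in HP. destruct HP as (eta & Heta & HP).
    set (v := Rmax 0 (s - eta / 2)). assert (0 <= v < s /\ s - eta / 2 <= v) by (unfold v, Rmax; destruct Rle_dec; lra).
    exists (x + RtoC v * d)%C. split; [|apply Below; lra]. apply HP. rewrite Hdist, Rabs_left; lra.
  - intros I. apply locally_Cmod in I. destruct I as (eta & Heta & I). apply Out, I.
    rewrite Hdist, Rminus_eq_0, Rabs_R0; auto.
Qed.

Lemma region_unbounded F F' ap am x : (forall z, hol F z (F' z)) ->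
  ~ (forall z, F z = RtoC 0) -> F ap = RtoC 0 -> F am = RtoC 0 -> ap <> am ->
  heteroclinic_region F ap am x -> unbounded (heteroclinic_region F ap am).
Proof.
  intros HF Hnz Hap Ham Hne Hx [M HM].
  (* A boundary point other than the ends has an unbounded orbit, yet a bounded region bounds it; so
     each ray must hit an end. *)
  assert (Ray : forall d, Cmod d = 1 -> exists u, 0 < u /\ (x + RtoC u * d = ap \/ x + RtoC u * d = am)%C).
  { intros d Hd. destruct (ray_hits_boundary (heteroclinic_region F ap am) x d M Hd Hx) as (u & Hu & Hb); auto.
    { intros y Hy. apply (region_open F F'); auto. }
    exists u. split; auto. apply Classical_Prop.NNPP. intros N.
    apply (boundary_orbit_unbounded F F' ap am (x + RtoC u * d)%C); auto.
    exists M. intros z Hz. apply (boundary_orbit_bounded F F' ap am M (x + RtoC u * d)%C); auto. apply Hb. }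
  (* Rays from the same point in independent or opposite directions meet only at their origin, so
     three of them give three distinct points where just two are available. *)
  assert (Ne : forall u v (d1 d2 : C), 0 < u -> 0 < v -> (fst d1 * snd d2 <> snd d1 * fst d2 \/ d2 = (- d1)%C /\ d1 <> RtoC 0) ->
    (x + RtoC u * d1)%C <> (x + RtoC v * d2)%C).
  { intros u v d1 d2 Hu Hv Hd E.
    assert (E' : (RtoC u * d1 = RtoC v * d2)%C).
    { apply Ceq_minus. apply Ceq_minus in E. rewrite <- E. ring. }
    pose proof (f_equal fst E') as E1. pose proof (f_equal snd E') as E2. simpl in E1, E2.
    destruct Hd as [Hd|[-> Hd]].
    - apply Hd. apply (Rmult_eq_reg_l (u * v)); [|nra].
      replace (u * v * (fst d1 * snd d2)) with ((u * fst d1 - 0 * snd d1) * (v * snd d2 + 0 * fst d2)) by ring.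
      rewrite E1, <- E2. ring.
    - apply Hd. simpl in E1, E2. destruct d1 as [p q]; simpl in *.
      assert (p = 0) by nra. assert (q = 0) by nra. subst. reflexivity. }
  destruct (Ray (RtoC 1)) as (u1 & Hu1 & P1); [apply Cmod_1|].
  destruct (Ray (- RtoC 1)%C) as (u2 & Hu2 & P2); [rewrite Cmod_opp; apply Cmod_1|].
  destruct (Ray Ci) as (u3 & Hu3 & P3); [apply Cmod_Ci|].
  pose proof (Ne u1 u2 (RtoC 1) (- RtoC 1)%C Hu1 Hu2 ltac:(right; split; auto; apply C1_nz)) as N12.
  pose proof (Ne u1 u3 (RtoC 1) Ci Hu1 Hu3 ltac:(left; simpl; lra)) as N13.
  pose proof (Ne u2 u3 (- RtoC 1)%C Ci Hu2 Hu3 ltac:(left; simpl; lra)) as N23.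
  destruct P1, P2, P3; congruence.
Qed.

Theorem theorem5p5 : forall (F : C -> C) (ap am : C),
  entire F ->
  ~ (forall z : C, F z = RtoC 0) ->
  ap <> am ->
  equilibrium F ap ->
  equilibrium F am ->
  (exists G : C -> Prop, is_orbit F G /\ connects F G ap am) ->
  (forall x : C,
     boundary (heteroclinic_region F ap am) x -> x <> ap -> x <> am ->
     unbounded (orbit F x)) /\
  unbounded (heteroclinic_region F ap am).
Proof.
  intros F ap am HE Hnz Hne Hap Ham (G & (x & Gx) & Cp & Cm).
  destruct (entire_hol F HE) as [F' HF]. unfold equilibrium in Hap, Ham. split.
  - intros y. apply (boundary_orbit_unbounded F F'); auto.
  (* [G] equals the orbit of [x] only extensionally, so membership of the base point is transferred
     inside each limit set. *)
  - apply (region_unbounded F F' ap am x); auto. split; intros y.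
    + rewrite <- (Cp y). split; intros (x' & al & be & phi & t & Hx & H); exists x', al, be, phi, t;
        (split; [apply Gx; exact Hx|exact H]).
    + rewrite <- (Cm y). split; intros (x' & al & be & phi & t & Hx & H); exists x', al, be, phi, t;
        (split; [apply Gx; exact Hx|exact H]).
Qed.
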